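(* Consider an urn model with a balanced (all row sums equal $1$), block upper triangular replacement matrix $R$ with nonnegative entries and $K+1$ blocks, which is in the increasing order, with $J+1$ clusters having indices of running maxima $\{i_j\}_{1\le j\le J+1}$, leading characters $\{\lambda_j\}_{1\le j\le J+1}$ and orders $\{\kappa_j\}_{1\le j\le J+1}$. Assume further that, for every $j$ with $\lambda_j>0$ and $\kappa_j>0$, at least one of the submatrices $Q_{m i_j}$, $i_{j-1}\le m\le i_j-1$, is nonzero. Let $W_k$, $w_j$, $\pi^{(k)}$ be as defined in the context. Then there exist nondegenerate random variables $V_j$, one for each $j\in\{1,\dots,J\}$ with $\lambda_j>0$, such that for every $k\in\{1,\dots,K\}$, with $j\in\{1,\dots,J\}$ determined by $i_j\le k<i_{j+1}$, as $N\to\infty$, $$\frac{1}{N^{\lambda_j}\log^{\kappa_j}N}\,C_N^{(k)}\to\begin{cases}\displaystyle \frac1{\kappa_j!}\,C_0^{(1)}\prod_{m=1}^{i_{j-1}}Q_{m,m+1},&\text{if }\lambda_j=0,\\[2mm] V_j\,\pi^{(i_j)}W_k,&\text{if }\lambda_j>0,\end{cases}$$ almost surely and in $L^2$, where for $j=1$ (when $\lambda_1=0$) the product is interpreted as the identity matrix. Furthermore, for $j\in\{1,\dots,J\}$ with $\lambda_j>0$ and $\kappa_j>0$, $$V_j=w_jV_{j-1}.$$ Finally, for the last block, $$\frac1N C_N^{(K+1)}\to\pi^{(K+1)}\quad\text{almost surely and in }L^2.$$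
   Context: Urn model: there are $D$ colors. The replacement matrix $R=((r_{ij}))$ is a non-random $D\times D$ matrix with nonnegative real entries and all row sums equal to $1$. The row vector of initial color counts $C_0$ is a (deterministic) probability vector with all components strictly positive. $C_N$ denotes the row vector of color counts after the $N$-th trial. At the $N$-th trial, $N\ge1$, given the past, color $i$ is selected with probability $C_{N-1,i}/N$; if color $i$ is selected then $C_{N,j}=C_{N-1,j}+r_{ij}$ for all $j$. Blocks: the colors are partitioned into $K+1$ consecutive blocks, the $k$-th containing $d_k$ colors; $Q_{kl}$ is the corresponding $d_k\times d_l$ submatrix of $R$, $Q_{kl}=0$ for $k>l$, $Q_k:=Q_{kk}$, and each $Q_k$ is either irreducible or a zero matrix. $C_N^{(k)}$ is the subvector of $C_N$ corresponding to the $k$-th block. A square nonnegative matrix $Q$ is irreducible if for all $i,j$ there is $n=n(i,j)\ge1$ with the $(i,j)$ entry of $Q^n$ strictly positive. The character $\mu_k$ of the $k$-th block is the Perron-Frobenius eigenvalue of $Q_k$ if $Q_k$ is irreducible, and $0$ if $Q_k=0$. Running maxima, clusters: $1=i_1<i_2<\cdots<i_{J+1}$ are the indices of the running maxima of the characters: $\mu_1=\mu_{i_1}\le\mu_{i_2}\le\cdots\le\mu_{i_{J+1}}$, and $\mu_k<\mu_{i_j}$ whenever $i_j<k<i_{j+1}$ with $j\le J$ or $i_{J+1}<k\le K+1$ with $j=J+1$. Since $R$ is balanced, $\mu_{K+1}=1$ and $i_{J+1}=K+1$. For $j=1,\dots,J$ the $j$-th cluster consists of the blocks $i_j,i_j+1,\dots,i_{j+1}-1$;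 the $(J+1)$-th cluster is the block $K+1$ alone. The $i_j$-th block is the leading block of the $j$-th cluster; the other blocks are non-leading. The leading character is $\lambda_j=\mu_{i_j}$ and its order is $\kappa_j=\#\{j'<j:\lambda_{j'}=\lambda_j\}$. Increasing order: $R$ is in the increasing order if (i) all non-leading zero diagonal blocks are scalar ($1\times1$); (ii) for every non-leading block $k$, $i_j<k<i_{j+1}$, $j=1,\dots,J$, at least one of the submatrices $Q_{mk}$, $i_j\le m\le k-1$, is nonzero; (iii) if $\lambda_j=0$ and $\kappa_j>0$ for some $j=2,\dots,J$, then each column of $Q_{i_j-1,i_j}$ is nonzero. Eigenvectors: for irreducible $Q_k$, $\pi^{(k)}$ (row) and $\zeta^{(k)}$ (column) are the left and right eigenvectors of $Q_k$ for the Perron-Frobenius eigenvalue $\mu_k$, normalized so that $\pi^{(k)}\mathbf 1=1=\pi^{(k)}\zeta^{(k)}$, where $\mathbf 1$ is the column vector of ones. Matrices $W_k$: if $k=i_j$ is a leading block, $W_k=I$, the identity of order $d_k$; if $i_j<k<i_{j+1}$ for some $j\le J$, then inductively $W_k=\sum_{m=i_j}^{k-1}W_mQ_{mk}(\lambda_jI-Q_k)^{-1}$, a $d_{i_j}\times d_k$ matrix. Constants $w_j$: $w_j=1$ if $\lambda_j=0$ or $\kappa_j=0$; otherwise $w_j=\frac1{\kappa_j}\,\pi^{(i_{j-1})}\sum_{m=i_{j-1}}^{i_j-1}W_mQ_{mi_j}\zeta^{(i_j)}$. *)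

(* Defs.v *)
From HB Require Import structures.
Set Warnings "-notation-overridden,-notation-incompatible-prefix,-ambiguous-paths".
From mathcomp Require Import all_boot all_order all_algebra.
From mathcomp Require Import complex.
From mathcomp Require Import all_classical all_reals all_analysis.
Import Order.TTheory GRing.Theory Num.Theory.
Import numFieldNormedType.Exports.

Set Implicit Arguments.
Unset Strict Implicit.
Unset Printing Implicit Defensive.

Local Open Scope classical_set_scope.
Local Open Scope ring_scope.

(* Blocks are numbered 0, ..., K and clusters 0, ..., J, so every index is one
   less than in the mathematical text.  Block k has d k colors, the colors are
   the ordinals below \sum_k d k, and Q_{kl} is [submxblock M k l]. *)

Definition irreducible_mx (R : realType) (n : nat) (Q : 'M[R]_n) : Prop :=
  forall a b : 'I_n, exists2 m : nat, (0 < m)%N & 0 < (Q ^+ m) a b.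

(* An eigenvalue that equals the spectral radius: all complex eigenvalues have
   modulus at most mu. *)
Definition perron_frobenius_eigenvalue (R : realType) (n : nat)
    (Q : 'M[R]_n) (mu : R) : Prop :=
  eigenvalue Q mu /\
  forall z : R[i], eigenvalue (map_mx (real_complex R) Q) z ->
    `|z| <= real_complex R mu.

Definition is_character (R : realType) (n : nat) (Q : 'M[R]_n) (mu : R) :
    Prop :=
  (irreducible_mx Q -> perron_frobenius_eigenvalue Q mu) /\ (Q = 0 -> mu = 0).

Definition normalized_eigenvectors (R : realType) (n : nat) (Q : 'M[R]_n)
    (mu : R) (pi : 'rV[R]_n) (zeta : 'cV[R]_n) : Prop :=
  [/\ pi *m Q = mu *: pi,
      Q *m zeta = mu *: zeta,
      pi *m (const_mx 1 : 'cV[R]_n) = 1%:M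
    & pi *m zeta = 1%:M].

Definition balanced (R : realType) (D : nat) (M : 'M[R]_D) : Prop :=
  forall a : 'I_D, \sum_b M a b = 1.

Definition block_upper_triangular (R : realType) (K : nat)
    (d : 'I_K.+1 -> nat) (M : 'M[R]_(\sum_k d k)) : Prop :=
  (forall k l : 'I_K.+1, (l < k)%N -> submxblock M k l = 0) /\
  (forall k : 'I_K.+1,
     irreducible_mx (submxblock M k k) \/ submxblock M k k = 0).

(* The first block after cluster j; K.+1 for the last cluster. *)
Definition cluster_end (K J : nat) (i : 'I_J.+1 -> 'I_K.+1) (j : 'I_J.+1) :
    nat :=
  if (j < J)%N then nat_of_ord (i (inord j.+1)) else K.+1.

(* The index j - 1; only meaningful for 0 < j. *)
Definition previous (n : nat) (j : 'I_n.+1) : 'I_n.+1 := inord j.-1.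

Definition running_maxima (R : realType) (K J : nat) (mu : 'I_K.+1 -> R)
    (i : 'I_J.+1 -> 'I_K.+1) : Prop :=
  [/\ i ord0 = ord0,
      forall j j' : 'I_J.+1, (j < j')%N -> (i j < i j')%N,
      forall j j' : 'I_J.+1, (j <= j')%N -> mu (i j) <= mu (i j')
    & forall (j : 'I_J.+1) (k : 'I_K.+1),
        (i j < k < cluster_end i j)%N -> mu k < mu (i j)].

Definition cluster_order (R : realType) (J : nat) (lambda : 'I_J.+1 -> R)
    (j : 'I_J.+1) : nat :=
  #|[set j' : 'I_J.+1 | (j' < j)%N && (lambda j' == lambda j)]%SET|.

Definition increasing_order (R : realType) (K J : nat) (d : 'I_K.+1 -> nat)
    (M : 'M[R]_(\sum_k d k)) (mu : 'I_K.+1 -> R) (i : 'I_J.+1 -> 'I_K.+1) :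
    Prop :=
  let lambda j := mu (i j) in
  [/\ forall k : 'I_K.+1, (forall j, k != i j) ->
        submxblock M k k = 0 -> d k = 1%N,
      forall (j : 'I_J.+1) (k : 'I_K.+1), (j < J)%N ->
        (i j < k < cluster_end i j)%N ->
        exists2 m : 'I_K.+1, (i j <= m < k)%N & submxblock M m k != 0
    & forall j : 'I_J.+1, (0 < j < J)%N ->
        lambda j = 0 -> (0 < cluster_order lambda j)%N ->
        forall c, col c (submxblock M (previous (i j)) (i j)) != 0].

(* W j k is W_k for a block k of cluster j; it is unconstrained for the other
   pairs (j, k).  The inverted matrix is invertible because mu k < mu (i j) and
   mu k is the spectral radius of Q_k. *)
Definition is_cluster_W (R : realType) (K J : nat) (d : 'I_K.+1 -> nat)
    (M : 'M[R]_(\sum_k d k)) (mu : 'I_K.+1 -> R) (i : 'I_J.+1 -> 'I_K.+1)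
    (W : forall (j : 'I_J.+1) (k : 'I_K.+1), 'M[R]_(d (i j), d k)) : Prop :=
  forall j : 'I_J.+1,
    W j (i j) = 1%:M /\
    forall k : 'I_K.+1, (j < J)%N -> (i j < k < cluster_end i j)%N ->
      W j k = \sum_(m < K.+1 | (i j <= m < k)%N)
        W j m *m submxblock M m k *m
        invmx ((mu (i j))%:M - submxblock M k k).

Definition cluster_w (R : realType) (K J : nat) (d : 'I_K.+1 -> nat)
    (M : 'M[R]_(\sum_k d k)) (mu : 'I_K.+1 -> R) (i : 'I_J.+1 -> 'I_K.+1)
    (pi : forall k, 'rV[R]_(d k)) (zeta : forall k, 'cV[R]_(d k))
    (W : forall (j : 'I_J.+1) (k : 'I_K.+1), 'M[R]_(d (i j), d k))
    (j : 'I_J.+1) : R :=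
  let lambda j := mu (i j) in
  let kappa := cluster_order lambda in
  if (lambda j == 0) || (kappa j == 0%N) then 1
  else (kappa j)%:R^-1 *
    (pi (i (previous j)) *m
     (\sum_(m < K.+1 | (i (previous j) <= m < i j)%N)
        W (previous j) m *m submxblock M m (i j)) *m
     zeta (i j)) 0 0.

(* Q_{0,1} Q_{1,2} ... Q_{n-1,n}, for l the block n.  The last block l is a
   parameter of its own so that the result has the type 'M_(d ord0, d l) with
   no cast; for n = 0 and l = ord0 the value [pid_mx (d ord0)] is 1%:M. *)
Fixpoint superdiagonal_prod (R : realType) (K : nat) (d : 'I_K.+1 -> nat)
    (M : 'M[R]_(\sum_k d k)) (n : nat) (l : 'I_K.+1) : 'M[R]_(d ord0, d l) :=
  if n is n'.+1 then
    superdiagonal_prod M n' (inord n') *m submxblock M (inord n') l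
  else pid_mx (d ord0).

(* The number of factors in the product of the Q_{m,m+1}, from the first block
   up to m = i_{j-1}, which is an empty product for the first cluster. *)
Definition nb_factors (K J : nat) (i : 'I_J.+1 -> 'I_K.+1) (j : 'I_J.+1) :
    nat :=
  if j == ord0 then 0%N else (i (previous j)).+1.

(* The color counts after N trials when color h n is selected at trial n + 1. *)
Fixpoint color_counts (R : realType) (D : nat) (M : 'M[R]_D) (C0 : 'rV[R]_D)
    (h : nat -> 'I_D) (N : nat) : 'rV[R]_D :=
  if N is n.+1 then color_counts M C0 h n + row (h n) M else C0.

(* X n is the color selected at trial n + 1.  The past before trial N + 1 is
   generated by the events {X 0 = h 0, ..., X (N - 1) = h (N - 1)},
   so the conditional law of X N given the past is given by its values on
   these events; the equation is multiplied out to cover null events. *)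
Definition urn_selection (R : realType) (disp : measure_display)
    (T : measurableType disp) (P : probability T R) (D : nat) (M : 'M[R]_D)
    (C0 : 'rV[R]_D) (X : nat -> T -> 'I_D) : Prop :=
  (forall (n : nat) (c : 'I_D), measurable (X n @^-1` [set c])) /\
  forall (N : nat) (h : nat -> 'I_D) (c : 'I_D),
    let past := [set t | forall n, (n < N)%N -> X n t = h n] in
    P (past `&` X N @^-1` [set c]) =
    ((color_counts M C0 h N 0 c / N.+1%:R)%:E * P past)%E.

Definition nondegenerate_rv (R : realType) (disp : measure_display)
    (T : measurableType disp) (P : probability T R) (V : T -> R) : Prop :=
  forall c : R, ~ {ae P, forall t, V t = c}.

Definition cvg_as_and_L2 (R : realType) (disp : measure_display)
    (T : measurableType disp) (P : probability T R) (n : nat)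
    (Y : nat -> T -> 'rV[R]_n) (L : T -> 'rV[R]_n) : Prop :=
  {ae P, forall t, (fun N => Y N t) @ \oo --> L t} /\
  forall c : 'I_n,
    (fun N => 'N[P]_2%:E [(fun t => (Y N t 0 c - L t 0 c)%:E)])%E @ \oo -->
    (0 : \bar R).

(* Main.v *)
(* The counts satisfy C_(N+1) = C_N + C_N R / (N+1) + xi_N, where xi_N is a
   martingale difference.  Divide the blocks of cluster j by
     a_N = prod_(n < N) (1 + lambda_j / (n+1)) * (1 + sum_(n < N) 1 / (n+1))^kappa_j.
   The mean of such a block is O(a_N), so the divided noise is summed to a
   martingale bounded in L^2; Doob's inequality bounds it along the path and
   makes it converge.  Once the noise is fixed, the recursion is deterministic.
   A nonleading block contracts, in an l1 norm weighted by a positive right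
   eigenvector, to its drift times (lambda_j - Q_k)^-1.  A leading block contracts
   onto the line spanned by pi; its component along zeta converges, because the
   drift is summable if kappa_j = 0, and because it averages the drift out of the
   previous cluster if kappa_j > 0, which is where the factor w_j comes from.

   If kappa_j = 0, there is a right eigenvector u of R for lambda_j that equals
   zeta on the leading block and vanishes on all later ones, so C_N u / a_N is a
   martingale with limit proportional to V_j.  If V_j were constant, conditioning
   on the first color would make u constant; but u vanishes on the last block.
   If kappa_j > 0, nondegeneracy follows from V_j = w_j V_(j-1) and w_j > 0. *)
Require Import Defs.
Set Warnings "-notation-overridden,-notation-incompatible-prefix,-ambiguous-paths".
From mathcomp Require Import all_boot all_order all_algebra.
From mathcomp Require Import ring lra.
From mathcomp Require Import complex.
From mathcomp Require Import all_classical all_reals all_analysis.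
From mathcomp Require Import measurable_realfun.
Import Order.TTheory GRing.Theory Num.Theory.
Import numFieldNormedType.Exports.

Set Implicit Arguments.
Unset Strict Implicit.
Unset Printing Implicit Defensive.

Local Open Scope classical_set_scope.
Local Open Scope ring_scope.

(** * Normalizing sequences *)

(** The divided noise is summable only conditionally, so its absolute values may never be summed.
    Outside order 0, a recursion is therefore compared with a shift having the same noise
    increments; the difference obeys a noise-free inequality u(N+1) <= (1 - gam) u(N) + gam eps,
    where the product of the 1 - gam tends to 0. It serves scalars (gam = g / ell, which yields 1 /
    kappa) and vectors (gam proportional to g, in a suitable seminorm).

    The bounds on blocks are linear in a number B that bounds the initial state and the partial sums
    of the noise, with constants independent of the path. They are used twice: with zero noise on
    the mean counts, which gives the variance estimate and hence convergence of the noise; then on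
    random paths, where B is square integrable and gives the domination behind the L^2 limits.

    Perron-Frobenius theory is derived from nonnegativity of the resolvent above mu. The exact
    products in place of N^lambda keep the normalized recursions free of remainder terms; powers of
    N and log N return only at the end. *)

Definition step (R : realType) (n : nat) : R := n.+1%:R^-1.

(** This solves the scalar mean recursion exactly and is asymptotic to N^l / Gamma(1 + l). *)
Definition growth (R : realType) (l : R) (N : nat) : R :=
  \prod_(n < N) (1 + l * step R n).

(** The added 1 keeps [ell] positive at N = 0, so that one may divide by [scale] at every index, and
    gives [scale] the value 1 there. *)
Definition ell (R : realType) (N : nat) : R := 1 + \sum_(n < N) step R n.

Definition scale (R : realType) (l : R) (k N : nat) : R :=
  growth l N * ell R N ^+ k.

Section Normalizers.
Variable R : realType.
Implicit Types (l : R) (k N n : nat).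

Local Notation g := (step R).

Lemma step_gt0 n : 0 < g n.
Proof. by rewrite invr_gt0 ltr0n. Qed.

Lemma step_ge0 n : 0 <= g n.
Proof. exact/ltW/step_gt0. Qed.

Lemma step_le1 n : g n <= 1.
Proof. by rewrite invf_le1 ?ltr0n// ler1n. Qed.

Lemma step_cvg0 : g @ \oo --> (0 : R).
Proof. exact: cvg_harmonic. Qed.

Lemma ellS N : ell R N.+1 = ell R N + g N.
Proof. by rewrite /ell big_ord_recr /= addrA. Qed.

Lemma ell_ge1 N : 1 <= ell R N.
Proof. by rewrite lerDl sumr_ge0 // => n _; exact: step_ge0. Qed.

Lemma ell_gt0 N : 0 < ell R N.
Proof. exact: lt_le_trans (ell_ge1 N). Qed.

Lemma ell_neq0 N : ell R N != 0.
Proof. by rewrite gt_eqF ?ell_gt0. Qed.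

Lemma ell_leS N : ell R N <= ell R N.+1.
Proof. by rewrite ellS lerDl step_ge0. Qed.

Lemma ell_geln N : 1 + ln N.+1%:R <= ell R N.
Proof.
elim: N => [|N IH]; first by rewrite ln1 addr0 ell_ge1.
rewrite ellS; apply: le_trans (lerD IH (lexx _)).
rewrite -addrA lerD2l addrC -lerBlDr -ln_div ?posrE ?ltr0n//.
have -> : N.+2%:R / N.+1%:R = 1 + g N :> R.
  by rewrite -(natr1 N.+1) mulrDl divff ?pnatr_eq0// mul1r.
by rewrite le_ln1Dx// (lt_trans _ (step_gt0 N))// ltrN10.
Qed.

Lemma ell_leln N : ell R N.+1 <= 2 + ln N.+1%:R.
Proof.
elim: N => [|N IH].
  by rewrite /ell big_ord1 /step ln1 addr0 invr1 lexx.
rewrite ellS (le_trans (lerD IH (lexx _)))// -addrA lerD2l.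
have hx : 0 < N.+1%:R / N.+2%:R :> R by rewrite divr_gt0 ?ltr0n.
have -> : ln (N.+2%:R : R) = ln N.+1%:R - ln (N.+1%:R / N.+2%:R).
  by rewrite ln_div ?posrE ?ltr0n// opprB addrC subrK.
rewrite lerD2l lerNr.
have -> : N.+1%:R / N.+2%:R = 1 + - g N.+1 :> R.
  rewrite /step -[N.+1%:R](addrK 1) natr1 mulrBl divff ?pnatr_eq0//.
  by rewrite mul1r.
rewrite le_ln1Dx// ltrN2 /step invf_lt1 ?ltr0n// ltr1n//.
Qed.

Lemma ell_cvgy : ell R @ \oo --> +oo.
Proof.
have ns : nondecreasing_seq (series (@harmonic R)).
  by apply/nondecreasing_seqP => n; rewrite seriesSr lerDl harmonic_ge0.
have /cvgryPge h := nondecreasing_dvgn_lt ns (@dvg_harmonic R).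
apply/cvgryPge => A; near=> n.
rewrite /ell; apply: (@le_trans _ _ (series (@harmonic R) n)).
  by near: n; exact: h.
by rewrite seriesEord lerDr.
Unshelve. all: by end_near. Qed.

Lemma ellV_cvg0 : (fun N => (ell R N)^-1) @ \oo --> (0 : R).
Proof.
apply/gtr0_cvgV0; first by apply: nearW => n; exact: ell_gt0.
exact: ell_cvgy.
Qed.

Lemma growthS l N : growth l N.+1 = growth l N * (1 + l * g N).
Proof. by rewrite /growth big_ord_recr. Qed.

Lemma growth_factor_gt0 l n : 0 <= l -> 0 < 1 + l * g n.
Proof. by move=> l0; rewrite ltr_wpDr// mulr_ge0 ?step_ge0. Qed.

Lemma growth_gt0 l N : 0 <= l -> 0 < growth l N.
Proof. by move=> l0; rewrite prodr_gt0// => n _; exact: growth_factor_gt0. Qed.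

Lemma growth_leS l N : 0 <= l -> growth l N <= growth l N.+1.
Proof.
move=> l0; rewrite growthS ler_peMr ?growth_gt0//; first exact/ltW/growth_gt0.
by rewrite lerDl mulr_ge0 ?step_ge0.
Qed.

Lemma growth_ge1 l N : 0 <= l -> 1 <= growth l N.
Proof.
move=> l0; elim: N => [|N IH]; first by rewrite /growth big_ord0.
exact: le_trans IH (growth_leS _ l0).
Qed.

Lemma growth0 N : growth (0 : R) N = 1.
Proof. by rewrite /growth big1// => n _; rewrite mul0r addr0. Qed.

Lemma growth1 N : growth (1 : R) N = N.+1%:R.
Proof.
elim: N => [|N IH]; first by rewrite /growth big_ord0.
by rewrite growthS IH mul1r /step mulrDr mulr1 divff ?pnatr_eq0// natr1.
Qed.

Lemma scale_gt0 l k N : 0 <= l -> 0 < scale l k N.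
Proof. by move=> l0; rewrite mulr_gt0 ?growth_gt0 ?exprn_gt0 ?ell_gt0. Qed.

Lemma scale_leS l k N : 0 <= l -> scale l k N <= scale l k N.+1.
Proof.
move=> l0; rewrite ler_pM ?growth_leS ?exprn_ge0 ?(ltW (ell_gt0 _))//.
  exact/ltW/growth_gt0.
by rewrite lerXn2r ?nnegrE ?ell_leS// ltW ?ell_gt0.
Qed.

(** Since (1 - x) (1 + x) <= 1, the product is at most 1 / [growth], and [growth] is at least l
    times the divergent [ell]. *)
Lemma prod_contraction_cvg0 l : 0 < l < 1 ->
  (fun N => \prod_(n < N) (1 - l * g n)) @ \oo --> (0 : R).
Proof.
move=> /andP[l0 l1].
have pos n : 0 < 1 - l * g n.
  by rewrite subr_gt0 (le_lt_trans _ l1)// ler_piMr ?step_le1// ltW.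
have gr N : l * ell R N <= growth l N.
  elim: N => [|N IH].
    by rewrite /growth /ell !big_ord0 addr0 mulr1 ltW.
  rewrite growthS ellS (mulrDr l) (mulrDr (growth l N)) mulr1; apply: lerD => //.
  by rewrite ler_peMl ?growth_ge1 ?mulr_ge0 ?step_ge0// ltW.
apply: (@squeeze_cvgr _ _ _ _ (fun=> 0) (fun N => l^-1 * (ell R N)^-1)).
- apply: nearW => N; rewrite prodr_ge0/=; last by move=> n _; exact: ltW.
  rewrite -invfM -div1r ler_pdivlMr ?mulr_gt0 ?ell_gt0//.
  apply: (@le_trans _ _ (\prod_(n < N) (1 - l * g n) * growth l N)).
    by rewrite ler_wpM2l// prodr_ge0// => n _; exact: ltW.
  rewrite /growth -big_split/=; apply: prodr_ile1 => n _.
  rewrite mulr_ge0 ?(ltW (pos _)) ?addr_ge0 ?mulr_ge0 ?step_ge0// ?(ltW l0)//=.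
  by have := sqr_ge0 (l * g n); lra.
- exact: cvg_cst.
- by rewrite -(mulr0 l^-1); apply: cvgMr; exact: ellV_cvg0.
Unshelve. all: by end_near. Qed.

End Normalizers.

(** * Comparison of normalizing sequences *)

Section Comparison.
Variable R : realType.
Implicit Types (l : R) (k N n : nat).
Local Notation g := (step R).

(** Follows from exp (- x / 2) >= 1 - x / 2 and (1 + x) (1 - x / 2) >= 1. It bounds [growth] below
    by an exponential of [ell], which beats every power of [ell]. *)
Lemma expR_half_le (x : R) : 0 <= x <= 1 -> expR (x / 2) <= 1 + x.
Proof.
move=> /andP[x0 x1].
have h : 1 - x / 2 <= expR (- (x / 2)).
  by apply: le_trans (expR_ge1Dx _); rewrite lexx.
rewrite expRN in h.
have e0 := expR_gt0 (x / 2).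
have : (1 - x / 2) * expR (x / 2) <= 1.
  by rewrite -ler_pdivlMr// div1r.
set e := expR _ in e0 *.
move=> h2.
have h3 : (1 + x) * ((1 - x / 2) * e) <= 1 + x.
  by rewrite -[leRHS]mulr1; apply: ler_wpM2l => //; lra.
apply: le_trans h3.
have : 1 <= (1 + x) * (1 - x / 2) by nra.
rewrite mulrA => h4; rewrite ler_peMl//; exact: ltW.
Qed.

Lemma growth_ge_exp l N : 0 <= l <= 1 ->
  expR (l / 2 * (ell R N - 1)) <= growth l N.
Proof.
move=> /andP[l0 l1]; elim: N => [|N IH].
  by rewrite /growth /ell !big_ord0 addr0 subrr mulr0 expR0.
rewrite growthS ellS.
have -> : l / 2 * (ell R N + g N - 1) = l / 2 * (ell R N - 1) + l * g N / 2 by ring.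
rewrite expRD ler_pM ?expR_ge0// expR_half_le//.
by rewrite mulr_ge0 ?step_ge0//= mulr_ile1 ?step_ge0 ?step_le1.
Qed.

(** Half of the gap l - l' becomes a factor [growth d], since (1 + l' x) (1 + d x) <= 1 + l x for x
    in [0, 1]; that factor is exponential in [ell]. One spare power of [ell] is absorbed, which
    later provides a decay 1 / [ell]. *)
Lemma growth_dominated l' l k : 0 <= l' -> l' < l -> l <= 1 ->
  exists2 C : R, 0 <= C & forall N,
    growth l' N * ell R N ^+ k.+1 <= C * growth l N.
Proof.
move=> l'0 ll l1.
have [d d0 lE] : exists2 d, 0 < d & l = l' + 2 * d.
  by exists ((l - l') / 2); [rewrite divr_gt0 ?subr_gt0|field].
have q N : growth l' N * growth d N <= growth l N.
  rewrite /growth -big_split/=; apply: ler_prod => n _.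
  have g0 := step_ge0 R n; have g1 := step_le1 R n.
  rewrite mulr_ge0 ?addr_ge0 ?mulr_ge0 ?(ltW d0)//=.
  rewrite lE.
  have : l' * g n * (d * g n) <= d * g n.
    apply: ler_piMl; first exact: mulr_ge0 (ltW d0) g0.
    by apply: mulr_ile1 => //; exact: ltW (lt_le_trans ll l1).
  by move=> ?; nra.
have [c c0 dE] : exists2 c, 0 < c & d = 2 * c.
  by exists (d / 2); [rewrite divr_gt0|field].
have ex N : (c * ell R N) ^+ k.+1 <= (k.+1)`!%:R * (expR c * growth d N).
  have := expR_ge1Dxn k (mulr_ge0 (ltW c0) (ltW (ell_gt0 R N))).
  move=> h; have {}h : (c * ell R N) ^+ k.+1 / (k.+1)`!%:R <= expR (c * ell R N).
    by apply: le_trans h; rewrite lerDr.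
  move: h; rewrite ler_pdivrMr ?ltr0n ?fact_gt0// [leRHS]mulrC => h.
  apply: le_trans h _; rewrite ler_wpM2l//.
  have -> : c * ell R N = c + d / 2 * (ell R N - 1) by rewrite dE; field.
  rewrite expRD ler_wpM2l ?expR_ge0// growth_ge_exp//.
  by rewrite ltW//=; lra.
exists ((k.+1)`!%:R * expR c / c ^+ k.+1).
  by rewrite divr_ge0 ?mulr_ge0 ?expR_ge0 ?exprn_ge0 ?(ltW c0).
move=> N.
rewrite mulrAC ler_pdivlMr ?exprn_gt0// -mulrA -exprMn.
rewrite (mulrC (ell R N)).
apply: (le_trans (ler_wpM2l _ (ex N))); first exact/ltW/growth_gt0.
have h : 0 <= (k.+1)`!%:R * expR c by rewrite mulr_ge0 ?expR_ge0.
apply: le_trans (ler_wpM2l h (q N)).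
rewrite le_eqVlt; apply/orP; left; apply/eqP; ring.
Qed.

(** The pairs (l, k) are compared lexicographically; in both cases the ratio is O(1 / [ell]). *)
Lemma scale_ratio_cvg0 l' k' l k : 0 <= l' -> l <= 1 ->
  (l' < l) || ((l' == l) && (k' < k)%N) ->
  (fun N => scale l' k' N / scale l k N) @ \oo --> (0 : R).
Proof.
move=> l'0 l1 H.
have l0 : 0 <= l by case/orP: H => [/ltW|/andP[/eqP <- _]//]; exact: le_trans.
suff [C C0 hC] : exists2 C : R, 0 <= C & forall N,
    scale l' k' N / scale l k N <= C * (ell R N)^-1.
  apply: (@squeeze_cvgr _ _ _ _ (fun=> 0) (fun N => C * (ell R N)^-1)).
  - apply: nearW => N; rewrite hC andbT.
    by rewrite divr_ge0// ltW// scale_gt0.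
  - exact: cvg_cst.
  - by rewrite -(mulr0 C); apply: cvgMl_tmp; exact: ellV_cvg0.
case/orP: H => [ll|/andP[/eqP <- kk]].
  have [C C0 hC] := growth_dominated k' l'0 ll l1.
  exists C => // N.
  rewrite ler_pdivrMr ?scale_gt0// mulrAC ler_pdivlMr ?ell_gt0//.
  rewrite /scale -mulrA -exprSr (le_trans (hC N))//.
  by rewrite ler_wpM2l// ler_peMr ?exprn_ege1 ?ell_ge1// ltW// growth_gt0.
exists 1 => // N; rewrite mul1r.
rewrite ler_pdivrMr ?scale_gt0// mulrC ler_pdivlMr ?ell_gt0//.
rewrite /scale -mulrA -exprSr ler_wpM2l//.
  by rewrite ltW// growth_gt0.
by rewrite ler_weXn2l ?ell_ge1.
Qed.

(** The logarithms are absorbed by moving from l' to the midpoint m. The ratio q = growth m / growth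
    l then drops by at least g q (l - m) / 2 at each step, so the series is bounded by a telescoping
    sum. *)
Lemma growth_series_bounded l' k l : 0 <= l' -> l' < l -> l <= 1 ->
  exists2 C : R, 0 <= C & forall N,
    \sum_(n < N) g n * (growth l' n * ell R n ^+ k / growth l n) <= C.
Proof.
move=> l'0 ll l1.
pose m := (l' + l) / 2.
have l'm : l' < m by rewrite /m; lra.
have ml : m < l by rewrite /m; lra.
have m0 : 0 <= m by apply: le_trans (ltW l'm).
have l0 : 0 < l by apply: le_lt_trans ll.
have [C C0 hC] := growth_dominated k l'0 l'm (le_trans (ltW ml) l1).
have D0 : 0 < l - m by rewrite subr_gt0.
exists (C * (2 / (l - m))); first by rewrite mulr_ge0 ?divr_ge0 ?(ltW D0).
move=> N.
pose q n := growth m n / growth l n.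
have q0 n : 0 <= q n by rewrite divr_ge0// ltW// growth_gt0// ltW.
have h n : g n * (growth l' n * ell R n ^+ k / growth l n) <=
    C * (2 / (l - m) * (q n - q n.+1)).
  have hq : (l - m) * (g n * q n) <= 2 * (q n - q n.+1).
    have -> : q n.+1 = q n * ((1 + m * g n) / (1 + l * g n)).
      by rewrite /q !growthS invfM; ring.
    have f0 : 0 < 1 + l * g n by apply: growth_factor_gt0; exact: ltW.
    have -> : 2 * (q n - q n * ((1 + m * g n) / (1 + l * g n))) =
      2 * (q n * ((l - m) * g n)) / (1 + l * g n).
      by field; rewrite gt_eqF.
    rewrite ler_pdivlMr//.
    have : 0 <= q n * ((l - m) * g n).
      exact: mulr_ge0 (q0 n) (mulr_ge0 (ltW D0) (step_ge0 R n)).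
    have : l * g n <= 1 by apply: mulr_ile1 (ltW l0) (step_ge0 _ _) l1 (step_le1 _ _).
    set a := q n * _ => ? ?.
    have -> : (l - m) * (g n * q n) = a by rewrite /a; ring.
    nra.
  have : growth l' n * ell R n ^+ k / growth l n <= C * q n.
    rewrite /q mulrA ler_pM2r ?invr_gt0 ?growth_gt0 ?(ltW l0)//.
    apply: le_trans (hC n); apply: ler_wpM2l; first exact/ltW/growth_gt0.
    exact: ler_weXn2l (ell_ge1 R n) _ _ (leqnSn k).
  move=> h1; apply: (le_trans (ler_wpM2l (step_ge0 R n) h1)).
  rewrite mulrCA ler_wpM2l//.
  by rewrite mulrAC ler_pdivlMr// mulrC.
apply: (@le_trans _ _ (\sum_(n < N) C * (2 / (l - m) * (q n - q n.+1)))).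
  by apply: ler_sum => n _; exact: h.
rewrite -!mulr_sumr ler_wpM2l//.
rewrite ger_pMr; last by rewrite divr_gt0.
have -> : \sum_(i < N) (q i - q i.+1) = q 0%N - q N.
  elim: N => [|N IH]; first by rewrite big_ord0 subrr.
  by rewrite big_ord_recr /= IH; ring.
have -> : q 0%N = 1 by rewrite /q /growth !big_ord0 divr1.
by rewrite gerBl.
Qed.

End Comparison.

(** * Asymptotics in terms of N^l and log N *)

Section Asymptotics.
Variable R : realType.
Implicit Types (l : R) (k N n : nat).
Local Notation g := (step R).

Lemma powR_ratio_noninc l : 0 <= l ->
  nonincreasing_seq (fun N => growth l N.+1 / (N.+1%:R `^ l)).
Proof.
move=> l0; apply/nonincreasing_seqP => N.
have p1 : 0 < (N.+1%:R : R) `^ l by rewrite powR_gt0 ?ltr0n.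
have p2 : 0 < (N.+2%:R : R) `^ l by rewrite powR_gt0 ?ltr0n.
rewrite ler_pdivrMr// mulrAC ler_pdivlMr// growthS -!mulrA.
apply: ler_wpM2l; first exact/ltW/growth_gt0.
rewrite /powR !pnatr_eq0/=.
have e : ln (N.+1%:R : R) <= ln N.+2%:R - g N.+1.
  have -> : ln (N.+1%:R : R) = ln N.+2%:R + ln (N.+1%:R / N.+2%:R).
    by rewrite ln_div ?posrE ?ltr0n// addrC subrK.
  have -> : N.+1%:R / N.+2%:R = 1 + - g N.+1 :> R.
    rewrite /step -[N.+1%:R](addrK 1) natr1 mulrBl divff ?pnatr_eq0//.
    by rewrite mul1r.
  rewrite lerD2l le_ln1Dx// ltrN2 /step invf_lt1 ?ltr0n// ltr1n//.
apply: (@le_trans _ _ (expR (l * g N.+1) * expR (l * (ln N.+2%:R - g N.+1)))).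
  apply: ler_pM; rewrite ?expR_ge0 ?expR_ge1Dx//.
    by rewrite ltW// growth_factor_gt0.
  by rewrite ler_expR ler_wpM2l.
by rewrite -expRD mulrBr addrC subrK.
Qed.

(** The ratio decreases, so only a positive lower bound is at stake. It comes from growth l * growth
    (1 - l) >= growth 1, because [growth (1 - l)] is at most 2 N^(1 - l) by the same monotonicity,
    started from the first ratio 2 - l. *)
Lemma growth_powR_cvg l : 0 <= l <= 1 ->
  exists2 c : R, 0 < c & (fun N => growth l N / (N%:R `^ l)) @ \oo --> c.
Proof.
move=> /andP[l0 l1].
have lb N : 2^-1 <= growth l N.+1 / (N.+1%:R `^ l).
  have pp (m : R) : 0 < (N.+1%:R : R) `^ m by rewrite powR_gt0 ?ltr0n.
  have l10 : 0 <= 1 - l by rewrite subr_ge0.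
  have := powR_ratio_noninc l10 (leq0n N).
  rewrite powR1 divr1 {2}/growth big_ord1 /= /step invr1 mulr1.
  rewrite ler_pdivrMr// => h1.
  have h2 : growth (1 : R) N.+1 <= growth l N.+1 * growth (1 - l) N.+1.
    rewrite /growth -big_split; apply: ler_prod => n _ /=.
    have g0 := step_ge0 R n.
    rewrite addr_ge0 ?mulr_ge0//=.
    have : 0 <= l * (1 - l) * (g n * g n) by rewrite !mulr_ge0.
    by nra.
  rewrite growth1 in h2.
  have e : (N.+1%:R : R) `^ l * (N.+1%:R `^ (1 - l)) = N.+1%:R.
    rewrite -powRD; last by apply/implyP => _; rewrite pnatr_eq0.
    by rewrite addrC subrK powRr1.
  rewrite ler_pdivlMr// -(ler_pM2r (pp (1 - l))) -mulrA e.
  have h3 : growth l N.+1 * growth (1 - l) N.+1 <=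
      growth l N.+1 * (2 * N.+1%:R `^ (1 - l)).
    apply: ler_wpM2l; first exact/ltW/growth_gt0.
    by apply: (le_trans h1); rewrite ler_pM2r//; lra.
  have h4 : N.+1%:R <= N.+2%:R :> R by rewrite ler_nat.
  have := le_trans h4 (le_trans h2 h3).
  set A := growth _ _; set B := _ `^ _; lra.
have H := nonincreasing_cvgn (powR_ratio_noninc l0).
have hl : has_lbound (range (fun N => growth l N.+1 / (N.+1%:R `^ l))).
  by exists 2^-1 => _ [N _ <-].
exists (inf (range (fun N => growth l N.+1 / (N.+1%:R `^ l)))).
  apply: (@lt_le_trans _ _ 2^-1); first by rewrite invr_gt0.
  apply: lb_le_inf; first by exists (growth l 1 / (1%:R `^ l)); exists 0%N.
  by move=> _ [N _ <-].
by have := H hl; rewrite -(@cvg_shiftS _ (fun N => growth l N / (N%:R `^ l))).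
Qed.

Lemma ell_ln_cvg : (fun N => ell R N / ln N%:R) @ \oo --> (1 : R).
Proof.
rewrite -cvg_shiftS /=.
have lny : (fun N => ln (N.+1%:R : R)) @ \oo --> +oo.
  have := @ell_cvgy R; rewrite -cvg_shiftS /= => /cvgryPge h.
  apply/cvgryPge => A; near=> n.
  have : 2 + A <= ell R n.+1 by near: n; exact: h.
  by have := ell_leln R n; lra.
have lnV : (fun N => (ln (N.+1%:R : R))^-1) @ \oo --> (0 : R).
  apply/gtr0_cvgV0 => //; near=> n.
  apply: (@lt_le_trans _ _ 1) => //.
  by near: n; move/cvgryPge: lny; exact.
apply: (@squeeze_cvgr _ _ _ _ (fun=> 1) (fun N => 1 + 2 * (ln (N.+1%:R : R))^-1)).
- near=> n.
  have l0 : 0 < ln (n.+1%:R : R).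
    apply: (@lt_le_trans _ _ 1) => //.
    by near: n; move/cvgryPge: lny; exact.
  have h1 := ell_geln R n; have h2 := ell_leln R n; have h3 := ell_leS R n.
  rewrite ler_pdivlMr// mul1r; apply/andP; split; first by lra.
  rewrite ler_pdivrMr// mulrDl mul1r -mulrA mulVf ?gt_eqF// mulr1.
  by rewrite addrC.
- exact: cvg_cst.
- rewrite -[X in _ --> X]addr0 -(mulr0 2); apply: cvgD; first exact: cvg_cst.
  by apply: cvgMl_tmp.
Unshelve. all: by end_near. Qed.

(** Equal to 1 / Gamma(1 + l). The value is absorbed into the random factors V_j; it is computed
    only at l = 0 and l = 1, where the limits are explicit. *)
Definition growth_constant l : R := limn (fun N => growth l N / (N%:R `^ l)).

Lemma growth_constant_cvg l : 0 <= l <= 1 ->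
  (fun N => growth l N / (N%:R `^ l)) @ \oo --> growth_constant l.
Proof. by move=> /growth_powR_cvg[c _ /cvgP]. Qed.

Lemma growth_constant_gt0 l : 0 <= l <= 1 -> 0 < growth_constant l.
Proof. by move=> /growth_powR_cvg[c c0 hc]; rewrite /growth_constant (cvg_lim _ hc). Qed.

Lemma growth_constant0 : growth_constant 0 = 1.
Proof.
apply/cvg_lim => //; apply: cvg_near_cst; apply: nearW => N.
by rewrite growth0 powRr0 divr1.
Qed.

Lemma growth_constant1 : growth_constant 1 = 1.
Proof.
apply/cvg_lim => //; rewrite -[X in _ --> X]invr1.
rewrite (_ : (fun _ => _) = fun N => (1 - step R N)^-1).
  apply: cvgV; rewrite ?oner_eq0// -[X in _ --> X]subr0.
  by apply: cvgB; [exact: cvg_cst|exact: step_cvg0].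
apply/funext => N; rewrite growth1 powRr1// -[LHS]invrK invf_div; congr (_^-1).
by rewrite /step -{1}(addrK 1 N%:R) mulrBl natr1 divff ?pnatr_eq0// mul1r.
Qed.

Lemma scale_asymp l k : 0 <= l <= 1 ->
  (fun N => scale l k N / (N%:R `^ l * ln N%:R ^+ k)) @ \oo --> growth_constant l.
Proof.
move=> l01; rewrite (_ : (fun _ => _) = fun N => (growth l N / (N%:R `^ l)) *
   (ell R N / ln N%:R) ^+ k); last first.
  by apply/funext => N; rewrite /scale expr_div_n invfM; ring.
rewrite -[growth_constant l]mulr1; apply: cvgM; first exact: growth_constant_cvg.
elim: k => [|k IH].
  by apply: cvg_near_cst; apply: nearW => N; rewrite expr0.
rewrite -[X in _ --> X]mulr1.
rewrite (_ : (fun _ => _) = fun N => (ell R N / ln N%:R) *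
   (ell R N / ln N%:R) ^+ k); last by apply/funext => N; rewrite exprS.
by apply: cvgM => //; exact: ell_ln_cvg.
Qed.

End Asymptotics.

(** * Perturbed linear recursions *)

Lemma cvg_sumr (R : realType) (I : Type) (r : seq I) (P : pred I)
    (f : I -> nat -> R) (l : I -> R) :
  (forall i, P i -> f i @ \oo --> l i) ->
  (fun N => \sum_(i <- r | P i) f i N) @ \oo --> \sum_(i <- r | P i) l i.
Proof. by apply: cvg_big; exact: add_continuous. Qed.

Section Contraction.
Variable R : realType.
Implicit Types (u eps gam : nat -> R).

(** Once eps is below e / 2, each step averages u with a quantity at most e / 2, so the excess of u
    over e / 2 shrinks like the product of the 1 - gam. *)
Lemma contraction_cvg0 u eps gam :
  (forall N, 0 <= u N) -> (forall N, 0 <= gam N < 1) ->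
  (fun N => \prod_(n < N) (1 - gam n)) @ \oo --> (0 : R) ->
  (forall N, u N.+1 <= (1 - gam N) * u N + gam N * eps N) ->
  eps @ \oo --> (0 : R) -> u @ \oo --> (0 : R).
Proof.
move=> u0 hg hp hu heps.
pose P N := \prod_(n < N) (1 - gam n).
have P0 N : 0 < P N.
  by rewrite prodr_gt0// => n _; rewrite subr_gt0; case/andP: (hg n).
apply/cvgr0Pnorm_le => e e0.
have e20 : 0 < e / 2 by rewrite divr_gt0.
have [m _ hm] : \forall N \near \oo, `|eps N| <= e / 2.
  by move/cvgr0Pnorm_le: heps; exact.
have H N : (m <= N)%N -> u N <= e / 2 + P N / P m * u m.
  elim: N => [|N IH].
    by rewrite leqn0 => /eqP ->; rewrite divff ?gt_eqF// mul1r lerDr ltW.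
  rewrite leq_eqVlt => /orP[/eqP <-|mN].
    by rewrite divff ?gt_eqF// mul1r lerDr ltW.
  have {}IH := IH mN.
  have /andP[g0 g1] := hg N.
  apply: (le_trans (hu N)).
  have -> : P N.+1 = P N * (1 - gam N) by rewrite /P big_ord_recr.
  have h1 : (1 - gam N) * u N <= (1 - gam N) * (e / 2 + P N / P m * u m).
    by rewrite ler_wpM2l// subr_ge0 ltW.
  have h2 : gam N * eps N <= gam N * (e / 2).
    by rewrite ler_wpM2l// (le_trans (ler_norm _))// hm.
  apply: le_trans (lerD h1 h2) _.
  by rewrite le_eqVlt; apply/orP; left; apply/eqP; ring.
have hP : (fun N => P N * (u m / P m)) @ \oo --> (0 : R).
  by rewrite -(mul0r (u m / P m)); apply: cvgMr_tmp.
near=> N; rewrite ger0_norm//.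
apply: (@le_trans _ _ (e / 2 + P N / P m * u m)).
  by apply: H; near: N; exists m.
rewrite [leRHS](splitr e) lerD2l.
have -> : P N / P m * u m = P N * (u m / P m) by ring.
apply: (le_trans (ler_norm _)).
by near: N; move/cvgr0Pnorm_le: hP; exact.
Unshelve. all: by end_near. Qed.

Lemma contraction_le u eps gam (B : R) :
  (forall N, 0 <= gam N < 1) ->
  (forall N, u N.+1 <= (1 - gam N) * u N + gam N * eps N) ->
  u 0%N <= B -> (forall N, eps N <= B) -> forall N, u N <= B.
Proof.
move=> hg hu h0 he; elim=> // N IH; apply: (le_trans (hu N)).
have /andP[g0 /ltW g1] := hg N.
have h1 : (1 - gam N) * u N <= (1 - gam N) * B by rewrite ler_wpM2l// subr_ge0.
have h2 : gam N * eps N <= gam N * B by rewrite ler_wpM2l.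
by lra.
Qed.

Lemma expr_bernoulli (x : R) (k : nat) : 0 <= x <= 1 -> 1 - k%:R * x <= (1 - x) ^+ k.
Proof.
move=> /andP[x0 x1]; elim: k => [|k IH]; first by rewrite expr0 mul0r subr0.
rewrite exprSr -natr1.
have h := ler_wpM2r (_ : 0 <= 1 - x) IH.
apply: le_trans (h _); last by rewrite subr_ge0.
have : 0 <= (k%:R : R) * (x * x) by rewrite !mulr_ge0.
by lra.
Qed.

End Contraction.

Definition ell_ratio (R : realType) (N : nat) : R := ell R N / ell R N.+1.

Section EllRatio.
Variable R : realType.
Implicit Types (k N n : nat).
Local Notation g := (step R).
Local Notation rho := (ell_ratio R).

Lemma ell_ratioE N : rho N = 1 - g N / ell R N.+1.
Proof.
rewrite /ell_ratio; apply: (mulIf (ell_neq0 R N.+1)).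
by rewrite mulrBl !divfK ?ell_neq0// mul1r ellS addrK.
Qed.

Lemma ell_ratio_gt0 N : 0 < rho N.
Proof. by rewrite divr_gt0 ?ell_gt0. Qed.

Lemma ell_ratio_le1 N : rho N <= 1.
Proof. by rewrite ler_pdivrMr ?ell_gt0// mul1r ell_leS. Qed.

Lemma ell_ratio_cvg1 : rho @ \oo --> (1 : R).
Proof.
rewrite (_ : rho = fun N => 1 - g N / ell R N.+1); last first.
  by apply/funext => N; rewrite ell_ratioE.
rewrite -[X in _ --> X]subr0; apply: cvgB; first exact: cvg_cst.
rewrite -[X in _ --> X](mulr0 0); apply: cvgM; first exact: step_cvg0.
by have := @ellV_cvg0 R; rewrite -cvg_shiftS.
Qed.

Lemma step_ell_lt1 N : 0 <= g N / ell R N.+1 < 1.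
Proof.
rewrite divr_ge0 ?step_ge0 ?ltW ?ell_gt0//= ltr_pdivrMr ?ell_gt0// mul1r ellS.
by rewrite ltrDr ell_gt0.
Qed.

Lemma prod_ell_cvg0 :
  (fun N => \prod_(n < N) (1 - g n / ell R n.+1)) @ \oo --> (0 : R).
Proof.
rewrite (_ : (fun _ => _) = fun N => (ell R N)^-1); first exact: ellV_cvg0.
apply/funext; elim=> [|N IH].
  by rewrite /ell !big_ord0 addr0 invr1.
rewrite big_ord_recr /= IH -ell_ratioE /ell_ratio mulrA mulVf ?ell_neq0//.
by rewrite mul1r.
Qed.

Lemma scale_ratio l k N : 0 <= l ->
  scale l k N / scale l k N.+1 = rho N ^+ k / (1 + l * g N).
Proof.
move=> l0.
rewrite /scale growthS /ell_ratio expr_div_n.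
have /lt0r_neq0 h := growth_gt0 N l0.
field.
by rewrite h (gt_eqF (growth_factor_gt0 _ l0)) expf_neq0 ?ell_neq0.
Qed.

End EllRatio.

Section ScalarRecursion.
Variable R : realType.
Local Notation g := (step R).
Local Notation rho := (ell_ratio R).
Variables (l : R) (l0 : 0 <= l).

Definition psum (eta : nat -> R) N := \sum_(n < N) eta n.

Lemma psumS eta N : psum eta N.+1 = psum eta N + eta N.
Proof. by rewrite /psum big_ord_recr. Qed.

Section Order0.
Variables (z beta eta : nat -> R).
Hypothesis zE : forall N, z N.+1 = z N + g N / (1 + l * g N) * beta N + eta N.
Variable D : R.
Hypothesis hD : forall N, \sum_(n < N) g n * `|beta n| <= D.

Let hstep n : `|g n / (1 + l * g n) * beta n| <= g n * `|beta n|.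
Proof.
rewrite normrM ler_wpM2r// ger0_norm; last first.
  by rewrite divr_ge0 ?step_ge0 ?ltW ?growth_factor_gt0.
rewrite ler_pdivrMr ?growth_factor_gt0// ler_peMr ?step_ge0//.
by rewrite lerDl mulr_ge0 ?step_ge0.
Qed.

Let zsum N :
  z N = z 0%N + psum (fun n => g n / (1 + l * g n) * beta n) N + psum eta N.
Proof.
elim: N => [|N IH]; first by rewrite /psum !big_ord0 !addr0.
by rewrite zE IH !psumS; ring.
Qed.

Lemma order0_le B : `|z 0%N| <= B -> (forall N, `|psum eta N| <= B) ->
  forall N, `|z N| <= B + D + B.
Proof.
move=> hz hS N; rewrite zsum.
apply: (le_trans (ler_normD _ _)); apply: lerD => //.
apply: (le_trans (ler_normD _ _)); apply: lerD => //.
apply: (le_trans (ler_norm_sum _ _ _)); apply: le_trans (hD N).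
by apply: ler_sum => n _; exact: hstep.
Qed.

Lemma order0_cvg : cvgn (psum eta) -> cvgn z.
Proof.
move=> hS.
rewrite (_ : z = fun N => z 0%N +
   psum (fun n => g n / (1 + l * g n) * beta n) N + psum eta N); last first.
  by apply/funext => N; exact: zsum.
apply: is_cvgD => //; apply: is_cvgD; first exact: is_cvg_cst.
suff : cvgn (series (fun n => g n / (1 + l * g n) * beta n)).
  by rewrite seriesEord.
apply: normed_cvg.
apply: nondecreasing_is_cvgn.
  apply/nondecreasing_seqP => n.
  by rewrite [X in _ <= X]seriesSr lerDl normr_ge0.
exists D => _ [N _ <-]; rewrite /= seriesEord; apply: le_trans (hD N).
by apply: ler_sum => n _; exact: hstep.
Qed.

End Order0.

Section OrderS.
Variables (k : nat) (k0 : (0 < k)%N) (z beta eta : nat -> R).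
Hypothesis zE : forall N,
  z N.+1 = rho N ^+ k * (z N + g N / (1 + l * g N) * (beta N / ell R N)) + eta N.

(** With gam = 1 - rho = g / ell(N+1), one has 1 - rho^k = gam c, and the drift enters as gam f
    beta. Since c tends to k and f to 1, the recursion settles where beta = k z. *)
Let c N := \sum_(i < k) rho N ^+ i.
Let f N := rho N ^+ k.-1 / (1 + l * g N).

(* The shift [w] follows the noise, so that [z - w] is driven by a drift that
   is absolutely small although the noise is only conditionally summable. *)
Let stepE (w : nat -> R) : (forall N, w N.+1 = w N + eta N) -> forall N,
  `|z N.+1 - w N.+1| <= (1 - g N / ell R N.+1) * `|z N - w N|
     + g N / ell R N.+1 * `|f N * beta N - c N * w N|.
Proof.
move=> wE N; set gam := g N / ell R N.+1.
have r1 : rho N = 1 - gam by exact: ell_ratioE.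
have r0 := ltW (ell_ratio_gt0 R N); have rl := ell_ratio_le1 R N.
have gam0 : 0 <= gam by case/andP: (step_ell_lt1 R N).
have cE : 1 - rho N ^+ k = gam * c N.
  by rewrite -[1](expr1n _ k) subrXX r1 opprB addrC subrK; congr (_ * _);
     apply: eq_bigr => i _; rewrite expr1n mul1r -r1.
have fE : rho N ^+ k * (g N / (1 + l * g N) * (beta N / ell R N)) =
    gam * (f N * beta N).
  rewrite /f -{1}(prednK k0) exprSr {2}/ell_ratio /gam.
  by field; rewrite !ell_neq0 (gt_eqF (growth_factor_gt0 _ l0)).
have -> : z N.+1 - w N.+1 =
    rho N ^+ k * (z N - w N) + gam * (f N * beta N - c N * w N).
  have cE' : gam * (c N * w N) = (1 - rho N ^+ k) * w N by rewrite cE; ring.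
  by rewrite zE wE mulrDr fE (mulrBr gam) cE'; ring.
apply: (le_trans (ler_normD _ _)); apply: lerD; rewrite normrM.
  rewrite ler_wpM2r// -r1 ger0_norm ?exprn_ge0//.
  by rewrite -(prednK k0) exprS ler_piMr// exprn_ile1.
by rewrite (ger0_norm gam0).
Qed.

Let f_le1 N : 0 <= f N <= 1.
Proof.
have r0 := ltW (ell_ratio_gt0 R N); have rl := ell_ratio_le1 R N.
rewrite /f; apply/andP; split.
  by apply: divr_ge0; [exact: exprn_ge0|exact/ltW/growth_factor_gt0].
rewrite ler_pdivrMr ?growth_factor_gt0// mul1r.
by rewrite (@le_trans _ _ 1) ?exprn_ile1// lerDl mulr_ge0 ?step_ge0.
Qed.

Let c_le N : 0 <= c N <= k%:R.
Proof.
have r0 := ltW (ell_ratio_gt0 R N); have rl := ell_ratio_le1 R N.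
rewrite /c sumr_ge0/=; last by move=> i _; rewrite exprn_ge0.
rewrite -[X in _ <= X%:R]card_ord -sum1_card natr_sum; apply: ler_sum => i _.
by rewrite exprn_ile1.
Qed.

(** The constant is B + k B for the forcing f beta - c w, plus B for the shift w, here the partial
    sum of the noise. *)
Lemma orderS_le B : `|z 0%N| <= B -> (forall N, `|psum eta N| <= B) ->
  (forall N, `|beta N| <= B) -> forall N, `|z N| <= (k%:R + 2) * B.
Proof.
move=> hz hS hb.
have B0 : 0 <= B by apply: le_trans hz.
have h := @contraction_le R (fun N => `|z N - psum eta N|)
  (fun N => `|f N * beta N - c N * psum eta N|) (fun N => g N / ell R N.+1)
  ((k%:R + 1) * B) (step_ell_lt1 R) (stepE (psumS eta)).
move=> N.
have -> : z N = (z N - psum eta N) + psum eta N by rewrite subrK.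
apply: (le_trans (ler_normD _ _)).
have -> : (k%:R + 2) * B = (k%:R + 1) * B + B by ring.
apply: lerD => //; apply: h => [|n].
  rewrite /psum big_ord0 subr0 (le_trans hz)// ler_peMl//.
  by rewrite lerDr.
apply: (le_trans (ler_normB _ _)); rewrite (normrM (f n)) (normrM (c n)).
have /andP[f0 f1] := f_le1 n; have /andP[c0 c1] := c_le n.
rewrite (ger0_norm f0) (ger0_norm c0) mulrDl mul1r addrC.
by apply: lerD; [exact: ler_pM|rewrite -[leRHS]mul1r; exact: ler_pM].
Qed.

(** The shift w has the noise increments of z and is centred so as to tend to bl / k. The forcing f
    beta - c w then tends to bl - k (bl / k) = 0. *)
Lemma orderS_cvg (bl : R) : cvgn (psum eta) -> beta @ \oo --> bl ->
  z @ \oo --> bl / k%:R.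
Proof.
move=> hS hb; set zl := bl / k%:R.
pose w N := zl + (psum eta N - limn (psum eta)).
have wE N : w N.+1 = w N + eta N by rewrite /w psumS; ring.
have wl : w @ \oo --> zl.
  rewrite -[X in _ --> X]addr0; apply: cvgD; first exact: cvg_cst.
  by rewrite -(subrr (limn (psum eta))); apply: cvgB => //; exact: cvg_cst.
have rp i : (fun N => rho N ^+ i) @ \oo --> (1 : R).
  elim: i => [|i IH].
    by apply: cvg_near_cst; apply: nearW => N; rewrite expr0.
  rewrite -[X in _ --> X]mulr1.
  rewrite (_ : (fun _ => _) = fun N => rho N * rho N ^+ i); last first.
    by apply/funext => N; rewrite exprS.
  by apply: cvgM => //; exact: ell_ratio_cvg1.
have cl : c @ \oo --> (k%:R : R).
  rewrite -[X in X%:R]card_ord -sum1_card natr_sum.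
  by rewrite /c; apply: cvg_sumr => i _; exact: rp.
have fl : f @ \oo --> (1 : R).
  rewrite -[X in _ --> X](divr1 1); apply: cvgM; first exact: rp.
  apply: cvgV; first by rewrite oner_neq0.
  rewrite -[X in _ --> X]addr0; apply: cvgD; first exact: cvg_cst.
  by rewrite -(mulr0 l); apply: cvgMl_tmp; exact: step_cvg0.
have hl : (fun N => `|f N * beta N - c N * w N|) @ \oo --> (0 : R).
  rewrite -(normr0 R); apply: cvg_norm.
  have -> : (0 : R) = 1 * bl - k%:R * zl.
    by rewrite mul1r /zl mulrC divfK ?subrr// pnatr_eq0 -lt0n.
  by apply: cvgB; [exact: (cvgM fl hb)|exact: (cvgM cl wl)].
have := contraction_cvg0 (fun N => normr_ge0 (z N - w N)) (step_ell_lt1 R)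
  (@prod_ell_cvg0 R) (stepE wE) hl.
move/norm_cvg0P.
move=> h; have -> : z = fun N => (z N - w N) + w N.
  by apply/funext => N; rewrite subrK.
by rewrite -[X in _ --> X]add0r; exact: cvgD h wl.
Qed.

End OrderS.

End ScalarRecursion.

(** * The l1 norm and coordinatewise convergence *)

Definition l1norm (R : realType) (n : nat) (v : 'rV[R]_n) : R :=
  \sum_i `|v 0 i|.

Definition vcvg (R : realType) (n : nat) (v : nat -> 'rV[R]_n) (L : 'rV[R]_n) :=
  forall i, (fun N => v N 0 i) @ \oo --> L 0 i.

Section L1.
Variables (R : realType) (n : nat).
Implicit Types (u v : 'rV[R]_n).

Lemma l1norm_ge0 v : 0 <= l1norm v.
Proof. by apply: sumr_ge0 => i _. Qed.

Lemma l1normD u v : l1norm (u + v) <= l1norm u + l1norm v.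
Proof.
rewrite /l1norm -big_split; apply: ler_sum => i _ /=; rewrite mxE.
exact: ler_normD.
Qed.

Lemma l1normZ c v : l1norm (c *: v) = `|c| * l1norm v.
Proof. by rewrite /l1norm mulr_sumr; apply: eq_bigr => i _; rewrite mxE normrM. Qed.

Lemma ler_l1norm v i : `|v 0 i| <= l1norm v.
Proof. by rewrite /l1norm (bigD1 i)//= lerDl; apply: sumr_ge0. Qed.

Lemma l1norm_mulmx m (Q : 'M[R]_(n, m)) v :
  l1norm (v *m Q) <= (\sum_i \sum_j `|Q i j|) * l1norm v.
Proof.
rewrite mulr_suml {1}/l1norm.
apply: (@le_trans _ _ (\sum_(j < m) \sum_(i < n) `|v 0 i| * `|Q i j|)).
  apply: ler_sum => j _; rewrite mxE (le_trans (ler_norm_sum _ _ _))//.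
  by apply: ler_sum => i _; rewrite normrM.
rewrite exchange_big/=; apply: ler_sum => i _; rewrite -mulr_sumr mulrC.
by apply: ler_wpM2l; [apply: sumr_ge0|exact: ler_l1norm].
Qed.

Lemma vcvgP (v : nat -> 'rV[R]_n) L :
  vcvg v L <-> (fun N => l1norm (v N - L)) @ \oo --> (0 : R).
Proof.
split=> [h|h i].
  rewrite (_ : (fun _ => _) = fun N => \sum_i `|(v N - L) 0 i|)//.
  rewrite [X in _ --> X](_ : _ = \sum_(i < n) (0 : R)); last by rewrite big1.
  apply: cvg_sumr => i _; apply/norm_cvg0P.
  rewrite (_ : (fun _ => _) = fun N => v N 0 i - L 0 i).
    by rewrite -(subrr (L 0 i)); apply: cvgB; [exact: h|exact: cvg_cst].
  by apply/funext => N; rewrite !mxE.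
rewrite (_ : (fun _ => _) = fun N => (v N 0 i - L 0 i) + L 0 i); last first.
  by apply/funext => N; rewrite subrK.
rewrite -[X in _ --> X]add0r; apply: cvgD; last exact: cvg_cst.
apply/norm_cvg0P.
apply: (@squeeze_cvgr _ _ _ _ (fun=> 0) (fun N => l1norm (v N - L))) => //.
  apply: nearW => N; rewrite normr_ge0/=.
  by have := ler_l1norm (v N - L) i; rewrite !mxE.
exact: cvg_cst.
Qed.

Lemma vcvgD (u v : nat -> 'rV[R]_n) U V :
  vcvg u U -> vcvg v V -> vcvg (fun N => u N + v N) (U + V).
Proof.
move=> hu hv i; rewrite mxE.
rewrite (_ : (fun _ => _) = fun N => u N 0 i + v N 0 i); first exact: cvgD.
by apply/funext => N; rewrite mxE.
Qed.

Lemma vcvg_cst (V : 'rV[R]_n) : vcvg (fun=> V) V.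
Proof. by move=> i; exact: cvg_cst. Qed.

Lemma vcvgZ (c : nat -> R) (v : nat -> 'rV[R]_n) (c0 : R) V :
  c @ \oo --> c0 -> vcvg v V -> vcvg (fun N => c N *: v N) (c0 *: V).
Proof.
move=> hc hv i; rewrite mxE.
rewrite (_ : (fun _ => _) = fun N => c N * v N 0 i); first exact: cvgM.
by apply/funext => N; rewrite mxE.
Qed.

Lemma vcvgM m (Q : 'M[R]_(n, m)) (v : nat -> 'rV[R]_n) V :
  vcvg v V -> vcvg (fun N => v N *m Q) (V *m Q).
Proof.
move=> hv j; rewrite mxE.
rewrite (_ : (fun _ => _) = fun N => \sum_i v N 0 i * Q i j).
  apply: cvg_sumr => i _; apply: cvgM; [exact: hv|exact: cvg_cst].
by apply/funext => N; rewrite mxE.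
Qed.

Lemma vcvg_bounded (v : nat -> 'rV[R]_n) V : vcvg v V ->
  exists2 B, 0 <= B & forall N, l1norm (v N) <= B.
Proof.
move=> /vcvgP /cvgP /cvg_has_ub [B hB].
have B0 : 0 <= B.
  by apply: le_trans (normr_ge0 _) (hB _ _); exists 0%N.
exists (B + l1norm V) => [|N]; first by rewrite addr_ge0// l1norm_ge0.
rewrite -[v N](subrK V) (le_trans (l1normD _ _))// lerD2r.
by apply: le_trans (ler_norm _) (hB _ _); exists N.
Qed.

End L1.

Lemma vcvg_sum (R : realType) (n : nat) (I : Type) (r : seq I) (P : pred I)
    (v : I -> nat -> 'rV[R]_n) (V : I -> 'rV[R]_n) :
  (forall i, P i -> vcvg (v i) (V i)) ->
  vcvg (fun N => \sum_(i <- r | P i) v i N) (\sum_(i <- r | P i) V i).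
Proof.
move=> h j; rewrite summxE.
rewrite (_ : (fun _ => _) = fun N => \sum_(i <- r | P i) v i N 0 j).
  by apply: cvg_sumr => i Pi; exact: h.
by apply/funext => N; rewrite summxE.
Qed.

(** A seminorm and not a norm: for a leading block it vanishes along pi, where nothing contracts.
    The bound by [l1norm] expresses continuity. *)
Record seminorm (R : realType) (n : nat) (nu : 'rV[R]_n -> R) : Prop := {
  seminormD : forall u v, nu (u + v) <= nu u + nu v;
  seminormZ : forall c v, nu (c *: v) = `|c| * nu v;
  seminorm_l1 : exists2 C, 0 <= C & forall v, nu v <= C * l1norm v }.

(** The factor 1 + (l - delta) h is to be compared with the growth factor 1 + l h of the scale:
    after normalization a step contracts at a rate proportional to h. *)
Definition contractive (R : realType) (n : nat) (Q : 'M[R]_n) (l : R)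
    (nu : 'rV[R]_n -> R) :=
  exists2 delta, 0 < delta <= l & forall h v, 0 <= h <= 1 ->
    nu (v + h *: (v *m Q)) <= (1 + (l - delta) * h) * nu v.

Section VectorRecursion.
Variables (R : realType) (n : nat) (Q : 'M[R]_n) (l : R) (k : nat).
Local Notation g := (step R).
Local Notation rho := (ell_ratio R).
Local Notation a := (scale l k).

Definition recursion (x b xi : nat -> 'rV[R]_n) :=
  forall N, x N.+1 = x N + g N *: (x N *m Q + b N) + xi N.

Definition vsum (xi : nat -> 'rV[R]_n) N := \sum_(m < N) (a m.+1)^-1 *: xi m.

Lemma vsumS xi N : vsum xi N.+1 = vsum xi N + (a N.+1)^-1 *: xi N.
Proof. by rewrite /vsum big_ord_recr. Qed.

Lemma normalized_recursion (x b xi : nat -> 'rV[R]_n) : 0 <= l ->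
  recursion x b xi -> forall N,
  (a N.+1)^-1 *: x N.+1 =
    (rho N ^+ k / (1 + l * g N)) *: ((a N)^-1 *: x N +
      g N *: (((a N)^-1 *: x N) *m Q + (a N)^-1 *: b N)) + (a N.+1)^-1 *: xi N.
Proof.
move=> l0 rec N; rewrite rec -scale_ratio// -scalemxAl.
have /lt0r_neq0 hN := scale_gt0 k N l0.
have /lt0r_neq0 hS := scale_gt0 k N.+1 l0.
move: (a N) (a N.+1) (x N *m Q) hN hS => aN aS xQ hN hS.
by apply/rowP => i; rewrite !mxE; field; rewrite ?hN ?hS.
Qed.

Section Contractive.
Hypothesis l0 : 0 < l.
Variable nu : 'rV[R]_n -> R.
Hypothesis nuS : seminorm nu.
Hypothesis Qnu : contractive Q l nu.

Let nu0 : nu 0 = 0.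
Proof. by rewrite -(scale0r 0) (seminormZ nuS) normr0 mul0r. Qed.

Lemma seminormN v : nu (- v) = nu v.
Proof. by rewrite -scaleN1r (seminormZ nuS) normrN1 mul1r. Qed.

Lemma seminorm_ge0 v : 0 <= nu v.
Proof.
have := seminormD nuS v (- v); rewrite subrr nu0 seminormN; lra.
Qed.

Let l00 : 0 <= l. Proof. exact: ltW. Qed.

(* The shift [w] follows the noise, as in the scalar recursion. *)
Lemma shifted_contraction : exists2 d, 0 < d < 1 &
  forall x b xi, recursion x b xi ->
  forall w, (forall N, w N.+1 = w N + (a N.+1)^-1 *: xi N) -> forall N,
  nu ((a N.+1)^-1 *: x N.+1 - w N.+1) <=
    (1 - d * g N) * nu ((a N)^-1 *: x N - w N) +
    d * g N * (d^-1 * (nu ((a N)^-1 *: b N + w N *m Q - l *: w N) +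
      k%:R / ell R N.+1 * nu (w N))).
Proof.
have [delta /andP[d0 dl] hQ] := Qnu.
have l1 : 0 < 1 + l by lra.
(* (1 + (l - delta) h) / (1 + l h) = 1 - delta h / (1 + l h), and h <= 1 bounds the denominator by 1
   + l. *)
exists (delta / (1 + l)).
  by rewrite divr_gt0//= ltr_pdivrMr// mul1r; lra.
move=> x b xi rec w wE N.
rewrite (normalized_recursion l00 rec) wE.
set y := (a N)^-1 *: x N; set be := (a N)^-1 *: b N; set r := rho N ^+ k.
set et := (a N.+1)^-1 *: xi N.
have g0 := step_ge0 R N; have g1 := step_le1 R N.
have f0 := growth_factor_gt0 N l00.
set s := r / (1 + l * g N).
have r0 : 0 <= r by rewrite exprn_ge0// ltW// ell_ratio_gt0.
have r1 : r <= 1 by rewrite exprn_ile1 ?ell_ratio_le1// ltW// ell_ratio_gt0.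
have s0 : 0 <= s by rewrite divr_ge0// ltW.
have s1 : s <= 1 by rewrite ler_pdivrMr// mul1r (le_trans r1)// lerDl mulr_ge0.
pose e := y - w N.
have -> : s *: (y + g N *: (y *m Q + be)) + et - (w N + et) =
    s *: (e + g N *: (e *m Q)) +
    (s * g N) *: (be + w N *m Q - l *: w N) + (r - 1) *: w N.
  rewrite /e mulmxBl; have -> : r = s * (1 + l * g N) by rewrite divfK// gt_eqF.
  move: (y *m Q) (w N *m Q) (w N) => yQ wQ w0.
  by apply/rowP => i; rewrite !mxE; ring.
(* By Bernoulli's inequality the logarithmic part of the scale costs at most k g / ell; acting on
   the shift, it is a vanishing drift. *)
have rk : 1 - r <= k%:R / ell R N.+1 * g N.
  have := @expr_bernoulli R (g N / ell R N.+1) k.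
  have /andP[-> /ltW ->] := step_ell_lt1 R N.
  rewrite -ell_ratioE -/r => /(_ isT).
  have -> : k%:R / ell R N.+1 * g N = k%:R * (g N / ell R N.+1) by ring.
  by lra.
apply: (le_trans (seminormD nuS _ _)).
apply: (le_trans (lerD (seminormD nuS _ _) (lexx _))).
rewrite !(seminormZ nuS) (ger0_norm s0) (ger0_norm (mulr_ge0 s0 g0)).
rewrite distrC (ger0_norm (_ : 0 <= 1 - r)) ?subr_ge0//.
rewrite -addrA; apply: lerD.
  apply: (le_trans (ler_wpM2l s0 (hQ _ _ _))); first by rewrite g0.
  rewrite mulrA ler_wpM2r ?seminorm_ge0//.
  apply: (@le_trans _ _ ((1 + (l - delta) * g N) / (1 + l * g N))).
    rewrite mulrC ler_wpM2l ?addr_ge0 ?mulr_ge0 ?subr_ge0//.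
    by rewrite /s ler_piMl// invr_ge0 ltW.
  rewrite ler_pdivrMr//.
  have -> : (1 - delta / (1 + l) * g N) * (1 + l * g N) =
      1 + l * g N - delta * g N * ((1 + l * g N) / (1 + l)) by ring.
  have : delta * g N * ((1 + l * g N) / (1 + l)) <= delta * g N.
    apply: ler_piMr; first exact: mulr_ge0 (ltW d0) g0.
    by rewrite ler_pdivrMr// mul1r lerD2l ler_piMr.
  by lra.
have dn0 : delta / (1 + l) != 0 by rewrite gt_eqF// divr_gt0.
set A := nu (_ - _); set B := nu (w N).
have A0 : 0 <= A by exact: seminorm_ge0.
have B0 : 0 <= B by exact: seminorm_ge0.
set dd := delta / (1 + l) in dn0 *.
have -> : dd * g N * (dd^-1 * (A + k%:R / ell R N.+1 * B)) =
    g N * A + k%:R / ell R N.+1 * g N * B.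
  by field; rewrite dn0 ell_neq0.
apply: lerD; last exact: ler_wpM2r.
by rewrite ler_wpM2r// ler_piMl.
Qed.

(** The shift is the partial sum of the noise. The quantifier order matters: C is fixed before the
    solution, so one constant serves all paths. *)
Lemma contractive_le : exists2 C, 0 <= C & forall x b xi, recursion x b xi ->
  forall B, l1norm (x 0%N) <= B -> (forall N, l1norm (vsum xi N) <= B) ->
  (forall N, l1norm ((a N)^-1 *: b N) <= B) ->
  forall N, nu ((a N)^-1 *: x N) <= C * B.
Proof.
have [d /andP[d0 d1] H] := shifted_contraction.
have [C0 C00 hC0] := seminorm_l1 nuS.
pose q := \sum_i \sum_j `|Q i j|.
have q0 : 0 <= q by apply: sumr_ge0 => i _; apply: sumr_ge0.
pose E := C0 + d^-1 * (C0 * (1 + q + l) + k%:R * C0).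
have E0 : 0 <= E.
  by rewrite /E !(addr_ge0, mulr_ge0)// invr_ge0 ltW.
exists (E + C0); first by rewrite addr_ge0.
move=> x b xi rec B hx hS hb N.
have B0 : 0 <= B by apply: le_trans hx; exact: l1norm_ge0.
have nuB v : l1norm v <= B -> nu v <= C0 * B.
  by move=> h; apply: (le_trans (hC0 v)); rewrite ler_wpM2l.
rewrite -[_ *: x N](subrK (vsum xi N)).
apply: (le_trans (seminormD nuS _ _)); rewrite mulrDl; apply: lerD; last exact: nuB.
apply: (@contraction_le _ (fun N => nu ((a N)^-1 *: x N - vsum xi N)) _ _ _ _
  (H x b xi rec _ (vsumS xi))) => [m||m].
- rewrite mulr_ge0 ?step_ge0 ?(ltW d0)//=.
  by rewrite (le_lt_trans _ d1)// ler_piMr ?step_le1// ltW.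
- rewrite /vsum big_ord0 subr0 /scale /growth /ell !big_ord0 addr0 expr1n mulr1.
  rewrite invr1 scale1r (le_trans (nuB _ hx))// ler_wpM2r// /E lerDl.
  by rewrite mulr_ge0 ?invr_ge0 ?(ltW d0)// addr_ge0 ?mulr_ge0 ?addr_ge0.
- rewrite /E mulrDl -[leLHS]add0r; apply: lerD; first exact: mulr_ge0.
  rewrite -[leRHS]mulrA ler_wpM2l ?invr_ge0 ?(ltW d0)// mulrDl; apply: lerD.
    apply: (le_trans (hC0 _)); rewrite -[leRHS]mulrA ler_wpM2l//.
    apply: (le_trans (l1normD _ _)); rewrite -scaleN1r scalerA l1normZ.
    rewrite normrM normrN1 mul1r (ger0_norm l00) !mulrDl mul1r.
    apply: lerD; last exact: ler_wpM2l.
    apply: (le_trans (l1normD _ _)); apply: lerD => //.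
    by apply: (le_trans (l1norm_mulmx _ _)); exact: ler_wpM2l.
  rewrite -[leRHS]mulrA; apply: ler_pM => //.
  + by rewrite mulr_ge0// invr_ge0 ltW// ell_gt0.
  + exact: seminorm_ge0.
  + by rewrite ler_piMr// invf_le1 ?ell_ge1// ell_gt0.
  + exact: nuB.
Qed.

(** The shift has the noise increments of x and tends to [ys], so the forcing tends to
    [bl + ys *m Q - l *: ys], which has to vanish only for the seminorm. *)
Lemma contractive_cvg x b xi : recursion x b xi ->
  forall S, vcvg (vsum xi) S -> forall bl ys,
  vcvg (fun N => (a N)^-1 *: b N) bl -> nu (bl + ys *m Q - l *: ys) = 0 ->
  (fun N => nu ((a N)^-1 *: x N - ys)) @ \oo --> (0 : R).
Proof.
move=> rec S hS bl ys hb hys.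
have [d /andP[d0 d1] H] := shifted_contraction.
have [C0 C00 hC0] := seminorm_l1 nuS.
pose w N := ys + (vsum xi N - S).
have wE N : w N.+1 = w N + (a N.+1)^-1 *: xi N.
  by rewrite /w vsumS [vsum xi N + _ - S]addrAC !addrA.
have wl : vcvg w ys.
  rewrite -[ys in vcvg _ ys](addrK S) -addrA /w.
  apply: vcvgD; first exact: vcvg_cst.
  by apply: vcvgD => //; exact: vcvg_cst.
have nucvg (v : nat -> 'rV[R]_n) V : vcvg v V -> (fun N => nu (v N - V)) @ \oo --> (0 : R).
  move=> /vcvgP h.
  apply: (@squeeze_cvgr _ _ _ _ (fun=> 0) (fun N => C0 * l1norm (v N - V))).
  - by apply: nearW => N; rewrite seminorm_ge0 hC0.
  - exact: cvg_cst.
  - by rewrite -(mulr0 C0); apply: cvgMl_tmp.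
have nul (v : nat -> 'rV[R]_n) V : nu V = 0 -> vcvg v V -> (fun N => nu (v N)) @ \oo --> (0 : R).
  move=> V0 /nucvg h.
  apply: (@squeeze_cvgr _ _ _ _ (fun=> 0) (fun N => nu (v N - V))) => //; last exact: cvg_cst.
  apply: nearW => N; rewrite seminorm_ge0/=.
  by rewrite -{1}[v N](subrK V) (le_trans (seminormD nuS _ _))// V0 addr0.
have [Bw Bw0 hBw] := vcvg_bounded wl.
have h0 : (fun N => nu ((a N)^-1 *: x N - w N)) @ \oo --> (0 : R).
  apply: (contraction_cvg0 _ _ _ (H x b xi rec w wE)).
  - by move=> N; exact: seminorm_ge0.
  - move=> m; rewrite mulr_ge0 ?step_ge0 ?(ltW d0)//=.
    by rewrite (le_lt_trans _ d1)// ler_piMr ?step_le1// ltW.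
  - by apply: prod_contraction_cvg0; rewrite d0.
  - rewrite -[X in _ --> X](mulr0 d^-1); apply: cvgMl_tmp.
    rewrite -[X in _ --> X](addr0 0); apply: cvgD.
      apply: nul hys _; apply: vcvgD.
        by apply: vcvgD => //; exact: vcvgM.
      rewrite -scaleNr; under eq_fun do rewrite -scaleNr.
      by apply: vcvgZ => //; exact: cvg_cst.
    apply: (@squeeze_cvgr _ _ _ _ (fun=> 0)
      (fun N => (k%:R * (C0 * Bw)) * (ell R N.+1)^-1)).
    + apply: nearW => N; rewrite !mulr_ge0 ?seminorm_ge0 ?invr_ge0 ?(ltW (ell_gt0 _ _))//=.
      rewrite mulrAC ler_wpM2r ?invr_ge0 ?(ltW (ell_gt0 _ _))//.
      rewrite ler_wpM2l// (le_trans (hC0 _))// ler_wpM2l//.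
    + exact: cvg_cst.
    + rewrite -[X in _ --> X](mulr0 (k%:R * (C0 * Bw))); apply: cvgMl_tmp.
      by have := @ellV_cvg0 R; rewrite -cvg_shiftS.
apply: (@squeeze_cvgr _ _ _ _ (fun=> 0)
  (fun N => nu ((a N)^-1 *: x N - w N) + nu (w N - ys))).
- apply: nearW => N; rewrite seminorm_ge0/=.
  by apply: le_trans (seminormD nuS _ _); rewrite addrA subrK.
- exact: cvg_cst.
- by rewrite -[X in _ --> X](addr0 0); apply: cvgD => //; exact: nucvg.
Qed.

End Contractive.
End VectorRecursion.

(** * Perron-Frobenius theory *)

Definition pos_mx (R : realType) (m n : nat) (A : 'M[R]_(m, n)) :=
  forall i j, 0 < A i j.
Definition nneg_mx (R : realType) (m n : nat) (A : 'M[R]_(m, n)) :=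
  forall i j, 0 <= A i j.

Section Nonnegative.
Variable R : realType.

(** The reciprocal of 1 plus the sum of the reciprocals; the 1 covers an empty index type. *)
Lemma fin_pos_lb (I : finType) (f : I -> R) : (forall i, 0 < f i) ->
  exists2 e, 0 < e & forall i, e <= f i.
Proof.
move=> f0; pose S := 1 + \sum_i (f i)^-1.
have S0 : 0 < S by rewrite ltr_pwDl// sumr_ge0// => i _; rewrite invr_ge0 ltW.
exists S^-1 => [|i]; first by rewrite invr_gt0.
rewrite -[f i]invrK lef_pV2 ?posrE ?invr_gt0//.
rewrite /S (bigD1 i)//= addrCA lerDl addr_ge0// sumr_ge0// => j _.
by rewrite invr_ge0 ltW.
Qed.

Lemma nneg_mulmx m n p (A : 'M[R]_(m, n)) (B : 'M[R]_(n, p)) :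
  nneg_mx A -> nneg_mx B -> nneg_mx (A *m B).
Proof. by move=> A0 B0 i j; rewrite mxE sumr_ge0// => k _; rewrite mulr_ge0. Qed.

Lemma nneg_exp n (A : 'M[R]_n) k : nneg_mx A -> nneg_mx (A ^+ k).
Proof.
move=> A0; elim: k => [|k IH]; last by rewrite exprS; exact: nneg_mulmx.
by rewrite expr0 => i j; rewrite mxE; case: (_ == _).
Qed.

Lemma nneg_scalar n : nneg_mx (1%:M : 'M[R]_n).
Proof. by move=> i j; rewrite mxE; case: (_ == _). Qed.

Lemma pos_mulmx m n p (A : 'M[R]_(m, n)) (B : 'M[R]_(n, p)) j :
  pos_mx A -> nneg_mx B -> (exists i, 0 < B i j) -> forall i, 0 < (A *m B) i j.
Proof.
move=> A0 B0 [k kB] i; rewrite mxE (bigD1 k)//= ltr_wpDr ?mulr_gt0//.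
by rewrite sumr_ge0// => l _; rewrite mulr_ge0// ltW.
Qed.

(* The negative part of a solution is a subsolution, and testing it against
   [z] forces it to vanish. *)
Lemma nonneg_solution n (B : 'M[R]_n) (z : 'cV[R]_n) (s : R) (v : 'rV[R]_n) :
  nneg_mx B -> pos_mx z -> (forall i, (B *m z) i 0 < s * z i 0) ->
  nneg_mx (v *m (s%:M - B)) -> nneg_mx v.
Proof.
move=> B0 z0 Bz hv.
pose w : 'rV[R]_n := \row_j Num.max 0 (- v 0 j).
have w0 : nneg_mx w by move=> a j; rewrite mxE le_max lexx.
have vw j : - v 0 j <= w 0 j by rewrite mxE le_max lexx orbT.
have sub j : s * w 0 j <= (w *m B) 0 j.
  rewrite {1}/w mxE; case: (lerP 0 (v 0 j)) => vj.
    by rewrite max_l ?oppr_le0// mulr0; exact: nneg_mulmx.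
  rewrite max_r; last by rewrite oppr_ge0 ltW.
  have := hv 0 j; rewrite mulmxBr mul_mx_scalar !mxE subr_ge0 => h.
  apply: (@le_trans _ _ (- \sum_k v 0 k * B k j)).
    by rewrite mulrN lerN2.
  by rewrite -sumrN; apply: ler_sum => k _; rewrite -mulNr ler_wpM2r.
move=> a j; rewrite (ord1 a) {a} leNgt; apply/negP => vj.
have wj : 0 < w 0 j by apply: lt_le_trans (vw j); rewrite oppr_gt0.
have h1 : \sum_k (s * w 0 k) * z k 0 <= \sum_k (w *m B) 0 k * z k 0.
  by apply: ler_sum => k _; rewrite ler_wpM2r// ltW.
have h2 : \sum_k (w *m B) 0 k * z k 0 = \sum_k w 0 k * (B *m z) k 0.
  have /matrixP/(_ 0 0) := mulmxA w B z.
  by rewrite [X in X = _]mxE [X in _ = X]mxE.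
have h3 : \sum_k w 0 k * (B *m z) k 0 < \sum_k (s * w 0 k) * z k 0.
  rewrite [X in X < _](bigD1 j)//= [X in _ < X](bigD1 j)//=; apply: ltr_leD.
    by rewrite mulrAC [X in _ < X]mulrC ltr_pM2l.
  apply: ler_sum => k _; rewrite mulrAC [X in _ <= X]mulrC.
  by rewrite ler_wpM2l// ltW.
by move: h1; rewrite h2 leNgt h3.
Qed.

(** By [nonneg_solution], a row vector of the kernel and its opposite are both nonnegative. *)
Lemma dominated_unitmx n (B : 'M[R]_n) (z : 'cV[R]_n) (s : R) :
  nneg_mx B -> pos_mx z -> (forall i, (B *m z) i 0 < s * z i 0) ->
  s%:M - B \in unitmx.
Proof.
move=> B0 z0 Bz; rewrite unitmxE unitfE; apply/negP => /det0P[v v0 hv].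
have ns := nonneg_solution B0 z0 Bz.
move/negP: v0; apply.
have h1 : nneg_mx v by apply: ns; rewrite hv => i j; rewrite mxE.
have h2 : nneg_mx (- v) by apply: ns; rewrite mulNmx hv oppr0 => i j; rewrite mxE.
apply/eqP/rowP => j; rewrite mxE; apply/eqP; rewrite eq_le h1 andbT.
by have := h2 0 j; rewrite mxE oppr_ge0.
Qed.

Lemma nneg_invmx n (B : 'M[R]_n) (z : 'cV[R]_n) (s : R) :
  nneg_mx B -> pos_mx z -> (forall i, (B *m z) i 0 < s * z i 0) ->
  nneg_mx (invmx (s%:M - B)).
Proof.
move=> B0 z0 Bz i j.
have u := dominated_unitmx B0 z0 Bz.
have := nonneg_solution B0 z0 Bz (v := row i (invmx (s%:M - B))).
rewrite -row_mul mulVmx// => /(_ _ 0 j); rewrite mxE; apply => a b.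
by rewrite mxE; exact: nneg_scalar.
Qed.

Section Resolvent.
Variables (n : nat) (Q : 'M[R]_n) (mu : R).
Hypothesis Q0 : nneg_mx Q.
Hypothesis eig_le : forall x, eigenvalue Q x -> x <= mu.

Let resolvent_unit s : mu < s -> s%:M - Q \in unitmx.
Proof.
move=> ms; rewrite unitmxE unitfE; apply/negP => /det0P[v v0 hv].
have : eigenvalue Q s.
  apply/eigenvalueP; exists v => //; apply/eqP.
  by rewrite eq_sym -subr_eq0 -mul_mx_scalar -mulmxBr hv.
by move/eig_le; rewrite leNgt ms.
Qed.

(* Up to the square of the characteristic polynomial, the entries of the
   resolvent. *)
Let q i j : {poly R} := char_poly Q * (\adj (char_poly_mx Q)) i j.

Let horner_char_mx s : map_mx (horner_eval s) (char_poly_mx Q) = s%:M - Q.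
Proof.
apply/matrixP => i j; rewrite !mxE /horner_eval hornerD hornerN hornerC.
by rewrite hornerMn hornerX.
Qed.

Let qE s i j : mu < s ->
  (q i j).[s] = (\det (s%:M - Q)) ^+ 2 * (invmx (s%:M - Q)) i j.
Proof.
move=> ms; have u := resolvent_unit ms.
have d0 : \det (s%:M - Q) != 0 by rewrite -unitfE -unitmxE.
have hd : (char_poly Q).[s] = \det (s%:M - Q).
  by rewrite -horner_char_mx det_map_mx.
have ha : ((\adj (char_poly_mx Q)) i j).[s] = (\adj (s%:M - Q)) i j.
  by rewrite -horner_char_mx -map_mx_adj [RHS]mxE.
have hi : (invmx (s%:M - Q)) i j = (\det (s%:M - Q))^-1 * (\adj (s%:M - Q)) i j.
  by rewrite /invmx u [LHS]mxE.
by rewrite /q hornerM hd ha hi; field.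
Qed.

(** Nonnegativity holds above the row sums by strict dominance. If it failed at s, take the supremum
    t of the bad points: by continuity t is good, and the resolvent identity carries nonnegativity
    from t to points slightly on its left, against the choice of t. *)
Lemma resolvent_ge0 s : mu < s -> nneg_mx (invmx (s%:M - Q)).
Proof.
move=> ms i0 j0; rewrite leNgt; apply/negP => neg.
have sgn t i j : mu < t -> ((q i j).[t] < 0) = ((invmx (t%:M - Q)) i j < 0).
  move=> mt; have d0 : \det (t%:M - Q) != 0.
    by rewrite -unitfE -unitmxE; exact: resolvent_unit.
  by rewrite qE// pmulr_rlt0// lt_neqAle eq_sym sqrf_eq0 d0 sqr_ge0.
pose bad := [set t : R | s <= t /\ exists i j, (q i j).[t] < 0].
have bs : bad s by split => //; exists i0, j0; rewrite sgn.
(* Exceeds every row sum, so beyond b the constant vector 1 satisfies the strict inequality of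
   [nneg_invmx]. *)
pose b := 1 + \sum_i \sum_j Q i j.
have ub : ubound bad b.
  move=> t [st [i [j h]]]; rewrite leNgt; apply/negP => bt.
  have mt : mu < t by apply: lt_le_trans st.
  move: h; rewrite sgn// ltNge => /negP[].
  apply: (@nneg_invmx _ _ (const_mx 1)) => // [k l|k]; first by rewrite mxE.
  rewrite !mxE mulr1; apply: le_lt_trans bt.
  under eq_bigr do rewrite mxE mulr1.
  rewrite /b [X in _ <= 1 + X](bigD1 k)//= addrCA lerDl addr_ge0// sumr_ge0// => l _.
  by apply: sumr_ge0 => m _; exact: Q0.
have hs : has_sup bad by split; [exists s|exists b].
set t := sup bad.
have st : s <= t by apply: ub_le_sup => //; exists b.
have mt : mu < t by apply: lt_le_trans st.
have tgood i j : 0 <= (q i j).[t].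
  rewrite leNgt; apply/negP => h.
  have : \forall x \near t, (q i j).[x] < 0.
    by have /cvgr_lt := @continuous_horner R (q i j) t; apply.
  move=> /nbhs_ballP[e /= e0 he].
  have : bad (t + e / 2).
    split; first by rewrite (le_trans st)// lerDl divr_ge0// ltW.
    exists i, j; apply: he; rewrite /ball/= opprD addNKr normrN gtr0_norm ?divr_gt0//.
    by rewrite ltr_pdivrMr// ltr_pMr// ltr1n.
  move=> hb; have := ub_le_sup (ex_intro _ b ub : has_ubound bad) hb.
  by rewrite -/t gerDl leNgt divr_gt0.
pose B := invmx (t%:M - Q).
have B0 : nneg_mx B by move=> i j; rewrite leNgt -sgn// -leNgt.
(* Within distance e to the left of t, the matrix (t - x) B has row sums below 1, so
   [nonneg_solution] applies to the resolvent identity [CE]. *)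
pose e := (1 + \sum_i \sum_j B i j)^-1.
have S0 : 0 <= \sum_i \sum_j B i j.
  by apply: sumr_ge0 => i _; apply: sumr_ge0.
have e0 : 0 < e by rewrite invr_gt0 ltr_pwDl.
have [x badx xt] := sup_adherent e0 hs.
have {}xt : t - e < x by [].
have xlet : x <= t by apply: ub_le_sup => //; exists b.
case: badx => sx [i [j]]; have mx : mu < x by apply: lt_le_trans sx.
rewrite sgn// ltNge => /negP[].
have uB := resolvent_unit mt; have ux := resolvent_unit mx.
pose C := invmx (x%:M - Q).
have CE : C *m (1%:M - (t - x) *: B) = B.
  have : C *m (x%:M - Q) = 1%:M by rewrite mulVmx.
  have -> : x%:M - Q = (t%:M - Q) - (t - x)%:M.
    apply/matrixP => k m; rewrite !mxE.
    by case: (k == m); rewrite ?mulr1n ?mulr0n; ring.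
  move=> /(congr1 (mulmx^~ B)); rewrite mul1mx -mulmxA mulmxBl mulmxV//.
  by rewrite mul_scalar_mx.
have := @nonneg_solution n ((t - x) *: B) (const_mx 1) 1 (row i C).
move=> /(_ _ _ _ _ 0 j); rewrite [_ 0 j]mxE; apply.
- by move=> k l; rewrite mxE mulr_ge0// subr_ge0.
- by move=> k l; rewrite mxE ltr01.
- move=> k; rewrite -scalemxAl !mxE mulr1.
  under eq_bigr do rewrite mxE mulr1.
  apply: (@le_lt_trans _ _ ((t - x) * \sum_i \sum_j B i j)).
    rewrite ler_wpM2l ?subr_ge0// [leRHS](bigD1 k)//= lerDl sumr_ge0// => l _.
    exact: sumr_ge0.
  apply: (@le_lt_trans _ _ (e * \sum_i \sum_j B i j)).
    by rewrite ler_wpM2r// lerBlDr -lerBlDl ltW.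
  by rewrite mulrC ltr_pdivrMr ?mul1r ?ltr_pwDl// ltrDr.
- by move=> k l; rewrite -row_mul CE mxE.
Qed.

End Resolvent.

End Nonnegative.
(** (1 + Q)^L dominates Q^m entrywise for every m <= L, and L is the sum of the exponents that
    irreducibility provides. *)
Lemma irreducible_pos_power (R : realType) n (Q : 'M[R]_n) : nneg_mx Q ->
  irreducible_mx Q -> exists L : nat, pos_mx ((1%:M + Q) ^+ L).
Proof.
move=> Q0 irr.
have A0 : nneg_mx (1%:M + Q).
  by move=> i j; rewrite mxE addr_ge0//; exact: nneg_scalar.
have irr' (ab : 'I_n * 'I_n) : exists m, 0 < (Q ^+ m) ab.1 ab.2.
  by have [m _ h] := irr ab.1 ab.2; exists m.
have [f hf] := fin_all_exists irr'.
pose L := (\sum_ab f ab)%N; exists L => i j.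
have mono k m : (m <= k)%N -> forall a b, (Q ^+ m) a b <= ((1%:M + Q) ^+ k) a b.
  elim: k m => [|k IH] m.
    by rewrite leqn0 => /eqP -> a b; rewrite !expr0.
  rewrite leq_eqVlt => /orP[/eqP -> a b|mk a b].
    rewrite !exprS -!mulmxE mulmxDl mul1mx [leRHS]mxE.
    rewrite -[leLHS]add0r; apply: lerD; first exact: nneg_exp.
    by rewrite !mxE; apply: ler_sum => c _; rewrite ler_wpM2l// IH.
  rewrite exprS -mulmxE mulmxDl mul1mx [leRHS]mxE -[leLHS]addr0.
  by apply: lerD; [exact: IH|apply: nneg_mulmx => //; exact: nneg_exp].
apply: lt_le_trans (hf (i, j)) _; apply: mono.
by rewrite /L (bigD1 (i, j))//= leq_addr.
Qed.

Lemma trmx_expr (R : realType) n (Q : 'M[R]_n) k : (Q ^+ k)^T = (Q^T) ^+ k.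
Proof.
elim: k => [|k IH]; first by rewrite !expr0 trmx1.
by rewrite exprS exprSr -!mulmxE trmx_mul IH.
Qed.

Lemma irreducible_tr (R : realType) n (Q : 'M[R]_n) :
  irreducible_mx Q -> irreducible_mx Q^T.
Proof.
by move=> irr a b; have [m m0 h] := irr b a; exists m => //; rewrite -trmx_expr mxE.
Qed.

Section Perron.
Variables (R : realType) (n : nat) (Q : 'M[R]_n) (mu : R).
Hypothesis Q0 : nneg_mx Q.
Hypothesis irr : irreducible_mx Q.

Lemma mulmx_exp_eigen (z : 'cV[R]_n) (s : R) (A : 'M[R]_n) k :
  A *m z = s *: z -> A ^+ k *m z = s ^+ k *: z.
Proof.
move=> h; elim: k => [|k IH]; first by rewrite !expr0 mul1mx scale1r.
by rewrite exprSr -mulmxE -mulmxA h -scalemxAr IH scalerA exprS.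
Qed.

Lemma eigen_pos (z : 'cV[R]_n) (s : R) : nneg_mx z -> z != 0 ->
  Q *m z = s *: z -> pos_mx z.
Proof.
move=> z0 zn0 hz.
have [b zb] : exists b, z b 0 != 0.
  apply/existsP; rewrite -negb_forall; apply: contra zn0 => /forallP h.
  by apply/eqP/colP => i; rewrite mxE; apply/eqP.
have {}zb : 0 < z b 0 by rewrite lt_neqAle eq_sym zb z0.
move=> a j; rewrite (ord1 j) lt_neqAle z0 andbT eq_sym; apply/eqP => za.
have [m _ hm] := irr a b.
have /matrixP/(_ a 0) := mulmx_exp_eigen m hz.
rewrite [RHS]mxE za mulr0 mxE (bigD1 b)//=; apply/eqP.
rewrite gt_eqF// ltr_pwDl ?mulr_gt0//.
by apply: sumr_ge0 => k _; rewrite mulr_ge0//; exact: nneg_exp.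
Qed.

Hypothesis eig_le : forall x, eigenvalue Q x -> x <= mu.

(** If Q z >= mu z were strict somewhere, a positive power P of 1 + Q would make it strict
    everywhere for y = P z, so that Q y >= s y for some s > mu. The nonnegative resolvent at s then
    gives y <= 0, hence y = 0, a contradiction. *)
Lemma supereigen_eigen (z : 'cV[R]_n) : nneg_mx z ->
  nneg_mx (Q *m z - mu *: z) -> Q *m z = mu *: z.
Proof.
move=> z0 hz; apply/eqP; rewrite -subr_eq0; apply: contraT => D0.
have [L PL] := irreducible_pos_power Q0 irr.
pose P := (1%:M + Q) ^+ L.
have P0 : nneg_mx P by move=> i j; exact/ltW/PL.
have QP : Q *m P = P *m Q.
  by apply: commrX; apply: commrD; [exact: commr1|].
pose y := P *m z.
have Dpos : pos_mx (P *m (Q *m z - mu *: z)).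
  move=> i j; apply: pos_mulmx => //.
  have [b hb] : exists b, (Q *m z - mu *: z) b 0 != 0.
    apply/existsP; rewrite -negb_forall; apply: contra D0 => /forallP h.
    by apply/eqP/colP => k; rewrite [RHS]mxE; apply/eqP.
  by exists b; rewrite (ord1 j) lt_neqAle eq_sym hb; exact: hz.
have y0 : nneg_mx y by exact: nneg_mulmx.
have Dy : P *m (Q *m z - mu *: z) = Q *m y - mu *: y.
  by rewrite mulmxBr mulmxA -QP -mulmxA -scalemxAr.
have [e e0 he] := fin_pos_lb (fun i => Dpos i 0).
pose S := 1 + \sum_i y i 0.
have S0 : 0 < S by rewrite ltr_pwDl// sumr_ge0// => i _; exact: y0.
have yS i : y i 0 <= S.
  rewrite /S (bigD1 i)//= addrCA lerDl addr_ge0// sumr_ge0// => k _; exact: y0.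
(* The entries of Q y - mu y are at least e and those of y at most S, which leaves room for the
   increment e / S. *)
pose s := mu + e / S.
have ms : mu < s by rewrite ltrDl divr_gt0.
have B0 := resolvent_ge0 Q0 eig_le ms.
have u : s%:M - Q \in unitmx.
  rewrite unitmxE unitfE; apply/negP => /det0P[v v0 hv].
  have : eigenvalue Q s.
    apply/eigenvalueP; exists v => //; apply/eqP.
    by rewrite eq_sym -subr_eq0 -mul_mx_scalar -mulmxBr hv.
  by move/eig_le; rewrite leNgt ms.
have sy i : ((s%:M - Q) *m y) i 0 <= 0.
  rewrite mulmxBl mul_scalar_mx [leLHS]mxE [(s *: y) i 0]mxE [(- _ : 'cV_n) i 0]mxE.
  have := he i; rewrite Dy [in leRHS]mxE [(- _ : 'cV_n) i 0]mxE [(mu *: y) i 0]mxE => h.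
  have : e / S * y i 0 <= e by rewrite mulrAC ler_pdivrMr// ler_wpM2l// ltW.
  by rewrite /s; lra.
have yle i : y i 0 <= 0.
  have -> : y = invmx (s%:M - Q) *m ((s%:M - Q) *m y) by rewrite mulKmx.
  rewrite mxE; apply: sumr_le0 => k _; rewrite mulr_ge0_le0//.
have yz : y = 0.
  by apply/colP => i; rewrite [RHS]mxE; apply/eqP; rewrite eq_le yle y0.
case/eqP: D0; apply/colP => i; exfalso.
by have := Dpos i 0; rewrite Dy yz mulmx0 scaler0 subrr mxE ltxx.
Qed.

End Perron.

Lemma character_eigenvalue_le (R : realType) n (Q : 'M[R]_n) mu :
  perron_frobenius_eigenvalue Q mu -> forall x, eigenvalue Q x -> x <= mu.
Proof.
move=> [_ h] x; rewrite -(eigenvalue_map (real_complex R)) => /h.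
rewrite normc_def /= expr0n addr0 sqrtr_sqr lecR => hx.
exact: le_trans (ler_norm x) hx.
Qed.
Lemma eigenvalue_tr (R : realType) n (Q : 'M[R]_n) x :
  eigenvalue Q^T x = eigenvalue Q x.
Proof.
rewrite !eigenvalue_root_char; congr (root _ x).
rewrite /char_poly /char_poly_mx -[RHS]det_tr; congr (\det _).
by rewrite linearB/= tr_scalar_mx map_trmx.
Qed.

Lemma rank1_mx11 (R : realType) (c : R) : (c%:M : 'M[R]_1) 0 0 = c.
Proof. by rewrite mxE mulr1n. Qed.

Section PerronVectors.
Variables (R : realType) (n : nat) (Q : 'M[R]_n) (mu : R).
Variables (pi : 'rV[R]_n) (zeta : 'cV[R]_n).
Hypothesis Q0 : nneg_mx Q.
Hypothesis irr : irreducible_mx Q.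
Hypothesis PF : perron_frobenius_eigenvalue Q mu.
Hypothesis vec : normalized_eigenvectors Q mu pi zeta.

Let abs m p (A : 'M[R]_(m, p)) := map_mx (fun x => `|x|) A.

Let abs0 m p (A : 'M[R]_(m, p)) : nneg_mx (abs A).
Proof. by move=> i j; rewrite mxE. Qed.

Let abs_neq0 m p (A : 'M[R]_(m, p)) : A != 0 -> abs A != 0.
Proof.
apply: contra => /eqP/matrixP h; apply/eqP/matrixP => i j.
by have := h i j; rewrite !mxE => /normr0_eq0.
Qed.

Let pi_neq0 : pi != 0.
Proof.
case: vec => _ _ _; apply: contra_eq_neq => ->.
by rewrite mul0mx; apply/eqP => /matrixP/(_ 0 0)/eqP; rewrite rank1_mx11 mxE eq_sym oner_eq0.
Qed.

Let zeta_neq0 : zeta != 0.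
Proof.
case: vec => _ _ _; apply: contra_eq_neq => ->.
by rewrite mulmx0; apply/eqP => /matrixP/(_ 0 0)/eqP; rewrite rank1_mx11 mxE eq_sym oner_eq0.
Qed.

Let eig_le := character_eigenvalue_le PF.

(** The triangle inequality gives A |z| >= s |z|, and [supereigen_eigen] turns this into an
    equality. *)
Lemma abs_eigen (A : 'M[R]_n) (s : R) (z : 'cV[R]_n) : nneg_mx A ->
  irreducible_mx A -> (forall x, eigenvalue A x -> x <= s) ->
  z != 0 -> A *m z = s *: z -> pos_mx (abs z) /\ A *m abs z = s *: abs z.
Proof.
move=> A0 Airr Ale zn0 hz.
have e : A *m abs z = s *: abs z.
  apply: (supereigen_eigen A0 Airr Ale) => // i j.
  rewrite (ord1 j) [leRHS]mxE [(- _ : 'cV_n) i 0]mxE [(s *: _ : 'cV_n) i 0]mxE [abs z i 0]mxE.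
  rewrite [(A *m abs z) i 0]mxE subr_ge0.
  apply: (@le_trans _ _ `|(A *m z) i 0|).
    by rewrite hz mxE normrM ler_wpM2r// ler_norm.
  rewrite mxE (le_trans (ler_norm_sum _ _ _))//; apply: ler_sum => k _.
  by rewrite normrM ?mxE (ger0_norm (A0 _ _)).
split=> //; exact: (eigen_pos A0 Airr (abs0 z) (abs_neq0 zn0) e).
Qed.

(* Either [abs z + z] or [abs z - z] vanishes, being eigenvectors, which are
   positive unless they are zero. *)
Lemma signed_eigen (A : 'M[R]_n) (s : R) (z : 'cV[R]_n) : nneg_mx A ->
  irreducible_mx A -> (forall x, eigenvalue A x -> x <= s) ->
  z != 0 -> A *m z = s *: z -> (exists i, 0 < z i 0) -> pos_mx z.
Proof.
move=> A0 Airr Ale zn0 hz [i zi].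
have [_ e] := abs_eigen A0 Airr Ale zn0 hz.
have p : pos_mx (abs z + z).
  apply: (@eigen_pos _ _ A A0 Airr _ s) => [k j||].
  - by rewrite !mxE -lerBlDr sub0r (le_trans (ler_norm _))// normrN.
  - apply/eqP => /matrixP/(_ i 0)/eqP; rewrite !mxE gt_eqF//.
    by rewrite addr_gt0// normr_gt0 gt_eqF.
  - by rewrite mulmxDr e hz scalerDr.
move=> k j; have := p k j; rewrite !mxE.
case: (ltrP 0 (z k j)) => // h.
by rewrite ler0_norm// addNr ltxx.
Qed.

(** Since the entries of pi add up to 1, one of them is positive, and [signed_eigen] spreads this to
    all of them. *)
Lemma perron_pi_gt0 : pos_mx pi.
Proof.
have [e1 e2 e3 e4] := vec.
suff h : pos_mx pi^T by move=> i j; have := h j i; rewrite mxE.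
apply: (@signed_eigen Q^T mu).
- by move=> i j; rewrite mxE.
- exact: irreducible_tr.
- by move=> x; rewrite eigenvalue_tr; exact: eig_le.
- by rewrite trmx_eq0.
- by rewrite -trmx_mul e1 linearZ.
- apply: contrapT => h.
  have : (pi *m (const_mx 1 : 'cV_n)) 0 0 <= 0.
    rewrite mxE; apply: sumr_le0 => k _; rewrite mxE mulr1 leNgt.
    by apply/negP => hk; apply: h; exists k; rewrite mxE.
  by rewrite e3 rank1_mx11 leNgt ltr01.
Qed.

Lemma perron_zeta_gt0 : pos_mx zeta.
Proof.
have [e1 e2 e3 e4] := vec.
apply: (@signed_eigen Q mu) => //.
apply: contrapT => h.
have : (pi *m zeta) 0 0 <= 0.
  rewrite mxE; apply: sumr_le0 => k _.
  rewrite mulr_ge0_le0 ?(ltW (perron_pi_gt0 _ _))// leNgt.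
  by apply/negP => hk; apply: h; exists k.
by rewrite e4 rank1_mx11 leNgt ltr01.
Qed.

(** A closed walk of length m > 0 at i makes (Q^m zeta)_i = mu^m zeta_i positive. *)
Lemma perron_value_gt0 : 0 < mu.
Proof.
have [e1 e2 e3 e4] := vec.
have [i _] : exists i, zeta i 0 != 0.
  apply/existsP; rewrite -negb_forall; apply: contra zeta_neq0 => /forallP h.
  by apply/eqP/colP => i; rewrite mxE; apply/eqP.
have z0 := perron_zeta_gt0.
have [m m0 hm] := irr i i.
have /matrixP/(_ i 0) := mulmx_exp_eigen m e2.
rewrite [RHS]mxE => h.
have mum : 0 < mu ^+ m.
  rewrite -(pmulr_lgt0 _ (z0 i 0)) -h mxE (bigD1 i)//= ltr_pwDl ?mulr_gt0//.
  by apply: sumr_ge0 => k _; rewrite mulr_ge0 ?(ltW (z0 _ _))//; exact: nneg_exp.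
have mu0 : 0 <= mu.
  rewrite -(pmulr_lge0 _ (z0 i 0)).
  have /matrixP/(_ i 0) := e2; rewrite [RHS]mxE => <-.
  by apply: nneg_mulmx => // a b; exact/ltW/z0.
rewrite lt_neqAle mu0 andbT eq_sym; apply/eqP => e; move: mum.
by rewrite e expr0n eqn0Ngt m0 ltxx.
Qed.

Section Substochastic.
Hypothesis row_le1 : forall i, \sum_j Q i j <= 1.

(** Both sides are pi (1 - Q) 1. The weights are positive and the row defects nonnegative, so mu = 1
    exactly when no row has a defect. *)
Let deficiency : \sum_i pi 0 i * (1 - \sum_j Q i j) = 1 - mu.
Proof.
have [e1 e2 e3 e4] := vec.
have /matrixP/(_ 0 0) := e3; rewrite rank1_mx11 mxE.
under eq_bigr do rewrite mxE mulr1.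
move=> s1.
under eq_bigr do rewrite mulrBr mulr1.
rewrite sumrB s1; congr (_ - _).
under eq_bigr do rewrite mulr_sumr.
rewrite exchange_big/= -[mu]mulr1 -s1 mulr_sumr; apply: eq_bigr => j _.
have /matrixP/(_ 0 j) := e1; rewrite [RHS]mxE => <-.
by rewrite mxE.
Qed.

Lemma perron_value_le1 : mu <= 1.
Proof.
rewrite -subr_ge0 -deficiency; apply: sumr_ge0 => i _.
by rewrite mulr_ge0 ?subr_ge0// ltW// perron_pi_gt0.
Qed.

Lemma perron_value_eq1 : mu = 1 <-> forall i, \sum_j Q i j = 1.
Proof.
split=> [m1 i|h]; last first.
  apply/eqP; rewrite eq_sym -subr_eq0 -deficiency; apply/eqP/big1 => i _.
  by rewrite h subrr mulr0.
have /eqP := deficiency; rewrite m1 subrr psumr_eq0; last first.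
  by move=> k _; rewrite mulr_ge0 ?subr_ge0// ltW// perron_pi_gt0.
move=> /allP/(_ i); rewrite mem_index_enum => /(_ isT)/=.
rewrite mulf_eq0 gt_eqF ?perron_pi_gt0//= subr_eq0 => /eqP <-//.
Qed.

End Substochastic.

End PerronVectors.

(** * Recursion of a single block *)

Section WeightedNorm.
Variables (R : realType) (n : nat) (z : 'cV[R]_n).
Hypothesis z0 : pos_mx z.

(** When z is a right eigenvector for mu, v |-> v Q multiplies this norm by at most mu, whereas the
    plain l1 norm sees only the row sums. *)
Definition wnorm (v : 'rV[R]_n) : R := \sum_i `|v 0 i| * z i 0.

Lemma wnorm_ge0 v : 0 <= wnorm v.
Proof. by apply: sumr_ge0 => i _; rewrite mulr_ge0// ltW. Qed.

Lemma wnorm_seminorm : seminorm wnorm.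
Proof.
split.
- move=> u v; rewrite /wnorm -big_split; apply: ler_sum => i _ /=.
  by rewrite -mulrDl ler_wpM2r ?(ltW (z0 _ _))// mxE ler_normD.
- move=> c v; rewrite /wnorm mulr_sumr; apply: eq_bigr => i _.
  by rewrite mxE normrM mulrA.
- exists (\sum_i z i 0) => [|v].
    by apply: sumr_ge0 => i _; exact: ltW.
  rewrite mulr_suml; apply: ler_sum => i _; rewrite mulrC.
  by rewrite ler_wpM2l ?ler_l1norm// ltW.
Qed.

Lemma wnorm_mulmx (A : 'M[R]_n) (c : R) : nneg_mx A ->
  (forall i, (A *m z) i 0 <= c * z i 0) -> forall v, wnorm (v *m A) <= c * wnorm v.
Proof.
move=> A0 Az v.
apply: (@le_trans _ _ (\sum_j \sum_i `|v 0 i| * (A i j * z j 0))).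
  apply: ler_sum => j _; rewrite mxE.
  apply: (@le_trans _ _ ((\sum_i `|v 0 i| * A i j) * z j 0)).
    rewrite ler_wpM2r ?(ltW (z0 _ _))// (le_trans (ler_norm_sum _ _ _))//.
    by apply: ler_sum => i _; rewrite normrM (ger0_norm (A0 _ _)).
  by rewrite mulr_suml; apply: ler_sum => i _; rewrite mulrA.
rewrite exchange_big mulr_sumr/=; apply: ler_sum => i _.
rewrite -mulr_sumr mulrCA ler_wpM2l//.
by apply: le_trans (Az i); rewrite mxE.
Qed.

Lemma l1norm_wnorm : exists2 C, 0 <= C & forall v, l1norm v <= C * wnorm v.
Proof.
have [e e0 he] := fin_pos_lb (fun i => z0 i 0).
exists e^-1 => [|v]; first by rewrite invr_ge0 ltW.
rewrite mulrC ler_pdivlMr// mulr_suml; apply: ler_sum => i _.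
by rewrite ler_wpM2l.
Qed.

End WeightedNorm.

Lemma subcritical_contractive (R : realType) n (Q : 'M[R]_n) (z : 'cV[R]_n)
    (mu l : R) : nneg_mx Q -> pos_mx z -> Q *m z = mu *: z -> 0 <= mu < l ->
  seminorm (wnorm z) /\ contractive Q l (wnorm z).
Proof.
move=> Q0 z0 hz /andP[mu0 mul]; split; first exact: wnorm_seminorm.
exists (l - mu); first by rewrite subr_gt0 mul gerBl.
move=> h v /andP[h0 h1]; have nuS := wnorm_seminorm z0.
apply: (le_trans (seminormD nuS _ _)); rewrite (seminormZ nuS) ger0_norm//.
have -> : l - (l - mu) = mu by ring.
rewrite mulrDl mul1r lerD2l [mu * h]mulrC -mulrA ler_wpM2l//.
by apply: wnorm_mulmx => // i; rewrite hz mxE.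
Qed.

Section Leading.
Variables (R : realType) (n : nat) (Q : 'M[R]_n) (mu : R).
Variables (pi : 'rV[R]_n) (z : 'cV[R]_n).
Hypotheses (Q0 : nneg_mx Q) (irr : irreducible_mx Q).
Hypotheses (mu0 : 0 < mu) (z0 : pos_mx z).
Hypotheses (piE : pi *m Q = mu *: pi) (zE : Q *m z = mu *: z).
Hypothesis (piz : pi *m z = 1%:M).

(** For 0 <= h <= 1, 1 + h Q is the convex combination (1 - h) + h A, so it is enough to contract A,
    whose Perron value is r. *)
Let A : 'M[R]_n := 1%:M + Q.
Let r := 1 + mu.
Let r0 : 0 < r. Proof. by rewrite addr_gt0. Qed.
Let A0 : nneg_mx A.
Proof. by move=> i j; rewrite mxE addr_ge0//; exact: nneg_scalar. Qed.
Let AE : A *m z = r *: z.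
Proof. by rewrite mulmxDl mul1mx zE scalerDl scale1r. Qed.

Let proj : 'M[R]_n := 1%:M - z *m pi.

Let projz (v : 'rV[R]_n) : (v *m proj) *m z = 0.
Proof. by rewrite -mulmxA mulmxBl mul1mx -mulmxA piz mulmx1 subrr mulmx0. Qed.

Let projQ : proj *m Q = Q *m proj.
Proof.
rewrite /proj mulmxBl mulmxBr mul1mx mulmx1 -mulmxA piE mulmxA zE.
by rewrite -scalemxAr -scalemxAl.
Qed.

Let projA : proj *m A = A *m proj.
Proof. by rewrite /A mulmxDl mulmxDr projQ mulmx1 mul1mx. Qed.

(* A power of [1 + Q] dominates a multiple of the rank-one matrix [z *m pi],
   which annihilates the vectors orthogonal to [z]. *)
Let power_contraction : exists L, exists2 e, 0 < e <= 2^-1 & (0 < L)%N /\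
  forall v, v *m z = 0 -> wnorm z (v *m A ^+ L) <= r ^+ L * (1 - e) * wnorm z v.
Proof.
have [L0 PL0] := irreducible_pos_power Q0 irr.
pose L := L0.+1.
have PL : pos_mx (A ^+ L).
  move=> i j; rewrite /L exprSr -mulmxE; apply: pos_mulmx => //.
  exists j; rewrite mxE [1%:M j j]mxE eqxx ltr_pwDl//.
have [e e0 he] := fin_pos_lb (fun ij : 'I_n * 'I_n => PL ij.1 ij.2).
pose S := 1 + \sum_(ij : 'I_n * 'I_n) `|z ij.1 0 * pi 0 ij.2|.
have S0 : 0 < S by rewrite ltr_pwDl// sumr_ge0.
have dom i j : e / S * (z i 0 * pi 0 j) <= (A ^+ L) i j.
  apply: (le_trans _ (he (i, j))); rewrite mulrAC ler_pdivrMr// ler_wpM2l ?(ltW e0)//.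
  apply: (le_trans (ler_norm _)); rewrite /S (bigD1 (i, j))//= addrCA lerDl.
  by rewrite addr_ge0// sumr_ge0.
have rL : 0 < r ^+ L by rewrite exprn_gt0.
pose d := Num.min (e / S / r ^+ L) 2^-1.
have d0 : 0 < d by rewrite /d lt_min invr_gt0 ltr0n andbT !divr_gt0.
exists L; exists d; first by rewrite d0/= /d ge_min lexx orbT.
split=> // v vz.
have -> : v *m A ^+ L = v *m (A ^+ L - (e / S) *: (z *m pi)).
  by rewrite mulmxBr -scalemxAr mulmxA vz mul0mx scaler0 subr0.
apply: (@le_trans _ _ ((r ^+ L - e / S) * wnorm z v)).
  apply: wnorm_mulmx => // [i j|i].
    rewrite mxE [(- _ : 'M[R]_n) i j]mxE [(_ *: _ : 'M[R]_n) i j]mxE subr_ge0.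
    by rewrite [(z *m pi) i j]mxE big_ord1.
  rewrite mulmxBl (mulmx_exp_eigen L AE) -scalemxAl -mulmxA piz mulmx1.
  by rewrite -scalerBl mxE.
rewrite ler_wpM2r ?wnorm_ge0// mulrBr mulr1 lerD2l lerN2.
rewrite -ler_pdivlMl// mulrC /d ge_min lexx//.
Qed.

(** Renorming turns the contraction of a power of A into one of A itself: in [nu0] a factor A shifts
    the sum by one index, and Bernoulli's inequality q^(L+1) >= 1 - e compares the last term with
    the first. Composing with the projection that kills pi gives a seminorm on all vectors. *)
Lemma leading_contractive : exists nu, [/\ seminorm nu, contractive Q mu nu &
  exists2 C, 0 <= C & forall v, l1norm (v - (v *m z) *m pi) <= C * nu v].
Proof.
have [L1 [e /andP[e0 e12] [L0 HL]]] := power_contraction.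
case: L1 L0 HL => // L _ HL.
have e1 : e < 1 by apply: (le_lt_trans e12); rewrite invf_lt1// ltr1n.
have Lr : (L.+1%:R : R) != 0 by rewrite pnatr_eq0.
pose q := 1 - e / L.+1%:R.
have eL : 0 < e / L.+1%:R < 1.
  rewrite divr_gt0 ?ltr0n//= ltr_pdivrMr ?ltr0n// mul1r (lt_le_trans e1)//.
  by rewrite ler1n.
have qq : 0 < q by rewrite subr_gt0; case/andP: eL.
have q0 := ltW qq.
have q1 : q < 1 by rewrite gtrBl; case/andP: eL.
have qL : 1 - e <= q ^+ L.+1.
  have := @expr_bernoulli R (e / L.+1%:R) L.+1.
  by rewrite (ltW (proj1 (andP eL))) (ltW (proj2 (andP eL))) mulrC divfK// => /(_ isT).
have wS := wnorm_seminorm z0.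
pose nu0 v := \sum_(m < L.+1) q ^+ (L.+1 - m) / r ^+ m * wnorm z (v *m A ^+ m).
have nu00 v : 0 <= nu0 v.
  apply: sumr_ge0 => m _; rewrite mulr_ge0 ?wnorm_ge0//.
  by rewrite divr_ge0 ?exprn_ge0// ltW.
have cf0 m : 0 <= q ^+ (L.+1 - m) / r ^+ m by rewrite divr_ge0 ?exprn_ge0// ltW.
have nu0S : seminorm nu0.
  split.
  - move=> u v; rewrite /nu0 -big_split; apply: ler_sum => m _ /=.
    by rewrite -mulrDr ler_wpM2l// mulmxDl; exact: (seminormD wS).
  - move=> c v; rewrite /nu0 mulr_sumr; apply: eq_bigr => m _.
    by rewrite -scalemxAl (seminormZ wS) mulrCA.
  - have [C C0 hC] := seminorm_l1 wS.
    pose D m := q ^+ (L.+1 - m) / r ^+ m * (C * \sum_i \sum_j `|(A ^+ m) i j|).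
    exists (\sum_(m < L.+1) D m) => [|v].
      apply: sumr_ge0 => m _; rewrite mulr_ge0// mulr_ge0// sumr_ge0// => i _.
      exact: sumr_ge0.
    rewrite /nu0 mulr_suml; apply: ler_sum => m _; rewrite /D -[leRHS]mulrA.
    rewrite ler_wpM2l// (le_trans (hC _))// -mulrA ler_wpM2l//.
    exact: l1norm_mulmx.
have nu0A v : v *m z = 0 -> nu0 (v *m A) <= r * q * nu0 v.
  move=> vz.
  rewrite /nu0 big_ord_recr/= [X in _ <= _ * X]big_ord_recl/= [leRHS]mulrDr [leLHS]addrC.
  apply: lerD.
    rewrite subSn// subnn expr1 subn0 expr0 divr1 mulmx1.
    rewrite -mulmxA mulmxE -exprS.
    apply: (@le_trans _ _ (q / r ^+ L * (r ^+ L.+1 * (1 - e) * wnorm z v))).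
      by rewrite ler_wpM2l ?HL// divr_ge0// exprn_ge0// ltW.
    rewrite exprS.
    have -> : q / r ^+ L * (r * r ^+ L * (1 - e) * wnorm z v) =
       r * q * ((1 - e) * wnorm z v).
      by field; rewrite expf_neq0// gt_eqF.
    rewrite ler_wpM2l ?mulr_ge0 ?(ltW r0)//.
    by rewrite ler_wpM2r// wnorm_ge0.
  rewrite mulr_sumr; apply: ler_sum => m _ /=.
  rewrite /bump/= add1n subSS -mulmxA mulmxE -exprS.
  rewrite subSn ?(ltnW (ltn_ord m))// le_eqVlt; apply/orP; left; apply/eqP.
  by rewrite !exprS; field; rewrite expf_neq0 gt_eqF.
pose nu v := nu0 (v *m proj).
have [C C0 hC] := l1norm_wnorm z0.
exists nu; split.
- split.
  + by move=> u v; rewrite /nu mulmxDl; exact: (seminormD nu0S).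
  + by move=> c v; rewrite /nu -scalemxAl (seminormZ nu0S).
  + have [D D0 hD] := seminorm_l1 nu0S.
    exists (D * \sum_i \sum_j `|proj i j|) => [|v].
      by rewrite mulr_ge0// sumr_ge0// => i _; apply: sumr_ge0.
    by rewrite (le_trans (hD _))// -mulrA ler_wpM2l// l1norm_mulmx.
(* (1 - h) + h r q = 1 + (mu - r (1 - q)) h; the minimum with mu ensures the bound delta <= l of
   [contractive]. *)
- exists (Num.min (r * (1 - q)) mu).
    by rewrite lt_min mu0 mulr_gt0 ?subr_gt0//= ge_min lexx orbT.
  move=> h v /andP[h0 h1].
  have -> : v + h *: (v *m Q) = (1 - h) *: v + h *: (v *m A).
    rewrite mulmxDr mulmx1 scalerDr addrA -scalerDl subrK scale1r//.
  rewrite /nu mulmxDl (le_trans (seminormD nu0S _ _))//.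
  rewrite -!scalemxAl !(seminormZ nu0S) -mulmxA -projA mulmxA.
  rewrite (ger0_norm h0) (ger0_norm (_ : 0 <= 1 - h)) ?subr_ge0//.
  apply: (@le_trans _ _ ((1 - h) * nu0 (v *m proj) + h * (r * q * nu0 (v *m proj)))).
    by rewrite lerD2l ler_wpM2l// nu0A.
  rewrite mulrA -mulrDl ler_wpM2r//.
  have : Num.min (r * (1 - q)) mu <= r * (1 - q) by rewrite ge_min lexx.
  move: (Num.min _ _) => m hm.
  have : h * m <= h * (r * (1 - q)) by rewrite ler_wpM2l.
  by rewrite /r; lra.
- exists (C / q ^+ L.+1); first by rewrite divr_ge0// exprn_ge0.
  move=> v.
  have -> : v - v *m z *m pi = v *m proj by rewrite mulmxBr mulmx1 mulmxA.
  rewrite (le_trans (hC _))// -mulrA ler_wpM2l// mulrC ler_pdivlMr ?exprn_gt0//.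
  rewrite /nu /nu0 big_ord_recl/= mulmx1.
  rewrite subn0 expr0 divr1 mulrC lerDl sumr_ge0// => m _.
  by rewrite mulr_ge0 ?wnorm_ge0// divr_ge0 ?exprn_ge0// ltW.
Qed.

End Leading.

(** * Component along a right eigenvector *)

Section EigenComponent.
Variables (R : realType) (n : nat) (Q : 'M[R]_n) (l : R) (u : 'cV[R]_n).
Hypotheses (l0 : 0 <= l) (uE : Q *m u = l *: u).
Local Notation g := (step R).
Local Notation rho := (ell_ratio R).

Let ev (v : 'rV[R]_n) : R := (v *m u) 0 0.

Let evD v w : ev (v + w) = ev v + ev w.
Proof. by rewrite /ev mulmxDl mxE. Qed.

Let evZ c v : ev (c *: v) = c * ev v.
Proof. by rewrite /ev -scalemxAl mxE. Qed.

Let evQ v : ev (v *m Q) = l * ev v.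
Proof. by rewrite /ev -mulmxA uE -scalemxAr mxE. Qed.

Let U := \sum_i `|u i 0|.
Let U0 : 0 <= U. Proof. exact: sumr_ge0. Qed.

Let ev_le v : `|ev v| <= U * l1norm v.
Proof.
rewrite /ev mxE (le_trans (ler_norm_sum _ _ _))// mulr_suml; apply: ler_sum => i _.
by rewrite normrM mulrC ler_wpM2l// ler_l1norm.
Qed.

Let ev_cvg v V : vcvg v V -> (fun N => ev (v N)) @ \oo --> ev V.
Proof. by move=> h; exact: (@vcvgM _ _ _ u _ _ h 0). Qed.

Let ev_psum k xi N : psum (fun m => ev ((scale l k m.+1)^-1 *: xi m)) N =
  ev (vsum l k xi N).
Proof.
elim: N => [|N IH]; first by rewrite /psum /vsum !big_ord0 /ev mul0mx mxE.
by rewrite psumS IH vsumS evD.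
Qed.

Lemma scale00 k : scale l k 0 = 1.
Proof. by rewrite /scale /growth /ell !big_ord0 addr0 expr1n mulr1. Qed.

Section Order0.
Variables (x b xi : nat -> 'rV[R]_n).
Hypothesis rec : recursion Q x b xi.
Let z N := ev ((scale l 0 N)^-1 *: x N).
Let beta N := ev ((scale l 0 N)^-1 *: b N).

Let zE N : z N.+1 = z N + g N / (1 + l * g N) * beta N +
  ev ((scale l 0 N.+1)^-1 *: xi N).
Proof.
rewrite /z (normalized_recursion 0 l0 rec) evD evZ evD evZ evD evQ -/(z N) -/(beta N).
rewrite expr0; congr (_ + _); field.
by rewrite gt_eqF// growth_factor_gt0.
Qed.

Let beta_sum D : (forall N, \sum_(m < N) g m * l1norm ((scale l 0 m)^-1 *: b m) <= D) ->
  forall N, \sum_(m < N) g m * `|beta m| <= U * D.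
Proof.
move=> hD N; apply: (le_trans _ (ler_wpM2l U0 (hD N))).
rewrite mulr_sumr; apply: ler_sum => m _; rewrite mulrCA.
by apply: ler_wpM2l; [exact: step_ge0|exact: ev_le].
Qed.

(** Here [u] is any right eigenvector: zeta for an irreducible leading block, and later every
    coordinate vector for a zero block, where l = 0. *)
Lemma component0_le B :
  l1norm (x 0%N) <= B -> (forall N, l1norm (vsum l 0 xi N) <= B) ->
  (forall N, \sum_(m < N) g m * l1norm ((scale l 0 m)^-1 *: b m) <= B) ->
  forall N, `|((scale l 0 N)^-1 *: x N *m u) 0 0| <=
    3 * (\sum_i `|u i 0|) * B.
Proof.
move=> hx hS hb N.
have := order0_le l0 zE (beta_sum hb) (B := U * B) _ _ N.
rewrite -/U (_ : 3 * U * B = U * B + U * B + U * B); last by ring.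
apply.
  by rewrite /z scale00 invr1 scale1r (le_trans (ev_le _))// ler_wpM2l.
by move=> m; rewrite ev_psum (le_trans (ev_le _))// ler_wpM2l.
Qed.

Lemma component0_cvg D S : vcvg (vsum l 0 xi) S ->
  (forall N, \sum_(m < N) g m * l1norm ((scale l 0 m)^-1 *: b m) <= D) ->
  cvgn (fun N => ((scale l 0 N)^-1 *: x N *m u) 0 0).
Proof.
move=> hS hb; apply: (order0_cvg l0 zE (beta_sum hb)).
rewrite (_ : psum _ = fun N => ev (vsum l 0 xi N)).
  by apply/cvgP/ev_cvg; exact: hS.
by apply/funext => N; exact: ev_psum.
Qed.

End Order0.

Section OrderS.
Variables (k : nat) (x b xi : nat -> 'rV[R]_n).
Hypothesis rec : recursion Q x b xi.
Let z N := ev ((scale l k.+1 N)^-1 *: x N).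
Let beta N := ev ((scale l k N)^-1 *: b N).

Let zE N : z N.+1 = rho N ^+ k.+1 *
   (z N + g N / (1 + l * g N) * (beta N / ell R N)) +
  ev ((scale l k.+1 N.+1)^-1 *: xi N).
Proof.
rewrite /z (normalized_recursion k.+1 l0 rec) evD evZ evD evZ evD evQ -/(z N).
have -> : ev ((scale l k.+1 N)^-1 *: b N) = beta N / ell R N.
  rewrite /beta !evZ /scale exprSr !invfM; ring.
congr (_ + _); field.
by rewrite ell_neq0 gt_eqF// growth_factor_gt0.
Qed.

(** The drift is measured one logarithm below the scale of x, which produces the factor 1 / [ell] of
    the scalar recursion. *)
Lemma componentS_le B :
  l1norm (x 0%N) <= B -> (forall N, l1norm (vsum l k.+1 xi N) <= B) ->
  (forall N, l1norm ((scale l k N)^-1 *: b N) <= B) ->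
  forall N, `|((scale l k.+1 N)^-1 *: x N *m u) 0 0| <=
    (k.+1%:R + 2) * (\sum_i `|u i 0|) * B.
Proof.
move=> hx hS hb N; rewrite -mulrA.
apply: (orderS_le l0 (ltn0Sn k) zE) => [|m|m].
- by rewrite /z scale00 invr1 scale1r (le_trans (ev_le _))// ler_wpM2l.
- by rewrite ev_psum (le_trans (ev_le _))// ler_wpM2l.
- by rewrite (le_trans (ev_le _))// ler_wpM2l.
Qed.

Lemma componentS_cvg S bl : vcvg (vsum l k.+1 xi) S ->
  vcvg (fun N => (scale l k N)^-1 *: b N) bl ->
  (fun N => ((scale l k.+1 N)^-1 *: x N *m u) 0 0) @ \oo -->
    (bl *m u) 0 0 / k.+1%:R.
Proof.
move=> hS hb; apply: (orderS_cvg l0 (ltn0Sn k) zE); last exact: ev_cvg.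
rewrite (_ : psum _ = fun N => ev (vsum l k.+1 xi N)).
  by apply/cvgP/ev_cvg; exact: hS.
by apply/funext => N; exact: ev_psum.
Qed.

End OrderS.
End EigenComponent.

Section NonleadingBlock.
Variables (R : realType) (n : nat) (Q : 'M[R]_n) (z : 'cV[R]_n) (mu l : R).
Variable (k : nat).
Hypotheses (Q0 : nneg_mx Q) (z0 : pos_mx z) (zE : Q *m z = mu *: z).
Hypothesis (mul : 0 <= mu < l).

Let l0 : 0 < l. Proof. by case/andP: mul; exact: le_lt_trans. Qed.

Let dom i : (Q *m z) i 0 < l * z i 0.
Proof. by rewrite zE mxE ltr_pM2r//; case/andP: mul. Qed.

Lemma nonleading_unitmx : l%:M - Q \in unitmx.
Proof. exact: dominated_unitmx Q0 z0 dom. Qed.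

Lemma nonleading_invmx_ge0 : nneg_mx (invmx (l%:M - Q)).
Proof. exact: nneg_invmx Q0 z0 dom. Qed.

Lemma nonleading_le : exists2 C, 0 <= C & forall x b xi, recursion Q x b xi ->
  forall B, l1norm (x 0%N) <= B -> (forall N, l1norm (vsum l k xi N) <= B) ->
  (forall N, l1norm ((scale l k N)^-1 *: b N) <= B) ->
  forall N, l1norm ((scale l k N)^-1 *: x N) <= C * B.
Proof.
have [nuS Qnu] := subcritical_contractive Q0 z0 zE mul.
have [C C0 hC] := contractive_le k l0 nuS Qnu.
have [D D0 hD] := l1norm_wnorm z0.
exists (D * C) => [|x b xi rec B hx hS hb N]; first exact: mulr_ge0.
by rewrite (le_trans (hD _))// -mulrA ler_wpM2l// (hC _ _ _ rec).
Qed.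

(** The limit is the vector [ys] with [bl + ys *m Q = l *: ys], for which the forcing in
    [contractive_cvg] vanishes. *)
Lemma nonleading_cvg x b xi : recursion Q x b xi ->
  forall S, vcvg (vsum l k xi) S -> forall bl,
  vcvg (fun N => (scale l k N)^-1 *: b N) bl ->
  vcvg (fun N => (scale l k N)^-1 *: x N) (bl *m invmx (l%:M - Q)).
Proof.
move=> rec S hS bl hb.
have [nuS Qnu] := subcritical_contractive Q0 z0 zE mul.
have [D D0 hD] := l1norm_wnorm z0.
apply/vcvgP; set ys := bl *m _.
have hys : bl + ys *m Q - l *: ys = 0.
  have : ys *m (l%:M - Q) = bl by rewrite mulmxKV// nonleading_unitmx.
  by rewrite mulmxBr mul_mx_scalar => <-; rewrite subrK subrr.
have /= h := contractive_cvg l0 nuS Qnu rec hS hb (ys := ys).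
apply: (@squeeze_cvgr _ _ _ _ (fun=> 0)
  (fun N => D * wnorm z ((scale l k N)^-1 *: x N - ys))).
- by apply: nearW => N; rewrite l1norm_ge0 hD.
- exact: cvg_cst.
- rewrite -(mulr0 D); apply: cvgMl_tmp; apply: h.
  by rewrite hys -(scale0r 0) (seminormZ nuS) normr0 mul0r.
Qed.

End NonleadingBlock.

Section LeadingBlock.
Variables (R : realType) (n : nat) (Q : 'M[R]_n) (l : R).
Variables (pi : 'rV[R]_n) (z : 'cV[R]_n).
Hypotheses (Q0 : nneg_mx Q) (irr : irreducible_mx Q).
Hypotheses (l0 : 0 < l) (z0 : pos_mx z).
Hypotheses (piE : pi *m Q = l *: pi) (zE : Q *m z = l *: z).
Hypothesis (piz : pi *m z = 1%:M).

Let split v : v = (v - (v *m z) *m pi) + (v *m z) 0 0 *: pi.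
Proof. by rewrite [X in _ - X *m _]mx11_scalar mul_scalar_mx subrK. Qed.

(** The seminorm does not see the component along pi, so its bound D is supplied separately, from
    the scalar recursions. *)
Lemma leading_split_le k : exists2 C, 0 <= C & forall x b xi, recursion Q x b xi ->
  forall B D, l1norm (x 0%N) <= B -> (forall N, l1norm (vsum l k xi N) <= B) ->
  (forall N, l1norm ((scale l k N)^-1 *: b N) <= B) ->
  (forall N, `|((scale l k N)^-1 *: x N *m z) 0 0| <= D) ->
  forall N, l1norm ((scale l k N)^-1 *: x N) <= C * (B + D).
Proof.
have [nu [nuS Qnu [E E0 hE]]] := leading_contractive Q0 irr l0 z0 piE zE piz.
have [C C0 hC] := contractive_le k l0 nuS Qnu.
exists (E * C + l1norm pi) => [|x b xi rec B D hx hS hb hD N].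
  by rewrite addr_ge0 ?mulr_ge0 ?l1norm_ge0.
have B0 : 0 <= B by apply: le_trans hx; exact: l1norm_ge0.
have D0 : 0 <= D by apply: le_trans (hD 0%N).
rewrite [_ *: x N]split (le_trans (l1normD _ _))// l1normZ.
have h1 := le_trans (hE ((scale l k N)^-1 *: x N)) (ler_wpM2l E0 (hC _ _ _ rec _ hx hS hb N)).
have h2 := ler_wpM2r (l1norm_ge0 pi) (hD N).
apply: (le_trans (lerD h1 h2)).
have : 0 <= E * C * D + B * l1norm pi.
  by rewrite addr_ge0 ?mulr_ge0 ?l1norm_ge0.
by rewrite mulrDl !mulrDr; lra.
Qed.

(** On the scale of a leading block the drift tends to 0, so the seminorm of the normalized block
    tends to 0 and only a multiple of pi survives. *)
Lemma leading_split_cvg k x b xi : recursion Q x b xi ->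
  forall S, vcvg (vsum l k xi) S ->
  vcvg (fun N => (scale l k N)^-1 *: b N) 0 ->
  forall v : R, (fun N => ((scale l k N)^-1 *: x N *m z) 0 0) @ \oo --> v ->
  vcvg (fun N => (scale l k N)^-1 *: x N) (v *: pi).
Proof.
move=> rec S hS hb v hv.
have [nu [nuS Qnu [E E0 hE]]] := leading_contractive Q0 irr l0 z0 piE zE piz.
have h := contractive_cvg l0 nuS Qnu rec hS hb (ys := 0).
rewrite (_ : (fun N => _) = fun N =>
   ((scale l k N)^-1 *: x N - ((scale l k N)^-1 *: x N *m z) *m pi) +
   ((scale l k N)^-1 *: x N *m z) 0 0 *: pi); last first.
  by apply/funext => N; exact: split.
rewrite -[X in vcvg _ X]add0r; apply: vcvgD; last first.
  by apply: vcvgZ => //; exact: vcvg_cst.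
apply/vcvgP.
apply: (@squeeze_cvgr _ _ _ _ (fun=> 0) (fun N => E * nu ((scale l k N)^-1 *: x N))).
- by apply: nearW => N; rewrite l1norm_ge0 subr0 hE.
- exact: cvg_cst.
- rewrite -(mulr0 E); apply: cvgMl_tmp.
  under eq_fun do rewrite -[X in nu X]subr0; apply: h.
  by rewrite mul0mx scaler0 !addr0 subr0 -(scale0r 0) (seminormZ nuS) normr0 mul0r.
Qed.

End LeadingBlock.

(** * Clusters *)

Section Clusters.
Variables (R : realType) (K J : nat) (mu : 'I_K.+1 -> R) (i : 'I_J.+1 -> 'I_K.+1).
Hypothesis i_maxima : running_maxima mu i.
Implicit Types (j : 'I_J.+1) (k m : 'I_K.+1).

Let lambda j := mu (i j).
Let kappa := cluster_order lambda.

Definition in_cluster j k := (i j <= k < cluster_end i j)%N.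

Let i0 : i ord0 = ord0. Proof. by case: i_maxima. Qed.
Let i_lt j j' : (j < j')%N -> (i j < i j')%N. Proof. by case: i_maxima => _ + _ _; exact. Qed.
Let i_le j j' : (j <= j')%N -> (i j <= i j')%N.
Proof.
rewrite leq_eqVlt => /orP[/eqP/val_inj -> //|/i_lt/ltnW//].
Qed.

Lemma lambda_le j j' : (j <= j')%N -> lambda j <= lambda j'.
Proof. by case: i_maxima => _ _ + _; exact. Qed.

Lemma cluster_endP j j' : (j < j')%N -> (cluster_end i j <= i j')%N.
Proof.
move=> jj; have jJ : (j < J)%N by apply: leq_trans jj _; rewrite -ltnS.
by rewrite /cluster_end jJ; apply: i_le; rewrite inordK// ltnS.
Qed.

Lemma in_cluster_leader j : in_cluster j (i j).
Proof.
rewrite /in_cluster leqnn/= /cluster_end; case: ifPn => jJ; last exact: ltn_ord.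
by apply: i_lt; rewrite inordK.
Qed.

Lemma in_cluster_exists k : exists j, in_cluster j k.
Proof.
pose p n := (n < J.+1)%N && (i (inord n) <= k)%N.
have ex : exists n, p n.
  exists 0%N; rewrite /p/= (_ : inord 0 = ord0) ?i0//.
  by apply: val_inj; rewrite /= inordK.
have ub n : p n -> (n <= J)%N by case/andP.
case: (ex_maxnP ex ub) => n /andP[nJ nk] hmax.
exists (inord n); rewrite /in_cluster nk/= /cluster_end inordK//.
case: ifPn => [nJ'|_]; last exact: ltn_ord.
rewrite ltnNge; apply/negP => h.
by have := hmax n.+1; rewrite /p ltnS nJ' h => /(_ isT); rewrite ltnn.
Qed.

Lemma in_cluster_mono j j' m k : in_cluster j' m -> in_cluster j k ->
  (m <= k)%N -> (j' <= j)%N.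
Proof.
move=> /andP[a b] /andP[c e] mk; rewrite leqNgt; apply/negP => /cluster_endP h.
have := leq_trans e (leq_trans h (leq_trans a mk)); by rewrite ltnn.
Qed.

Lemma in_cluster_uniq j j' k : in_cluster j k -> in_cluster j' k -> j = j'.
Proof.
move=> h h'; apply: val_inj; apply/eqP; rewrite eqn_leq.
by rewrite (in_cluster_mono h h')// (in_cluster_mono h' h).
Qed.

Lemma in_cluster_before j j' m : in_cluster j' m -> (m < i j)%N -> (j' < j)%N.
Proof.
move=> h mi; rewrite ltn_neqAle (in_cluster_mono h (in_cluster_leader j) (ltnW mi)) andbT.
apply/eqP => /val_inj e; move: mi; rewrite -e ltnNge.
by case/andP: h => ->.
Qed.

Lemma kappa_lt j j' : (j' < j)%N -> lambda j' = lambda j -> (kappa j' < kappa j)%N.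
Proof.
move=> jj e; apply: proper_card; apply/properP; split.
  apply/fintype.subsetP => h; rewrite !inE => /andP[hj /eqP ->].
  by rewrite (ltn_trans hj jj) e eqxx.
by exists j'; rewrite !inE ?ltnn// jj e eqxx.
Qed.

Lemma lambda_lt j j' : (j' < j)%N -> kappa j = 0%N -> lambda j' < lambda j.
Proof.
move=> jj k0; rewrite lt_neqAle lambda_le ?(ltnW jj)// andbT; apply/eqP => e.
by have := kappa_lt jj e; rewrite k0.
Qed.

Lemma previousE j : (0 < j)%N -> previous j = j.-1 :> nat.
Proof. by move=> j0; rewrite /previous inordK// (leq_ltn_trans (leq_pred _))//. Qed.

(** The leading characters are nondecreasing, so an earlier cluster with the same character forces
    the cluster just before to share it. *)
Lemma kappa_gt0 j : (0 < kappa j)%N ->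
  [/\ (0 < j)%N, lambda (previous j) = lambda j & kappa j = (kappa (previous j)).+1].
Proof.
move=> /card_gt0P[j']; rewrite inE => /andP[jj /eqP e].
have j0 : (0 < j)%N by apply: leq_ltn_trans jj.
have pE := previousE j0.
have le1 : (j' <= previous j)%N by rewrite pE -ltnS prednK.
have pj : (previous j < j)%N by rewrite pE prednK.
have lE : lambda (previous j) = lambda j.
  by apply/le_anti; rewrite lambda_le ?(ltnW pj)//= -e lambda_le.
split=> //.
rewrite /kappa /cluster_order.
have -> : [set j'0 : 'I_J.+1 | (j'0 < j)%N && (lambda j'0 == lambda j)]%SET =
   (previous j |: [set j'0 : 'I_J.+1 | (j'0 < previous j)%N && (lambda j'0 == lambda (previous j))])%SET.
  apply/setP => h; rewrite !inE lE; apply/andP/orP.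
    move=> [hj /eqP he].
    have : (h <= previous j)%N by rewrite pE -ltnS prednK.
    rewrite leq_eqVlt => /orP[/eqP/val_inj ->|->]; first by left.
    by right; rewrite he eqxx.
  move=> [/eqP ->|/andP[hp ->]]; first by rewrite pj lE.
  by rewrite (ltn_trans hp pj).
by rewrite cardsU1 inE ltnn.
Qed.

(** This is the hypothesis of [scale_ratio_cvg0]: earlier clusters are negligible against later
    ones. *)
Lemma order_lt j j' : (j' < j)%N ->
  (lambda j' < lambda j) || ((lambda j' == lambda j) && (kappa j' < kappa j)%N).
Proof.
move=> jj; have := lambda_le (ltnW jj); rewrite le_eqVlt => /orP[/eqP e|->//].
by rewrite e eqxx kappa_lt// orbT.
Qed.

Definition clus k : 'I_J.+1 := sval (cid (in_cluster_exists k)).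

Lemma clusP k : in_cluster (clus k) k.
Proof. exact: svalP (cid (in_cluster_exists k)). Qed.

Lemma clus_eq j k : in_cluster j k -> clus k = j.
Proof. exact: in_cluster_uniq (clusP k). Qed.

Lemma clus_leader j : clus (i j) = j.
Proof. exact/clus_eq/in_cluster_leader. Qed.

Lemma clus_mono m k : (m <= k)%N -> (clus m <= clus k)%N.
Proof. exact: in_cluster_mono (clusP m) (clusP k). Qed.

Lemma clus_before m j : (m < i j)%N -> (clus m < j)%N.
Proof. exact: in_cluster_before (clusP m). Qed.

Lemma clus_nonleader k : k != i (clus k) -> (i (clus k) < k < cluster_end i (clus k))%N.
Proof.
move=> h; have /andP[a b] := clusP k; rewrite b andbT ltn_neqAle a andbT.
by apply: contra h => /eqP/val_inj ->.
Qed.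

Lemma mu_nonleader k : k != i (clus k) -> mu k < lambda (clus k).
Proof. by move=> /clus_nonleader h; case: i_maxima => _ _ _; apply. Qed.

Lemma in_clusterE j k : in_cluster j k = (clus k == j).
Proof. by apply/idP/eqP => [/clus_eq//|<-]; exact: clusP. Qed.

Lemma leader_le k : (i (clus k) <= k)%N.
Proof. by case/andP: (clusP k). Qed.

End Clusters.

(** * Recursion of all the blocks *)

Lemma scale_ratio_bounded (R : realType) (l' : R) k' (l : R) k : 0 <= l' -> l <= 1 ->
  [|| l' < l, (l' == l) && (k' < k)%N | (l' == l) && (k' == k)] ->
  exists2 C, 0 <= C & forall N, scale l' k' N <= C * scale l k N.
Proof.
move=> l'0 l1; rewrite orbA => /orP[H|/andP[/eqP -> /eqP ->]]; last first.
  by exists 1 => // N; rewrite mul1r.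
have l0 : 0 <= l by case/orP: H => [/ltW|/andP[/eqP <- _]//]; exact: le_trans.
have /cvgP/cvg_has_ub[B hB] := scale_ratio_cvg0 l'0 l1 H.
exists B => [|N].
  by apply: le_trans (normr_ge0 _) (hB _ _); exists 0%N.
rewrite -ler_pdivrMr ?scale_gt0// (le_trans (ler_norm _))//.
by apply: hB; exists N.
Qed.

Lemma delta_component (R : realType) n (v : 'rV[R]_n) c :
  (v *m (delta_mx c 0 : 'cV[R]_n)) 0 0 = v 0 c.
Proof.
rewrite mxE (bigD1 c)//= mxE !eqxx mulr1 big1 ?addr0// => k kc.
by rewrite mxE (negbTE kc) mulr0.
Qed.

Section BlockRecursion.
Variables (R : realType) (K J : nat) (d : 'I_K.+1 -> nat).
Variable M : 'M[R]_(\sum_k d k).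
Hypothesis M_ge0 : forall a b, 0 <= M a b.
Hypothesis M_triangular : block_upper_triangular M.
Variable mu : 'I_K.+1 -> R.
Hypothesis mu_character : forall k, is_character (submxblock M k k) (mu k).
Hypothesis mu_le1 : forall k, mu k <= 1.
Variable i : 'I_J.+1 -> 'I_K.+1.
Hypothesis i_maxima : running_maxima mu i.
Variables (pi : forall k, 'rV[R]_(d k)) (zeta : forall k, 'cV[R]_(d k)).
Hypothesis pi_zeta : forall k, irreducible_mx (submxblock M k k) ->
  normalized_eigenvectors (submxblock M k k) (mu k) (pi k) (zeta k).

Implicit Types (m k : 'I_K.+1).
Local Notation Q := (submxblock M).
Local Notation g := (step R).
Local Notation clus := (clus i_maxima).
Local Notation lambda := (fun j => mu (i j)).

Definition block_exponent k : R := mu (i (clus k)).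
Definition block_order k : nat := cluster_order lambda (clus k).
Local Notation lam := block_exponent.
Local Notation kap := block_order.
Definition block_scale k N : R := scale (lam k) (kap k) N.
Local Notation a := block_scale.

Definition block_recursion (X xi : forall k, nat -> 'rV[R]_(d k)) :=
  forall k, recursion (Q k k) (X k)
    (fun N => \sum_(m < K.+1 | (m < k)%N) X m N *m Q m k) (xi k).

Lemma block_ge0 m k : nneg_mx (Q m k).
Proof. by move=> a b; rewrite !mxE. Qed.

Lemma block_perron k : irreducible_mx (Q k k) ->
  [/\ 0 < mu k, pos_mx (pi k) & pos_mx (zeta k)].
Proof.
move=> irr; have PF := (mu_character k).1 irr; have v := pi_zeta irr.
have Q0 := @block_ge0 k k.
split; [exact: perron_value_gt0 Q0 irr PF v|exact: perron_pi_gt0 Q0 irr PF v|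
        exact: perron_zeta_gt0 Q0 irr PF v].
Qed.

Lemma mu_ge0 k : 0 <= mu k.
Proof.
have [_ /(_ k)[/block_perron[/ltW//]|/(mu_character k).2 ->//]] := M_triangular.
Qed.

(** A zero block has no normalized Perron vector at hand, but every positive vector is an
    eigenvector for its character 0. *)
Lemma block_weight k : exists2 z : 'cV_(d k), pos_mx z & Q k k *m z = mu k *: z.
Proof.
have [_ /(_ k)[irr|Qk]] := M_triangular.
  have [_ _ z0] := block_perron irr; exists (zeta k) => //.
  by case: (pi_zeta irr).
exists (const_mx 1); first by move=> a b; rewrite mxE.
by rewrite Qk mul0mx ((mu_character k).2 Qk) scale0r.
Qed.

Lemma lam_ge0 k : 0 <= lam k. Proof. exact: mu_ge0. Qed.
Lemma lam_le1 k : lam k <= 1. Proof. exact: mu_le1. Qed.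
Lemma a_gt0 k N : 0 < a k N. Proof. exact: scale_gt0 (lam_ge0 k). Qed.

Lemma leader_irreducible k : k = i (clus k) -> 0 < lam k -> irreducible_mx (Q k k).
Proof.
move=> ki l0; have [_ /(_ k)[//|/(mu_character k).2 m0]] := M_triangular.
by move: l0; rewrite /lam -ki m0 ltxx.
Qed.

Lemma leader_zero k : k = i (clus k) -> lam k = 0 -> Q k k = 0.
Proof.
move=> ki l0; have [_ /(_ k)[/block_perron[]|//]] := M_triangular.
by move: l0; rewrite /block_exponent -ki => ->; rewrite ltxx.
Qed.

Lemma before_order m k : (m < k)%N -> k = i (clus k) ->
  (lam m < lam k) || ((lam m == lam k) && (kap m < kap k)%N).
Proof.
move=> mk ki; apply: (order_lt i_maxima); apply: clus_before.
by rewrite -ki.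
Qed.

Lemma before_order0 m k : (m < k)%N -> k = i (clus k) -> kap k = 0%N ->
  lam m < lam k.
Proof.
move=> mk ki k0; apply: (lambda_lt i_maxima) => //; apply: clus_before.
by rewrite -ki.
Qed.

(** Into a leading block of order q + 1 the drift is thus one logarithm smaller than the block
    itself. *)
Lemma before_orderS m k q : (m < k)%N -> k = i (clus k) -> kap k = q.+1 ->
  [|| lam m < lam k, (lam m == lam k) && (kap m < q)%N
    | (lam m == lam k) && (kap m == q)].
Proof.
move=> mk ki kq; have := before_order mk ki.
by rewrite kq ltnS leq_eqVlt => /orP[->//|/andP[->/= /orP[->|->]]]; rewrite !orbT.
Qed.

Lemma before_orderW m k : (m < k)%N ->
  [|| lam m < lam k, (lam m == lam k) && (kap m < kap k)%N
    | (lam m == lam k) && (kap m == kap k)].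
Proof.
move=> mk; have := clus_mono i_maxima (ltnW mk); rewrite leq_eqVlt => /orP[/eqP/val_inj e|h].
  by rewrite /lam /kap e !eqxx !orbT.
by have := order_lt i_maxima h => /orP[->//|->]; rewrite orbT.
Qed.

(** A later cluster of order 0 has a character strictly above that of the first cluster, which is at
    least 0. *)
Lemma first_block k : k = i (clus k) -> lam k = 0 -> kap k = 0%N -> k = ord0.
Proof.
move=> ki l0 k0; have [h|h] := posnP (clus k).
  rewrite ki (_ : clus k = ord0); last exact: val_inj.
  by case: i_maxima.
have := lambda_lt i_maxima (j' := ord0) h k0.
by rewrite -/(lam k) l0 ltNge mu_ge0.
Qed.

Definition absnorm (p q : nat) (A : 'M[R]_(p, q)) := \sum_i \sum_j `|A i j|.

Lemma absnorm_ge0 (p q : nat) (A : 'M[R]_(p, q)) : 0 <= absnorm A.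
Proof. by apply: sumr_ge0 => ? _; apply: sumr_ge0. Qed.

Section Drift.
Variables (k : 'I_K.+1) (C : 'I_K.+1 -> R).
Hypothesis C0 : forall m, 0 <= C m.
Variables (X : forall k, nat -> 'rV[R]_(d k)) (B : R).
Hypothesis B0 : 0 <= B.
Hypothesis XC : forall m, (m < k)%N -> forall N,
  l1norm ((a m N)^-1 *: X m N) <= C m * B.
Let b N := \sum_(m < K.+1 | (m < k)%N) X m N *m Q m k.

Lemma drift_le N :
  l1norm (b N) <= \sum_(m < K.+1 | (m < k)%N) a m N * (absnorm (Q m k) * C m * B).
Proof.
rewrite /b; elim/big_rec2: _ => [|m y v mk IH].
  by rewrite -(scale0r 0) l1normZ normr0 mul0r.
rewrite (le_trans (l1normD _ _))// lerD//.
have h : l1norm (X m N) <= a m N * (C m * B).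
  have := XC mk N; rewrite l1normZ ger0_norm ?invr_ge0 ?(ltW (a_gt0 _ _))//.
  by rewrite ler_pdivrMl ?a_gt0.
apply: (le_trans (l1norm_mulmx _ _)); rewrite -/(absnorm _).
have -> : a m N * (absnorm (Q m k) * C m * B) =
  absnorm (Q m k) * (a m N * (C m * B)) by ring.
by rewrite ler_wpM2l ?absnorm_ge0.
Qed.

End Drift.

Lemma drift_scaled_bounded k (C : 'I_K.+1 -> R) (l : R) q : 0 <= l -> l <= 1 ->
  (forall m, 0 <= C m) ->
  (forall m, (m < k)%N -> [|| lam m < l, (lam m == l) && (kap m < q)%N
    | (lam m == l) && (kap m == q)]) ->
  exists2 D, 0 <= D & forall (X : forall k, nat -> 'rV[R]_(d k)) B, 0 <= B ->
   (forall m, (m < k)%N -> forall N, l1norm ((a m N)^-1 *: X m N) <= C m * B) ->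
   forall N, l1norm ((scale l q N)^-1 *:
     \sum_(m < K.+1 | (m < k)%N) X m N *m Q m k) <= D * B.
Proof.
move=> l0 l1 C0 H.
have ex m : exists H, 0 <= H /\ ((m < k)%N -> forall N, a m N <= H * scale l q N).
  have [mk|_] := boolP (m < k)%N; last by exists 0.
  by have [E E0 hE] := scale_ratio_bounded (lam_ge0 m) l1 (H m mk); exists E.
have [E hE] := fin_all_exists ex.
exists (\sum_(m < K.+1 | (m < k)%N) E m * (absnorm (Q m k) * C m)).
  apply: sumr_ge0 => m _; rewrite mulr_ge0//; first by case: (hE m).
  by rewrite mulr_ge0 ?absnorm_ge0.
move=> X B B0 XC N.
have s0 := scale_gt0 q N l0.
rewrite l1normZ ger0_norm ?invr_ge0 ?(ltW s0)// mulrC ler_pdivrMr//.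
apply: (le_trans (drift_le XC N)).
rewrite !mulr_suml; apply: ler_sum => m mk.
have [_ /(_ mk N) h] := hE m.
have -> : E m * (absnorm (Q m k) * C m) * B * scale l q N =
  E m * scale l q N * (absnorm (Q m k) * C m * B) by ring.
by rewrite ler_wpM2r// !mulr_ge0 ?absnorm_ge0.
Qed.

Lemma drift_summable k (C : 'I_K.+1 -> R) (l : R) : l <= 1 ->
  (forall m, 0 <= C m) -> (forall m, (m < k)%N -> lam m < l) ->
  exists2 D, 0 <= D & forall (X : forall k, nat -> 'rV[R]_(d k)) B, 0 <= B ->
   (forall m, (m < k)%N -> forall N, l1norm ((a m N)^-1 *: X m N) <= C m * B) ->
   forall N, \sum_(n < N) g n * l1norm ((scale l 0 n)^-1 *:
     \sum_(m < K.+1 | (m < k)%N) X m n *m Q m k) <= D * B.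
Proof.
move=> l1 C0 H.
have ex m : exists H, 0 <= H /\ ((m < k)%N -> forall N,
    \sum_(n < N) g n * (a m n / scale l 0 n) <= H).
  have [mk|_] := boolP (m < k)%N; last by exists 0.
  have [E E0 hE] := growth_series_bounded (kap m) (lam_ge0 m) (H m mk) l1.
  exists E; split=> // _ N; apply: le_trans (hE N).
  by apply: ler_sum => n _; rewrite /a /scale expr0 mulr1.
have [E hE] := fin_all_exists ex.
exists (\sum_(m < K.+1 | (m < k)%N) E m * (absnorm (Q m k) * C m)).
  apply: sumr_ge0 => m _; rewrite mulr_ge0//; first by case: (hE m).
  by rewrite mulr_ge0 ?absnorm_ge0.
move=> X B B0 XC N.
have [m0 m0k|none] := pickP (fun m : 'I_K.+1 => (m < k)%N); last first.
  rewrite big1 ?mulr_ge0 ?sumr_ge0//.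
    by move=> m; rewrite none.
  move=> n _; rewrite big_pred0; last exact: none.
  by rewrite scaler0 -(scale0r 0) l1normZ normr0 mul0r mulr0.
have l0 : 0 <= l by apply: le_trans (lam_ge0 m0) (ltW (H _ m0k)).
apply: (@le_trans _ _ (\sum_(n < N) \sum_(m < K.+1 | (m < k)%N)
   g n * (a m n / scale l 0 n) * (absnorm (Q m k) * C m * B))).
  apply: ler_sum => n _; have s0 := scale_gt0 0 n l0.
  rewrite l1normZ ger0_norm ?invr_ge0 ?(ltW s0)//.
  have := ler_wpM2l (mulr_ge0 (step_ge0 R n) (ltW (_ : 0 < (scale l 0 n)^-1))) (drift_le XC n).
  rewrite invr_gt0 => /(_ s0) h; rewrite mulrA (le_trans h)// mulr_sumr.
  by apply: ler_sum => m _; rewrite le_eqVlt; apply/orP; left; apply/eqP; ring.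
rewrite exchange_big/= mulr_suml; apply: ler_sum => m mk.
rewrite -mulr_suml -!mulrA mulrA ler_wpM2r ?mulr_ge0 ?absnorm_ge0//.
by have [_ /(_ mk N)] := hE m.
Qed.

Definition admissible (X xi : forall k, nat -> 'rV[R]_(d k)) (B : R) :=
  [/\ block_recursion X xi, forall k, l1norm (X k 0%N) <= B &
      forall k N, l1norm (vsum (lam k) (kap k) (xi k) N) <= B].

(** Strong induction over the blocks, the earlier ones bounding the drift. For a leading block,
    [comp] first bounds its components along right eigenvectors. *)
Theorem block_bounded k : exists2 C, 0 <= C & forall X xi B,
  admissible X xi B -> forall N, l1norm ((a k N)^-1 *: X k N) <= C * B.
Proof.
have [n] := ubnP (k : nat); elim: n k => // n IH k; rewrite ltnS => kn.
have ex m : exists C, 0 <= C /\ ((m < k)%N -> forall X xi B,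
  admissible X xi B -> forall N, l1norm ((a m N)^-1 *: X m N) <= C * B).
  have [mk|_] := boolP (m < k)%N; last by exists 0.
  by have [C C0 hC] := IH m (leq_trans mk kn); exists C.
have [C hC] := fin_all_exists ex.
have C0 m : 0 <= C m by case: (hC m).
have XC X xi B : admissible X xi B -> forall m, (m < k)%N -> forall N,
    l1norm ((a m N)^-1 *: X m N) <= C m * B.
  by move=> ad m mk N; have [_ /(_ mk)] := hC m; apply; exact: ad.
have B0 X xi B : admissible X xi B -> 0 <= B.
  by move=> [_ /(_ ord0) h _]; apply: le_trans h; exact: l1norm_ge0.
have [D D0 hD] := drift_scaled_bounded (lam_ge0 k) (lam_le1 k) C0
  (fun m mk => before_orderW mk).
have [ki|ki] := eqVneq k (i (clus k)); last first.
  have [z z0 zE] := block_weight k.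
  have mul : 0 <= mu k < lam k by rewrite mu_ge0; exact: mu_nonleader ki.
  have [E E0 hE] := nonleading_le (kap k) (@block_ge0 k k) z0 zE mul.
  exists (E * (1 + D)) => [|X xi B ad N]; first by rewrite mulr_ge0 ?addr_ge0.
  have [rec hx hS] := ad; have Bp := B0 _ _ _ ad.
  have h1 : B <= (1 + D) * B by rewrite mulrDl mul1r lerDl mulr_ge0.
  rewrite -[leRHS]mulrA; apply: (hE _ _ _ (rec k)) => [|m|m].
  - exact: le_trans (hx k) h1.
  - exact: le_trans (hS k m) h1.
  - apply: (le_trans (hD _ _ Bp (XC _ _ _ ad) m)).
    by rewrite mulrDl lerDr mul1r.
have comp (u : 'cV_(d k)) : Q k k *m u = lam k *: u ->
    exists G, 0 <= G /\ forall X xi B, admissible X xi B ->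
      forall N, `|((a k N)^-1 *: X k N *m u) 0 0| <= G * B.
  move=> uE; pose U := \sum_c `|u c 0|.
  have U0 : 0 <= U by apply: sumr_ge0.
  have [k0|[q kq]] : kap k = 0%N \/ exists q, kap k = q.+1.
    by case: (kap k) => [|q]; [left|right; exists q].
  - have [E E0 hE] := drift_summable (lam_le1 k) C0
      (fun m mk => before_order0 mk ki k0).
    exists (3 * U * (1 + E)); split=> [|X xi B ad N].
      by rewrite !mulr_ge0 ?addr_ge0.
    have [rec hx hS] := ad; have Bp := B0 _ _ _ ad.
    have h1 : B <= (1 + E) * B by rewrite mulrDl mul1r lerDl mulr_ge0.
    rewrite -[leRHS]mulrA /a k0; apply: (component0_le (lam_ge0 k) uE (rec k)) => [|m|m].
    + exact: le_trans (hx k) h1.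
    + by rewrite -k0; exact: le_trans (hS k m) h1.
    + apply: (le_trans (hE _ _ Bp (XC _ _ _ ad) m)).
      by rewrite mulrDl lerDr mul1r.
  - have [E E0 hE] := drift_scaled_bounded (lam_ge0 k) (lam_le1 k) C0
      (fun m mk => before_orderS mk ki kq).
    exists ((q.+1%:R + 2) * U * (1 + E)); split=> [|X xi B ad N].
      by rewrite !mulr_ge0 ?addr_ge0.
    have [rec hx hS] := ad; have Bp := B0 _ _ _ ad.
    have h1 : B <= (1 + E) * B by rewrite mulrDl mul1r lerDl mulr_ge0.
    rewrite -[leRHS]mulrA /a kq; apply: (componentS_le (lam_ge0 k) uE (rec k)) => [|m|m].
    + exact: le_trans (hx k) h1.
    + by rewrite -kq; exact: le_trans (hS k m) h1.
    + apply: (le_trans (hE _ _ Bp (XC _ _ _ ad) m)).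
      by rewrite mulrDl lerDr mul1r.
(* In a zero leading block the coordinates are bounded one by one, as components along the standard
   basis. *)
have [l0|l0] := eqVneq (lam k) 0.
  have cc c : exists G, 0 <= G /\ forall X xi B, admissible X xi B ->
      forall N, `|((a k N)^-1 *: X k N) 0 c| <= G * B.
    have [|G [G0 hG]] := comp (delta_mx c 0).
      by rewrite (leader_zero ki l0) mul0mx l0 scale0r.
    exists G; split=> // X xi B ad N; rewrite -delta_component.
    exact: hG ad N.
  have [G hG] := fin_all_exists cc.
  exists (\sum_c G c) => [|X xi B ad N].
    by apply: sumr_ge0 => c _; case: (hG c).
  by rewrite mulr_suml; apply: ler_sum => c _; have [_] := hG c; apply; exact: ad.
have {}l0 : 0 < lam k by rewrite lt_neqAle eq_sym l0 lam_ge0.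
have irr := leader_irreducible ki l0.
have lk : lam k = mu k by rewrite /lam -ki.
have [_ _ z0] := block_perron irr; have [e1 e2 e3 e4] := pi_zeta irr.
rewrite -lk in e1 e2.
have [F F0 hF] := leading_split_le (@block_ge0 k k) irr l0 z0 e1 e2 e4 (kap k).
have [G [G0 hG]] := comp _ e2.
exists (F * (1 + D + G)) => [|X xi B ad N].
  by rewrite mulr_ge0 ?addr_ge0.
have [rec hx hS] := ad; have Bp := B0 _ _ _ ad.
have h1 : B <= (1 + D) * B by rewrite mulrDl mul1r lerDl mulr_ge0.
rewrite -[leRHS]mulrA mulrDl; apply: (hF _ _ _ (rec k)) => [|m|m|m].
- exact: le_trans (hx k) h1.
- exact: le_trans (hS k m) h1.
- apply: (le_trans (hD _ _ Bp (XC _ _ _ ad) m)).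
  by rewrite mulrDl lerDr mul1r.
- exact: hG ad m.
Qed.

Section Convergence.
Variable W : forall (j : 'I_J.+1) (k : 'I_K.+1), 'M[R]_(d (i j), d k).
Hypothesis W_def : is_cluster_W M mu W.
Hypothesis i_last : i ord_max = ord_max.
Variables (X xi : forall k, nat -> 'rV[R]_(d k)).
Hypothesis rec : block_recursion X xi.
Variable S : forall k, 'rV[R]_(d k).
Hypothesis noise : forall k, vcvg (vsum (lam k) (kap k) (xi k)) (S k).
Hypothesis noise0 : mu ord0 = 0 -> forall N, xi ord0 N = 0.
Implicit Types j : 'I_J.+1.

Definition block_normalized k N : 'rV[R]_(d k) := (a k N)^-1 *: X k N.
Local Notation y := block_normalized.

(** The entries of pi add up to 1, so the sum of the entries recovers the coefficient of pi. *)
Definition block_weight_limit j : R := limn (fun N => \sum_c y (i j) N 0 c).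
Local Notation v := block_weight_limit.

Definition block_limit j k : 'rV[R]_(d k) :=
  if mu (i j) == 0 then (cluster_order lambda j)`!%:R^-1 *:
    (X ord0 0%N *m superdiagonal_prod M (nb_factors i j) k)
  else v j *: (pi (i j) *m W j k).

Lemma drift_cvg k (l : R) q (L : forall m, 'rV[R]_(d m)) : 0 <= l -> l <= 1 ->
  (forall m, (m < k)%N -> [|| lam m < l, (lam m == l) && (kap m < q)%N
    | (lam m == l) && (kap m == q)]) ->
  (forall m, (m < k)%N -> lam m = l -> kap m = q -> vcvg (y m) (L m)) ->
  (forall m, (m < k)%N -> exists V, vcvg (y m) V) ->
  vcvg (fun N => (scale l q N)^-1 *:
      \sum_(m < K.+1 | (m < k)%N) X m N *m Q m k)
    (\sum_(m < K.+1 | (m < k)%N && ((lam m == l) && (kap m == q))) L m *m Q m k).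
Proof.
move=> l0 l1 H hL hV; rewrite big_mkcondr/=.
rewrite (_ : (fun _ => _) = fun N => \sum_(m < K.+1 | (m < k)%N)
   ((scale l q N)^-1 *: X m N) *m Q m k); last first.
  by apply/funext => N; rewrite scaler_sumr; apply: eq_bigr => m _; rewrite scalemxAl.
apply: vcvg_sum => m mk.
have yE N : (scale l q N)^-1 *: X m N = (a m N / scale l q N) *: y m N.
  rewrite /y scalerA mulrAC mulfV ?mul1r// gt_eqF//; exact: a_gt0.
under eq_fun do rewrite yE.
case: ifPn => [/andP[/eqP e1 /eqP e2]|ne].
  apply: vcvgM; rewrite -[L m]scale1r; apply: vcvgZ; last exact: hL.
  apply: cvg_near_cst; apply: nearW => N.
  by rewrite /a e1 e2 divff// gt_eqF// scale_gt0.
have [V hVm] := hV m mk.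
rewrite -(mul0mx _ (Q m k)) -(scale0r V).
apply: vcvgM; apply: vcvgZ => //.
apply: scale_ratio_cvg0 => //; first exact: lam_ge0.
by have := H m mk; rewrite (negbTE ne) orbF.
Qed.

Lemma same_clusterE m k : (m <= k)%N ->
  ((lam m == lam k) && (kap m == kap k)) = (clus m == clus k).
Proof.
move=> mk; apply/idP/eqP => [/andP[/eqP e1 /eqP e2]|e]; last first.
  by rewrite /lam /kap e !eqxx.
have := clus_mono i_maxima mk; rewrite leq_eqVlt => /orP[/eqP/val_inj//|h].
by have := @kappa_lt _ _ _ mu i _ _ h e1; rewrite -/(kap m) e2 ltnn.
Qed.

Lemma previous_lt j : (0 < j)%N -> (previous j < j)%N.
Proof. by move=> j0; rewrite previousE// prednK. Qed.

Lemma previous_succ j : (0 < j)%N -> inord (previous j).+1 = j.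
Proof. by move=> j0; apply: val_inj; rewrite /= previousE// prednK// inord_val. Qed.

(** A nonleading block of this cluster would have a negative character. *)
Lemma zero_cluster j k : mu (i j) = 0 -> in_cluster i j k -> k = i j.
Proof.
move=> m0 jk; apply/eqP; apply: contraT => ki.
have e := clus_eq i_maxima jk.
have := @mu_nonleader _ _ _ mu i i_maxima k; rewrite e => /(_ ki).
by rewrite m0 ltNge mu_ge0.
Qed.

Lemma zero_cluster_end j : (j < J)%N -> mu (i j) = 0 -> cluster_end i j = (i j).+1.
Proof.
move=> jJ m0.
have /andP[_ h1] := in_cluster_leader i_maxima j.
apply/eqP; rewrite eqn_leq h1 andbT leqNgt; apply/negP => h2.
have h3 : ((i j).+1 < K.+1)%N.
  apply: (leq_trans h2); rewrite /cluster_end jJ; exact/ltnW/ltn_ord.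
have : in_cluster i j (Ordinal h3) by rewrite /in_cluster /= leqnSn.
by move/(zero_cluster m0)/(congr1 val) => /= /eqP; rewrite gtn_eqF.
Qed.

(** The preceding cluster also has character 0 and is then a single block, so i_j = i_(j-1) + 1. *)
Lemma nb_factors_leader j : mu (i j) = 0 -> nb_factors i j = i j.
Proof.
move=> m0; rewrite /nb_factors; case: eqP => [->|/eqP jn0].
  by case: i_maxima => ->.
have j0 : (0 < j)%N by rewrite lt0n; apply: contra jn0 => /eqP e; apply/eqP/val_inj.
have pj := previous_lt j0.
have pJ : (previous j < J)%N by apply: leq_trans pj _; rewrite -ltnS.
have pm0 : mu (i (previous j)) = 0.
  apply/le_anti; rewrite mu_ge0 andbT -m0.
  by apply: (lambda_le i_maxima); exact: ltnW.
by rewrite -zero_cluster_end// /cluster_end pJ previous_succ.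
Qed.

Lemma lead_value j (c : R) : 0 < mu (i j) ->
  vcvg (y (i j)) (c *: pi (i j)) -> v j = c.
Proof.
move=> l0 h; apply/cvg_lim => //.
have irr : irreducible_mx (Q (i j) (i j)).
  by apply: leader_irreducible; rewrite /lam clus_leader.
have [_ _ e _] := pi_zeta irr.
have {}e : \sum_c pi (i j) 0 c = 1.
  by move/matrixP/(_ 0 0): e; rewrite rank1_mx11 mxE => <-; apply: eq_bigr => b _; rewrite mxE mulr1.
rewrite -[X in _ --> X]mulr1 -e mulr_sumr; apply: cvg_sumr => b _.
by have := h b; rewrite mxE.
Qed.

Lemma previous_in_cluster j m : (0 < cluster_order lambda j)%N ->
  (i (previous j) <= m < i j)%N -> in_cluster i (previous j) m.
Proof.
move=> /(kappa_gt0 i_maxima)[j0 _ _] pm; have pj := previous_lt j0.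
have pJ : (previous j < J)%N by apply: leq_trans pj _; rewrite -ltnS.
by rewrite /in_cluster /cluster_end pJ previous_succ.
Qed.

(** Distinct clusters have distinct scales, so the drift one logarithm below cluster j comes from
    the previous cluster alone. This is the range of the sum in [cluster_w]. *)
Lemma previous_clusterE j m q : cluster_order lambda j = q.+1 ->
  ((m < i j)%N && ((lam m == mu (i j)) && (kap m == q))) =
    (i (previous j) <= m < i j)%N.
Proof.
move=> kq; have kgt : (0 < cluster_order lambda j)%N by rewrite kq.
have [j0 lp kp] := kappa_gt0 i_maxima kgt.
have kpq : cluster_order lambda (previous j) = q by apply: succn_inj; rewrite -kp.
apply/idP/idP => [/and3P[mi /eqP h1 /eqP h2]|pm].
  rewrite mi andbT -(_ : clus m = previous j); first exact: leader_le.
  have : (clus m <= previous j)%N.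
    by rewrite previousE// -ltnS prednK//; exact: clus_before.
  rewrite leq_eqVlt => /orP[/eqP/val_inj//|cm].
  have := @kappa_lt _ _ _ mu i _ _ cm; rewrite lp kpq -/(kap m) h2 ltnn.
  by move=> /(_ h1).
have /(clus_eq i_maxima) cE := previous_in_cluster kgt pm.
by case/andP: pm => _ ->; rewrite /lam /kap cE lp kpq !eqxx.
Qed.

Section Leader.
Variable j : 'I_J.+1.
Hypothesis IH : forall m, (m < i j)%N -> forall j', in_cluster i j' m ->
  vcvg (y m) (block_limit j' m).

Let kj := cluster_order lambda j.
Let lamE : lam (i j) = mu (i j). Proof. by rewrite /lam clus_leader. Qed.
Let kapE : kap (i j) = kj. Proof. by rewrite /kap clus_leader. Qed.
Let leader : i j = i (clus (i j)). Proof. by rewrite clus_leader. Qed.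

Let IHV m : (m < i j)%N -> exists V, vcvg (y m) V.
Proof. by move=> mi; exists (block_limit (clus m) m); apply: IH => //; exact: clusP. Qed.

Let drift0 : vcvg (fun N => (scale (mu (i j)) kj N)^-1 *:
      \sum_(m < K.+1 | (m < i j)%N) X m N *m Q m (i j)) 0.
Proof.
rewrite [X in vcvg _ X](_ : 0 = \sum_(m < K.+1 | (m < i j)%N &&
    ((lam m == mu (i j)) && (kap m == kj))) (0 : 'rV[R]_(d m)) *m Q m (i j)); last first.
  by rewrite big1// => m _; rewrite mul0mx.
apply: (@drift_cvg (i j) (mu (i j)) kj (fun=> 0)) => //.
- exact: mu_ge0.
- by move=> m /before_orderW; rewrite lamE kapE.
move=> m mi e1 e2; have := before_order mi leader.
by rewrite lamE kapE e1 e2 ltxx eqxx ltnn.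
Qed.

(** In order 0 the component along zeta has some limit, not further identified; in order q + 1 its
    limit is the limiting drift along zeta divided by q + 1, that is, w_j times the previous
    weight. *)
Lemma leader_cvg : 0 < mu (i j) -> vcvg (y (i j)) (v j *: pi (i j)) /\
  ((0 < kj)%N -> v j = cluster_w M mu pi zeta W j * v (previous j)).
Proof.
move=> l0.
have irr : irreducible_mx (Q (i j) (i j)).
  by apply: leader_irreducible; rewrite ?lamE.
have [_ _ z0] := block_perron irr; have [e1 e2 e3 e4] := pi_zeta irr.
have noiseE : vcvg (vsum (mu (i j)) kj (xi (i j))) (S (i j)).
  by rewrite -lamE -kapE.
have finish (c : R) : (fun N => ((scale (mu (i j)) kj N)^-1 *: X (i j) N *m zeta (i j)) 0 0) @ \oo --> c ->
    vcvg (y (i j)) (c *: pi (i j)).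
  move=> hc.
  have := leading_split_cvg (@block_ge0 _ _) irr l0 z0 e1 e2 e4 (rec (i j)) noiseE drift0 hc.
  by rewrite /y /a lamE kapE.
have [k0|[q kq]] : kj = 0%N \/ exists q, kj = q.+1.
  by case: (kj) => [|q]; [left|right; exists q].
- rewrite k0; split=> //.
  (* The earlier blocks converge, hence are bounded along this solution, and [drift_summable]
     applies with B = 1. *)
  have exB m : exists C, 0 <= C /\ ((m < i j)%N -> forall N, l1norm (y m N) <= C).
    have [mi|_] := boolP (m < i j)%N; last by exists 0.
    have [V hV] := IHV mi; have [C C0 hC] := vcvg_bounded hV.
    by exists C.
  have [C hC] := fin_all_exists exB.
  have lt0 m : (m < i j)%N -> lam m < mu (i j).
    by rewrite -lamE => mi; apply: before_order0; rewrite ?kapE.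
  have [D D0 hD] := drift_summable (mu_le1 (i j)) (fun m => (hC m).1) lt0.
  have hyC m : (m < i j)%N -> forall N, l1norm (y m N) <= C m * 1.
    by move=> mi N; rewrite mulr1; have [_] := hC m; apply.
  have noise1 := noiseE; rewrite k0 in noise1.
  have := component0_cvg (ltW l0) e2 (rec (i j)) noise1 (hD X 1 ler01 hyC).
  move=> /cvg_ex[c hc]; have hy : vcvg (y (i j)) (c *: pi (i j)) by apply: finish; rewrite k0.
  by rewrite (lead_value l0 hy).
have kgt : (0 < kj)%N by rewrite kq.
have [_ lp kp] := kappa_gt0 i_maxima kgt.
have hb := @drift_cvg (i j) (mu (i j)) q
  (fun m => v (previous j) *: (pi (i (previous j)) *m W (previous j) m))
  (mu_ge0 _) (mu_le1 _).
have {hb} := hb _ _ IHV.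
rewrite (eq_bigl _ _ (fun m => previous_clusterE m kq)).
set bl := \sum_(m < K.+1 | _) _ => hb.
have hS := noiseE; rewrite kq in hS.
have hc := componentS_cvg (ltW l0) e2 (rec (i j)) hS (hb _ _).
have E : (bl *m zeta (i j)) 0 0 / q.+1%:R = cluster_w M mu pi zeta W j * v (previous j).
  rewrite /cluster_w gt_eqF//= -/kj kq/=.
  have -> : bl = v (previous j) *: (pi (i (previous j)) *m
     (\sum_(m < K.+1 | (i (previous j) <= m < i j)%N)
        W (previous j) m *m submxblock M m (i j))).
    rewrite /bl mulmx_sumr scaler_sumr; apply: eq_bigr => m _.
    by rewrite -scalemxAl mulmxA.
  by rewrite -scalemxAl mxE; ring.
have hy : vcvg (y (i j)) ((cluster_w M mu pi zeta W j * v (previous j)) *: pi (i j)).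
  rewrite -E; apply: finish; rewrite kq; apply: hc.
    by move=> m mi; rewrite -lamE; apply: before_orderS; rewrite ?kapE.
  move=> m mi h1 h2.
  have : (m < i j)%N && ((lam m == mu (i j)) && (kap m == q)) by rewrite mi h1 h2 !eqxx.
  rewrite (previous_clusterE m kq) => /(previous_in_cluster kgt) pm.
  by have := IH mi pm; rewrite /block_limit lp gt_eqF.
by rewrite (lead_value l0 hy).
Qed.

(** Each order multiplies by one superdiagonal block and divides by the order, whence kappa! and the
    product. The first block, when zero, receives neither drift nor noise and stays constant. *)
Lemma zero_leader_cvg : mu (i j) = 0 ->
  vcvg (y (i j)) (kj`!%:R^-1 *:
    (X ord0 0%N *m superdiagonal_prod M (nb_factors i j) (i j))).
Proof.
move=> l0.
have Q0 : Q (i j) (i j) = 0 by apply: leader_zero; rewrite ?lamE.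
have [k0|[q kq]] : kj = 0%N \/ exists q, kj = q.+1.
  by case: (kj) => [|q]; [left|right; exists q].
- have ij0 : i j = ord0 by apply: first_block; rewrite ?lamE ?kapE.
  have j0 : j = ord0.
    apply: (in_cluster_uniq i_maxima (in_cluster_leader i_maxima j)).
    by have := in_cluster_leader i_maxima ord0; have [-> _ _ _] := i_maxima; rewrite ij0.
  have yE N : y (i j) N = X (i j) 0%N.
    rewrite /y /a lamE kapE l0 k0 /scale growth0 expr0 mulr1 invr1 scale1r.
    elim: N => // N <-; rewrite (rec (i j) N) Q0 mulmx0 add0r big_pred0.
      rewrite scaler0 addr0.
      suff -> : xi (i j) N = 0 by rewrite addr0.
      by move: (i j) ij0 l0 => k -> m0; exact: noise0.
    by move=> m; rewrite ij0.
  have -> : nb_factors i j = 0%N by rewrite nb_factors_leader// ij0.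
  rewrite k0 fact0 invr1 scale1r /=.
  rewrite (_ : X ord0 0%N *m pid_mx (d ord0) = X (i j) 0%N); last first.
    by move: (i j) ij0 => k ->; rewrite pid_mx_1 mulmx1.
  move=> c; apply: cvg_near_cst; apply: nearW => N; by rewrite yE.
have kgt : (0 < kj)%N by rewrite kq.
have [j0 lp kp] := kappa_gt0 i_maxima kgt.
have kpq : cluster_order lambda (previous j) = q by apply: succn_inj; rewrite -kp.
have pl0 : mu (i (previous j)) = 0 by rewrite lp.
have hb := @drift_cvg (i j) (mu (i j)) q
  (fun m => q`!%:R^-1 *: (X ord0 0%N *m superdiagonal_prod M (i (previous j)) m))
  (mu_ge0 _) (mu_le1 _).
have {hb} := hb _ _ IHV.
rewrite (eq_bigl _ _ (fun m => previous_clusterE m kq)).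
have singleE m : (i (previous j) <= m < i j)%N = (m == i (previous j)).
  apply/idP/eqP => [pm|->].
    exact: zero_cluster pl0 (previous_in_cluster kgt pm).
  by rewrite leqnn/=; case: i_maxima => _ + _ _; apply; exact: previous_lt.
rewrite (eq_bigl _ _ singleE) big_pred1_eq.
set bl := _ *m Q _ _ => hb.
have hS : vcvg (vsum (mu (i j)) q.+1 (xi (i j))) (S (i j)).
  by rewrite -lamE -kq -kapE.
have {}hb : vcvg (fun N => (scale (mu (i j)) q N)^-1 *:
      \sum_(m < K.+1 | (m < i j)%N) X m N *m Q m (i j)) bl.
  apply: hb => [m mi|m mi h1 h2].
    by rewrite -lamE; apply: before_orderS; rewrite ?kapE.
  have : (m < i j)%N && ((lam m == mu (i j)) && (kap m == q)) by rewrite mi h1 h2 !eqxx.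
  rewrite (previous_clusterE m kq) => /(previous_in_cluster kgt) pm.
  by have := IH mi pm; rewrite /block_limit lp l0 eqxx kpq nb_factors_leader.
have -> : kj`!%:R^-1 *: (X ord0 0%N *m superdiagonal_prod M (nb_factors i j) (i j)) =
    q.+1%:R^-1 *: bl.
  have -> : nb_factors i j = (i (previous j)).+1.
    by rewrite /nb_factors; case: eqP j0 => // ->.
  rewrite /= inord_val /bl kq factS natrM invfM -scalemxAl scalerA mulmxA.
  by rewrite [_^-1 * _]mulrC.
move=> c; rewrite mxE mulrC -delta_component.
have dE : Q (i j) (i j) *m delta_mx c 0 = mu (i j) *: delta_mx c 0 :> 'cV_(d (i j)).
  by rewrite Q0 mul0mx l0 scale0r.
have h := componentS_cvg (mu_ge0 (i j)) dE (rec (i j)) hS hb.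
have yE : (fun N => y (i j) N 0 c) = (fun N =>
    ((scale (mu (i j)) q.+1 N)^-1 *: X (i j) N *m (delta_mx c 0 : 'cV[R]_(d (i j)))) 0 0).
  by apply/funext => N /=; rewrite delta_component /y /a lamE kapE kq.
by rewrite yE.
Qed.

End Leader.

Lemma nonleader_cvg k : (forall m, (m < k)%N -> forall j, in_cluster i j m ->
    vcvg (y m) (block_limit j m)) -> k != i (clus k) ->
  vcvg (y k) (v (clus k) *: (pi (i (clus k)) *m W (clus k) k)).
Proof.
move=> IH ki; set j := clus k.
have mul : mu k < mu (i j) by exact: mu_nonleader ki.
have l0 : 0 < mu (i j) by apply: le_lt_trans mul; exact: mu_ge0.
have jk := clus_nonleader ki.
(* The last cluster is the last block alone and has no nonleading block. *)
have jJ : (j < J)%N.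
  rewrite ltn_neqAle -ltnS ltn_ord andbT; apply/eqP => jJ.
  have jm : j = ord_max by exact: val_inj.
  move: ki; rewrite -/j jm i_last => /eqP[]; apply/val_inj/eqP; rewrite eqn_leq -ltnS ltn_ord/=.
  by have := leader_le i_maxima k; rewrite -/j jm i_last.
have [z z0 zE] := block_weight k.
have IHV m : (m < k)%N -> exists V, vcvg (y m) V.
  by move=> mk; exists (block_limit (clus m) m); apply: IH => //; exact: clusP.
have hb := @drift_cvg k (lam k) (kap k)
  (fun m => v j *: (pi (i j) *m W j m)) (lam_ge0 k) (lam_le1 k)
  (fun m mk => before_orderW mk) _ IHV.
have mul' : 0 <= mu k < lam k by rewrite mu_ge0.
have {hb} := nonleading_cvg (@block_ge0 k k) z0 zE mul' (rec k) (@noise k) (hb _).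
have E : (\sum_(m < K.+1 | (m < k)%N && ((lam m == lam k) && (kap m == kap k)))
    v j *: (pi (i j) *m W j m) *m Q m k) *m invmx ((lam k)%:M - Q k k) =
    v j *: (pi (i j) *m W j k).
  have [_ /(_ k jJ jk) ->] := W_def j.
  rewrite mulmx_suml mulmx_sumr scaler_sumr; apply: eq_big => [m|m _].
    have [mk|mk] := boolP (m < k)%N; rewrite ?andbF// andbT.
    rewrite same_clusterE ?(ltnW mk)//; apply/eqP/idP => [e|h]; first by rewrite -[j]/(clus k) -e; exact: leader_le.
    apply/clus_eq; rewrite /in_cluster h/=.
    by apply: (ltn_trans mk); case/andP: jk.
  by rewrite -!scalemxAl !mulmxA.
rewrite E; apply => m mk e1 e2.
have jm : in_cluster i j m.
  by rewrite (in_clusterE i_maxima) -same_clusterE ?(ltnW mk)// e1 e2 !eqxx.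
by have := IH m mk j jm; rewrite /block_limit gt_eqF.
Qed.

Theorem block_cvg k j : in_cluster i j k -> vcvg (y k) (block_limit j k).
Proof.
have [n] := ubnP (k : nat); elim: n k j => // n IHn k j; rewrite ltnS => kn jk.
have IH m : (m < k)%N -> forall j', in_cluster i j' m -> vcvg (y m) (block_limit j' m).
  by move=> mk j'; apply: IHn; exact: leq_trans mk kn.
have cE := clus_eq i_maxima jk.
have [ki|ki] := eqVneq k (i j); last first.
  have ki' : k != i (clus k) by rewrite cE.
  have := nonleader_cvg IH ki'.
  have : 0 < mu (i (clus k)).
    by apply: le_lt_trans (mu_nonleader ki'); exact: mu_ge0.
  by rewrite cE /block_limit => /gt_eqF ->.
subst k; rewrite /block_limit; case: eqP => [l0|/eqP l0]; first exact: zero_leader_cvg.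
have {}l0 : 0 < mu (i j) by rewrite lt_neqAle eq_sym l0 mu_ge0.
by have [h _] := leader_cvg IH l0; have [-> _] := W_def j; rewrite mulmx1.
Qed.

Theorem block_weight_limit_rec j : 0 < mu (i j) -> (0 < cluster_order lambda j)%N ->
  v j = cluster_w M mu pi zeta W j * v (previous j).
Proof.
move=> l0 k0; have [|_] := leader_cvg (j := j) _ l0; last exact.
by move=> m _ j'; exact: block_cvg.
Qed.

End Convergence.

End BlockRecursion.

(** * Martingales along the urn process *)

Section PathExpectation.
Variables (R : realType) (D : nat) (M : 'M[R]_D) (C0 : 'rV[R]_D).
Hypothesis M_ge0 : forall a b, 0 <= M a b.
Hypothesis M_balanced : balanced M.
Hypothesis C0_gt0 : forall a, 0 < C0 0 a.
Hypothesis C0_sum1 : \sum_a C0 0 a = 1.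
Implicit Types (h : nat -> 'I_D) (N n : nat) (phi psi : (nat -> 'I_D) -> R).

Local Notation cc := (color_counts M C0).

(** Functions of infinite sequences stand for functions of N draws, so that the type does not change
    with N. *)
Definition adapted N phi :=
  forall h h', (forall n, (n < N)%N -> h n = h' n) -> phi h = phi h'.

Definition update h N c n := if n == N then c else h n.

Lemma counts_adapted N h h' : (forall n, (n < N)%N -> h n = h' n) -> cc h N = cc h' N.
Proof.
elim: N => //= N IH e; rewrite e// IH// => n nN; apply: e; exact: ltnW.
Qed.

Lemma counts_gt0 h N a : 0 < cc h N 0 a.
Proof. by elim: N => //= N IH; rewrite !mxE ltr_wpDr. Qed.

Lemma counts_sum h N : \sum_a cc h N 0 a = N.+1%:R.
Proof.
elim: N => //= N IH.
under eq_bigr do rewrite mxE.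
rewrite big_split/= IH -[RHS]natr1; congr (_ + _).
by under eq_bigr do rewrite mxE; exact: M_balanced.
Qed.

Lemma counts_update h N c : cc (update h N c) N = cc h N.
Proof. by apply: counts_adapted => n nN; rewrite /update ltn_eqF. Qed.

Definition selection_prob h N c : R := cc h N 0 c / N.+1%:R.

Lemma selection_ge0 h N c : 0 <= selection_prob h N c.
Proof. by rewrite divr_ge0// ltW// counts_gt0. Qed.

Lemma selection_sum h N : \sum_c selection_prob h N c = 1.
Proof. by rewrite -mulr_suml counts_sum divff// pnatr_eq0. Qed.

Definition cond_exp N phi h := \sum_c selection_prob h N c * phi (update h N c).

Lemma cond_exp_adapted N phi : adapted N.+1 phi -> adapted N (cond_exp N phi).
Proof.
move=> ad h h' e; apply: eq_bigr => c _; rewrite /selection_prob (counts_adapted e).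
congr (_ * _); apply: ad => n; rewrite ltnS leq_eqVlt /update => /orP[/eqP ->|nN].
  by rewrite eqxx.
by rewrite ltn_eqF// e.
Qed.

Lemma cond_exp_id N phi : adapted N phi -> forall h, cond_exp N phi h = phi h.
Proof.
move=> ad h; rewrite /cond_exp -[RHS]mul1r -(selection_sum h N) mulr_suml.
apply: eq_bigr => c _; congr (_ * _); apply: ad => n nN.
by rewrite /update ltn_eqF.
Qed.

(* Integrating out the last draw first keeps the expectation a finite sum. *)
Fixpoint path_exp N phi (c0 : 'I_D) : R :=
  if N is n.+1 then path_exp n (cond_exp n phi) c0 else phi (fun=> c0).

Variable c0 : 'I_D.
Local Notation Ex N phi := (path_exp N phi c0).

Lemma eq_path_exp N phi psi : (forall h, phi h = psi h) -> Ex N phi = Ex N psi.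
Proof. by move=> /funext ->. Qed.

Lemma le_path_exp N phi psi : (forall h, phi h <= psi h) -> Ex N phi <= Ex N psi.
Proof.
elim: N phi psi => [|N IH] phi psi le; first exact: le.
by apply: IH => h; apply: ler_sum => c _; rewrite ler_wpM2l ?selection_ge0.
Qed.

Lemma path_expD N phi psi : Ex N (fun h => phi h + psi h) = Ex N phi + Ex N psi.
Proof.
elim: N phi psi => [|N IH] phi psi //=; rewrite -IH; apply: eq_path_exp => h.
by rewrite /cond_exp -big_split; apply: eq_bigr => c _ /=; rewrite mulrDr.
Qed.

Lemma path_expZ N k phi : Ex N (fun h => k * phi h) = k * Ex N phi.
Proof.
elim: N phi => [|N IH] phi //=; rewrite -IH; apply: eq_path_exp => h.
by rewrite /cond_exp mulr_sumr; apply: eq_bigr => c _; rewrite mulrCA.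
Qed.

Lemma path_exp0 N : Ex N (fun=> 0) = 0.
Proof.
rewrite -[RHS](mul0r (Ex N (fun=> 0))) -path_expZ.
by apply: eq_path_exp => h; rewrite mul0r.
Qed.

Lemma path_exp_sum N (I : Type) (r : seq I) (P : pred I) (f : I -> (nat -> 'I_D) -> R) :
  Ex N (fun h => \sum_(i <- r | P i) f i h) = \sum_(i <- r | P i) Ex N (f i).
Proof.
elim: r => [|i r IH].
  by rewrite big_nil -[RHS](path_exp0 N); apply: eq_path_exp => h; rewrite big_nil.
rewrite big_cons -IH; case: ifPn => Pi.
  by rewrite -path_expD; apply: eq_path_exp => h; rewrite big_cons Pi.
by apply: eq_path_exp => h; rewrite big_cons (negbTE Pi).
Qed.

Lemma path_exp_adapted N phi : adapted N phi -> Ex N.+1 phi = Ex N phi.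
Proof. by move=> ad /=; apply: eq_path_exp; exact: cond_exp_id. Qed.

Lemma adaptedW N N' phi : (N <= N')%N -> adapted N phi -> adapted N' phi.
Proof. by move=> NN ad h h' e; apply: ad => n nN; apply: e; exact: leq_trans NN. Qed.

Lemma path_exp_widen N N' phi : (N <= N')%N -> adapted N phi -> Ex N' phi = Ex N phi.
Proof.
move=> NN ad; rewrite -(subnK NN); elim: (N' - N)%N => // k IH.
rewrite addSn path_exp_adapted//; exact: adaptedW (leq_addl k N) ad.
Qed.

Definition martdiff N xi := adapted N.+1 xi /\ forall h, cond_exp N xi h = 0.

Lemma martdiff_exp N phi xi : adapted N phi -> martdiff N xi ->
  Ex N.+1 (fun h => phi h * xi h) = 0.
Proof.
move=> ad [_ x0] /=; rewrite -[RHS](path_exp0 N); apply: eq_path_exp => h.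
rewrite -[RHS](mulr0 (phi h)) -(x0 h) /cond_exp mulr_sumr; apply: eq_bigr => c _.
rewrite mulrCA; congr (_ * _); apply: ad => n nN.
by rewrite /update ltn_eqF.
Qed.

Section Doob.
Variable xi : nat -> (nat -> 'I_D) -> R.
Hypothesis xiM : forall N, martdiff N (xi N).

Definition mart m n h := \sum_(k < n) xi (m + k)%N h.

(** One-sided and started at 0, hence nonnegative; the two-sided maximum is later obtained from xi
    and - xi. *)
Fixpoint runmax m n h : R :=
  if n is n'.+1 then Num.max (runmax m n' h) (mart m n h) else 0.

Lemma martS m n h : mart m n.+1 h = mart m n h + xi (m + n)%N h.
Proof. by rewrite /mart big_ord_recr. Qed.

Lemma mart0 m h : mart m 0 h = 0.
Proof. by rewrite /mart big_ord0. Qed.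

Lemma mart_adapted m n : adapted (m + n) (mart m n).
Proof.
move=> h h' e; apply: eq_bigr => k _; apply: (xiM (m + k)).1 => q qk.
by apply: e; rewrite (leq_trans qk)// -addnS leq_add2l.
Qed.

Lemma runmax_adapted m n : adapted (m + n) (runmax m n).
Proof.
elim: n => [|n IH] h h' e //=; rewrite (mart_adapted e); congr Num.max.
by apply: IH => k kn; apply: e; rewrite (leq_trans kn)// leq_add2l.
Qed.

Lemma runmax_ge0 m n h : 0 <= runmax m n h.
Proof. by elim: n => //= n IH; rewrite le_max IH. Qed.

Lemma runmax_ge m n k h : (k <= n)%N -> mart m k h <= runmax m n h.
Proof.
elim: n => [|n IH]; first by rewrite leqn0 => /eqP ->; rewrite mart0.
rewrite leq_eqVlt => /orP[/eqP -> /=|kn /=]; first by rewrite le_max lexx orbT.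
by rewrite le_max IH.
Qed.

(* Doob's maximal inequality, pathwise: the last sum is a martingale transform. *)
Lemma pathwise_doob m n h : runmax m n h ^+ 2 <=
  4 * (mart m n h) ^+ 2 - 4 * \sum_(k < n) runmax m k h * xi (m + k)%N h.
Proof.
(* The inequality A^2 <= 2 A B - 2 C is the one that passes through the induction; with (A - 2 B)^2
   >= 0 it gives A^2 <= 4 B^2 - 4 C. *)
suff H : runmax m n h ^+ 2 <= 2 * (runmax m n h * mart m n h) -
    2 * \sum_(k < n) runmax m k h * xi (m + k)%N h.
  have : 0 <= (runmax m n h - 2 * mart m n h) ^+ 2 by exact: sqr_ge0.
  move: H; set A := runmax _ _ _; set B := mart _ _ _; set C := \sum_(_ < _) _.
  by rewrite !expr2 => H1 H2; nra.
elim: n => [|n IH]; first by rewrite big_ord0 /= mul0r; lra.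
rewrite big_ord_recr/=.
have := martS m n h; set B := mart m n h in IH *; set B' := mart m n.+1 h => BE.
move: IH; set A := runmax m n h; set S := \sum_(_ < _) _ => IH.
have A0 : 0 <= A := runmax_ge0 m n h.
have -> : xi (m + n)%N h = B' - B by rewrite BE addrC addKr.
case: (leP A B') => AB.
  have : 0 <= (B' - A) ^+ 2 by exact: sqr_ge0.
  by nra.
by nra.
Qed.

Lemma mart_variance m n :
  Ex (m + n) (fun h => mart m n h ^+ 2) = \sum_(k < n) Ex (m + k).+1 (fun h => xi (m + k)%N h ^+ 2).
Proof.
elim: n => [|n IH].
  rewrite big_ord0 -[RHS](path_exp0 (m + 0)); apply: eq_path_exp => h.
  by rewrite mart0 expr0n.
rewrite big_ord_recr -IH addnS.
have mA : adapted (m + n) (fun h => mart m n h ^+ 2).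
  by move=> h h' e; rewrite (mart_adapted e).
rewrite -(path_exp_adapted mA).
have e : Ex (m + n).+1 (fun h => 2 * mart m n h * xi (m + n)%N h) = 0.
  apply: martdiff_exp (xiM _) => h h' e.
  by rewrite (mart_adapted e).
rewrite (@eq_path_exp _ _ (fun h => mart m n h ^+ 2 +
    (2 * mart m n h * xi (m + n)%N h + xi (m + n)%N h ^+ 2))).
  by rewrite !path_expD e add0r.
by move=> h; rewrite martS; ring.
Qed.

(** In the mean of [pathwise_doob] the transform drops out, since [runmax m k] is known before the
    draw m + k. *)
Lemma doob_exp m n : Ex (m + n) (fun h => runmax m n h ^+ 2) <=
  4 * \sum_(k < n) Ex (m + k).+1 (fun h => xi (m + k)%N h ^+ 2).
Proof.
apply: (le_trans (le_path_exp _ (pathwise_doob m n))).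
rewrite path_expD path_expZ mart_variance gerDl.
rewrite (@eq_path_exp _ _ (fun h => -4 * \sum_(k < n) runmax m k h * xi (m + k)%N h)).
  rewrite path_expZ path_exp_sum big1 ?mulr0// => k _.
  rewrite -[RHS](martdiff_exp (@runmax_adapted m k) (xiM (m + k))).
  apply: path_exp_widen; first by rewrite -addnS leq_add2l.
  move=> h h' e; congr (_ * _); last exact: (xiM (m + k)).1.
  by apply: runmax_adapted => q qk; apply: e; exact: ltnW.
by move=> h; rewrite mulNr.
Qed.

End Doob.

End PathExpectation.

(** * Path expectations as integrals *)

Section Bridge.
Variables (R : realType) (D : nat) (M : 'M[R]_D) (C0 : 'rV[R]_D).
Variables (disp : measure_display) (T : measurableType disp) (P : probability T R).
Variable X : nat -> T -> 'I_D.
Hypothesis X_urn : urn_selection P M C0 X.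
Variable c0 : 'I_D.
Implicit Types (h : nat -> 'I_D) (N n : nat) (phi psi : (nat -> 'I_D) -> R).

Definition path t n : 'I_D := X n t.

Definition cylinder N h := [set t | forall n, (n < N)%N -> X n t = h n].

Lemma measurable_cylinder N h : measurable (cylinder N h).
Proof.
elim: N => [|N IH].
  rewrite (_ : cylinder 0 h = setT); first exact: measurableT.
  by apply/seteqP; split.
rewrite (_ : cylinder N.+1 h = cylinder N h `&` X N @^-1` [set h N]).
  by apply: measurableI => //; exact: X_urn.1.
apply/seteqP; split=> [t ht|t [ht e] n].
  by split=> [n nN|]; apply: ht => //; exact: ltnW.
by rewrite ltnS leq_eqVlt => /orP[/eqP -> //|]; exact: ht.
Qed.

Definition ext N (s : N.-tuple 'I_D) : nat -> 'I_D := nth c0 s.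

(** At t only the cylinder of the actual first N draws contributes; adapted functions thus become
    simple functions on the probability space. *)
Lemma cylinder_decomposition N psi (A : set T) t : adapted N psi ->
  psi (path t) * \1_A t =
  \sum_(s : N.-tuple 'I_D) psi (ext s) * \1_(cylinder N (ext s) `&` A) t.
Proof.
move=> ad; pose s0 := [tuple X i t | i < N].
have s0E n : (n < N)%N -> X n t = ext s0 n.
  move=> nN; rewrite /ext -(tnth_nth c0 s0 (Ordinal nN)).
  by rewrite tnth_mktuple.
rewrite (bigD1 s0)//= [X in _ = _ + X]big1 ?addr0.
  rewrite indicI /= (_ : \1_(cylinder N (ext s0)) t = 1) ?mul1r.
    by congr (_ * _); apply: ad => n /s0E.
  by rewrite indicE mem_set// => n; exact: s0E.
move=> s ss0; rewrite indicI /= (_ : \1_(cylinder N (ext s)) t = 0) ?mul0r ?mulr0//.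
rewrite indicE memNset// => hs; move/eqP: ss0; apply.
apply: eq_from_tnth => n; rewrite tnth_mktuple.
by rewrite (tnth_nth c0) hs.
Qed.

Let fin_integrable (I : finType) (f : I -> R) (B : I -> set T) :
  (forall s, measurable (B s)) -> forall s,
  P.-integrable setT (fun t => (f s * \1_(B s) t)%:E).
Proof.
move=> mB s; rewrite (_ : (fun t => _) = fun t => ((f s)%:E * (\1_(B s) t)%:E)%E).
  by apply: integrableZl => //; exact: integrable_indic.
by apply/funext => t; rewrite EFinM.
Qed.

Lemma integral_simple (I : finType) (f : I -> R) (B : I -> set T) :
  (forall s, measurable (B s)) ->
  (\int[P]_t (\sum_s f s * \1_(B s) t)%:E)%E = (\sum_s f s * fine (P (B s)))%:E.
Proof.
move=> mB; under eq_integral do rewrite -sumEFin.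
rewrite integral_sum//; last by move=> s; exact: fin_integrable.
rewrite -sumEFin; apply: eq_bigr => s _.
under eq_integral do rewrite EFinM.
rewrite integralZl//; last exact: integrable_indic.
rewrite integral_indic// setIT EFinM fineK//.
exact: fin_num_measure.
Qed.

Lemma adapted_measurable N psi : adapted N psi ->
  measurable_fun setT (fun t => psi (path t)).
Proof.
move=> ad; rewrite (_ : (fun t => _) =
   fun t => \sum_(s : N.-tuple 'I_D) psi (ext s) * \1_(cylinder N (ext s) `&` setT) t).
  apply: measurable_sum => s; apply: measurable_funM => //.
  by apply: measurable_indic; apply: measurableI => //; exact: measurable_cylinder.
by apply/funext => t; rewrite -cylinder_decomposition// indicT mulr1.
Qed.

Lemma adapted_integrable N psi : adapted N psi ->
  P.-integrable setT (fun t => (psi (path t))%:E).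
Proof.
move=> ad; rewrite (_ : (fun t => _) =
   fun t => (\sum_(s : N.-tuple 'I_D) (psi (ext s) * \1_(cylinder N (ext s) `&` setT) t)%:E)%E).
  apply: integrable_sum => //= s _.
  apply: (@fin_integrable _ (fun s : N.-tuple 'I_D => psi (ext s))
    (fun s => cylinder N (ext s) `&` setT)) => s'.
  by apply: measurableI => //; exact: measurable_cylinder.
by apply/funext => t; rewrite sumEFin -cylinder_decomposition// indicT mulr1.
Qed.

Lemma adapted_integral N psi (A : set T) : adapted N psi -> measurable A ->
  (\int[P]_t (psi (path t) * \1_A t)%:E)%E =
  (\sum_(s : N.-tuple 'I_D) psi (ext s) * fine (P (cylinder N (ext s) `&` A)))%:E.
Proof.
move=> ad mA; under eq_integral do rewrite (cylinder_decomposition _ _ ad).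
apply: integral_simple => s; apply: measurableI => //; exact: measurable_cylinder.
Qed.

(** The law of the urn is prescribed on cylinders, and an adapted function is a finite combination
    of their indicators. *)
Lemma integral_selection N psi c : adapted N psi ->
  (\int[P]_t (psi (path t) * \1_(X N @^-1` [set c]) t)%:E)%E =
  (\int[P]_t (psi (path t) * selection_prob M C0 (path t) N c)%:E)%E.
Proof.
move=> ad; rewrite (adapted_integral ad (X_urn.1 N c)).
have ad' : adapted N (fun h => psi h * selection_prob M C0 h N c).
  move=> h h' e; rewrite (ad _ _ e) /selection_prob.
  by rewrite (counts_adapted M C0 e).
transitivity (\int[P]_t ((psi (path t) * selection_prob M C0 (path t) N c) * \1_setT t)%:E)%E.
  rewrite (adapted_integral ad' measurableT); congr _%:E; apply: eq_bigr => s _.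
  rewrite -mulrA; congr (_ * _); rewrite setIT.
  by rewrite (X_urn.2 N (ext s) c) fineM// fin_num_measure//; exact: measurable_cylinder.
by apply: eq_integral => t _; rewrite indicT mulr1.
Qed.

(** The last draw is integrated out by splitting over its color; martingale arguments then need only
    finite sums in place of abstract conditional expectations. *)
Theorem integral_path_exp N phi : adapted N phi ->
  (\int[P]_t (phi (path t))%:E)%E = (path_exp M C0 N phi c0)%:E.
Proof.
elim: N phi => [|N IH] phi ad.
  rewrite /= (_ : (fun t => _) = fun=> (phi (fun=> c0))%:E).
    by rewrite integral_cst//= probability_setT mule1.
  by apply/funext => t; congr _%:E; exact: ad.
rewrite /= -IH; last exact: cond_exp_adapted.
have adc c : adapted N (fun h => phi (update h N c)).
  move=> h h' e; apply: ad => n; rewrite ltnS leq_eqVlt /update => /orP[/eqP ->|nN].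
    by rewrite eqxx.
  by rewrite ltn_eqF// e.
have e1 t : phi (path t) = \sum_c phi (update (path t) N c) * \1_(X N @^-1` [set c]) t.
  rewrite (bigD1 (X N t))//= big1 ?addr0.
    rewrite indicE mem_set// mulr1; apply: ad => n; rewrite /update.
    by case: eqP => // ->.
  by move=> c cX; rewrite indicE memNset ?mulr0//= => e; rewrite e eqxx in cX.
under eq_integral do rewrite e1 -sumEFin.
rewrite integral_sum//; last first.
  move=> c; rewrite (_ : (fun t => _) = (fun t => (\sum_(s : N.-tuple 'I_D)
      (phi (update (ext s) N c) * \1_(cylinder N (ext s) `&` X N @^-1` [set c]) t)%:E)%E)).
    apply: integrable_sum => //= s _.
    apply: (@fin_integrable _ (fun s : N.-tuple 'I_D => phi (update (ext s) N c))
      (fun s => cylinder N (ext s) `&` X N @^-1` [set c])) => s'.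
    by apply: measurableI; [exact: measurable_cylinder|exact: X_urn.1].
  by apply/funext => t; rewrite sumEFin -(cylinder_decomposition _ _ (adc c)).
under [RHS]eq_integral do rewrite /cond_exp -sumEFin.
rewrite [RHS]integral_sum//; last first.
  move=> c; apply: (@adapted_integrable N (fun h => selection_prob M C0 h N c * phi (update h N c))).
  move=> h h' e; rewrite (adc c _ _ e) /selection_prob.
  by rewrite (counts_adapted M C0 e).
apply: eq_bigr => c _; apply: (eq_trans (integral_selection c (adc c))).
by apply: eq_integral => t _; rewrite mulrC.
Qed.

End Bridge.

(** * Convergence of martingales bounded in L^2 *)

Section MartingaleConvergence.
Variables (R : realType) (D : nat) (M : 'M[R]_D) (C0 : 'rV[R]_D).
Hypothesis M_ge0 : forall a b, 0 <= M a b.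
Hypothesis M_balanced : balanced M.
Hypothesis C0_gt0 : forall a, 0 < C0 0 a.
Hypothesis C0_sum1 : \sum_a C0 0 a = 1.
Variables (disp : measure_display) (T : measurableType disp) (P : probability T R).
Variable X : nat -> T -> 'I_D.
Hypothesis X_urn : urn_selection P M C0 X.
Variable c0 : 'I_D.
Local Notation Ex N phi := (path_exp M C0 N phi c0).
Local Notation path := (path X).

Variable xi : nat -> (nat -> 'I_D) -> R.
Hypothesis xiM : forall N, martdiff M C0 N (xi N).
Let var n := Ex n.+1 (fun h => xi n h ^+ 2).
Variable V : R.
Hypothesis var_le : forall N, \sum_(n < N) var n <= V.

Let nxi n h := - xi n h.

Let nxiM N : martdiff M C0 N (nxi N).
Proof.
split=> [h h' e|h]; first by rewrite /nxi ((xiM N).1 _ _ e).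
rewrite -oppr0 -((xiM N).2 h) /cond_exp -sumrN; apply: eq_bigr => c _.
by rewrite mulrN.
Qed.

Let absmax m n h := runmax xi m n h + runmax nxi m n h.

Let absmax_adapted m n : adapted (m + n) (absmax m n).
Proof.
by move=> h h' e; rewrite /absmax (runmax_adapted xiM e) (runmax_adapted nxiM e).
Qed.

Let mart_nxi m n h : mart nxi m n h = - mart xi m n h.
Proof. by rewrite /mart -sumrN. Qed.

Let absmax_ge m n k h : (k <= n)%N -> `|mart xi m k h| <= absmax m n h.
Proof.
move=> kn; have h1 := runmax_ge xi m h kn; have h2 := runmax_ge nxi m h kn.
have h3 := runmax_ge0 xi m n h; have h4 := runmax_ge0 nxi m n h.
by rewrite mart_nxi in h2; rewrite ler_norml /absmax; apply/andP; split; lra.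
Qed.

Let absmax_ge0 m n h : 0 <= absmax m n h.
Proof. by rewrite addr_ge0// runmax_ge0. Qed.

Let absmax_leS m n h : absmax m n h <= absmax m n.+1 h.
Proof. by rewrite /absmax /= lerD// le_max lexx. Qed.

Let tail m n := \sum_(k < n) var (m + k)%N.

(** 16 = 2 * 4 + 2 * 4, from (x + y)^2 <= 2 x^2 + 2 y^2 and Doob's constant 4 for xi and for -
    xi. *)
Let absmax_exp m n : Ex (m + n) (fun h => absmax m n h ^+ 2) <= 16 * tail m n.
Proof.
have h1 := doob_exp M_ge0 M_balanced C0_gt0 C0_sum1 c0 xiM m n.
have h2 := doob_exp M_ge0 M_balanced C0_gt0 C0_sum1 c0 nxiM m n.
have e : \sum_(k < n) Ex (m + k).+1 (fun h => nxi (m + k)%N h ^+ 2) = tail m n.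
  apply: eq_bigr => k _; apply: eq_path_exp => h.
  by rewrite /nxi sqrrN.
rewrite e in h2.
apply: (@le_trans _ _ (2 * Ex (m + n) (fun h => runmax xi m n h ^+ 2) +
                       2 * Ex (m + n) (fun h => runmax nxi m n h ^+ 2))).
  rewrite -!path_expZ -path_expD.
  apply: (le_path_exp M_ge0 C0_gt0) => h; rewrite /absmax.
  set x := runmax _ _ _ _; set y := runmax _ _ _ _.
  have : 0 <= (x - y) ^+ 2 by exact: sqr_ge0.
  by nra.
by rewrite /tail -/(var _) in h1 h2 *; lra.
Qed.

Local Open Scope ereal_scope.

Let sq m n t : \bar R := ((absmax m n (path t) ^+ 2)%R)%:E.
Let S m t : \bar R := limn (fun n => sq m n t).

Let sq_adapted m n : adapted (m + n) (fun h => (absmax m n h ^+ 2)%R).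
Proof. by move=> h h' e; rewrite (absmax_adapted e). Qed.

Let sq_meas m n : measurable_fun setT (sq m n).
Proof. apply/measurable_EFinP; exact: adapted_measurable X_urn c0 _ _ (@sq_adapted m n). Qed.

Let sq_nd m t : nondecreasing_seq (fun n => sq m n t).
Proof.
apply/nondecreasing_seqP => n; rewrite lee_fin.
by rewrite lerXn2r ?nnegrE ?absmax_ge0.
Qed.

Let sq_cvg m t : (fun n => sq m n t) @ \oo --> S m t.
Proof. exact: ereal_nondecreasing_is_cvgn. Qed.

Let sq_le m n t : sq m n t <= S m t.
Proof.
rewrite /S (cvg_lim _ (ereal_nondecreasing_cvgn (@sq_nd m t)))//.
by apply: ereal_sup_ubound; exists n.
Qed.

Let S_ge0 m t : 0 <= S m t.
Proof. by apply: le_trans (sq_le m 0 t); rewrite lee_fin sqr_ge0. Qed.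

Let S_meas m : measurable_fun setT (S m).
Proof. by apply: (emeasurable_fun_cvg (sq m)) => // t _; exact: sq_cvg. Qed.

Let var_ge0 n : (0 <= var n)%R.
Proof.
rewrite -(path_exp0 M C0 c0 n.+1); apply: (le_path_exp M_ge0 C0_gt0) => h.
exact: sqr_ge0.
Qed.

Let s N := (\sum_(n < N) var n)%R.

Let s_nd : nondecreasing_seq s.
Proof. by apply/nondecreasing_seqP => n; rewrite /s big_ord_recr/= lerDl. Qed.

Let s_cvg : cvgn s.
Proof.
apply: nondecreasing_is_cvgn => //; exists V => _ [N _ <-]; exact: var_le.
Qed.

Let tailE m n : tail m n = (s (m + n) - s m)%R.
Proof.
rewrite /tail; elim: n => [|n IH]; first by rewrite big_ord0 addn0 subrr.
by rewrite big_ord_recr/= IH addnS /s [in RHS]big_ord_recr/=; ring.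
Qed.

Let S_integral m : \int[P]_t S m t <= (16 * (limn s - s m))%:E.
Proof.
rewrite (_ : \int[P]_t S m t = limn (fun n => \int[P]_t sq m n t)); last first.
  by apply: monotone_convergence => // n t _; rewrite lee_fin sqr_ge0.
apply: lime_le.
  apply: ereal_nondecreasing_is_cvgn => n n' nn; apply: ge0_le_integral => // t _.
  - by rewrite lee_fin sqr_ge0.
  - exact: sq_nd.
apply: nearW => n.
rewrite (integral_path_exp X_urn c0 (@sq_adapted m n)).
rewrite lee_fin (le_trans (absmax_exp m n))// tailE ler_wpM2l// lerD2r.
exact: nondecreasing_cvgn_le.
Qed.

Let S_integrable : P.-integrable setT (S 0).
Proof.
apply/integrableP; split=> //.
under eq_integral do rewrite gee0_abs//.
by rewrite (le_lt_trans (S_integral 0))// ltry.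
Qed.

(** Where this infimum is 0, the partial sums oscillate arbitrarily little after some time, which is
    the Cauchy property. Its integral is below every tail of the convergent series of variances. *)
Let O t := einfs (fun m => S m t) 0%N.

Let O_le m t : O t <= S m t.
Proof. by apply: ereal_inf_lbound; exists m. Qed.

Let O_ge0 t : 0 <= O t.
Proof. by apply: le_ereal_inf_tmp => _ [m _ <-]. Qed.

Let O_ae : {ae P, forall t, O t = 0}.
Proof.
have mO : measurable_fun setT O by exact: measurable_fun_einfs.
suff : \int[P]_t `|O t| = 0.
  move/(ae_eq_integral_abs P measurableT mO); apply: filterS => t; exact.
under eq_integral do rewrite gee0_abs//.
apply/le_anti/andP; split; last by apply: integral_ge0.
have h m : \int[P]_t O t <= (16 * (limn s - s m))%:E.
  apply: le_trans (S_integral m); apply: ge0_le_integral => // t _; exact: O_le.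
have hc : (fun m => (16 * (limn s - s m))%:E) @ \oo --> (0 : \bar R).
  apply/cvg_EFin; first exact: nearW.
  rewrite -[X in _ --> X](mulr0 16%R) /=; apply: cvgMl_tmp.
  by rewrite -[X in _ --> X](subrr (limn s)); apply: cvgB => //; exact: cvg_cst.
rewrite -(cvg_lim _ hc)//; apply: lime_ge; first exact: (cvgP _ hc).
by apply: nearW => m; exact: h.
Qed.

Local Close Scope ereal_scope.

Theorem martingale_cvg : exists H : T -> \bar R, [/\ P.-integrable setT H,
  forall N t, (((mart xi 0 N (path t)) ^+ 2)%:E <= H t)%E &
  {ae P, forall t, cvgn (fun N => mart xi 0 N (path t))}].
Proof.
exists (S 0); split=> // [N t|].
  apply: le_trans (sq_le 0 N t); rewrite lee_fin -real_normK ?num_real//.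
  by rewrite lerXn2r ?nnegrE ?absmax_ge0 ?absmax_ge.
apply: filterS O_ae => t Ot.
suff : cvgn (series (fun n => xi n (path t))).
  by rewrite seriesEord /mart.
apply/cauchy_cvgP/cauchy_seriesP => e e0.
have e20 : 0 < e / 2 by rewrite divr_gt0.
have [m hm] : exists m, (S m t < ((e / 2 / 2) ^+ 2)%:E)%E.
  have : (O t < ((e / 2 / 2) ^+ 2)%:E)%E by rewrite Ot lte_fin exprn_gt0// divr_gt0.
  by move=> /ereal_inf_lt[_ [m _ <-]]; exists m.
have small n : `|mart xi m n (path t)| < e / 2 / 2.
  have : (((mart xi m n (path t)) ^+ 2)%:E < ((e / 2 / 2) ^+ 2)%:E)%E.
    apply: le_lt_trans hm; apply: le_trans (sq_le m n t).
    rewrite lee_fin -real_normK ?num_real//.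
    by rewrite lerXn2r ?nnegrE ?absmax_ge0 ?absmax_ge.
  rewrite lte_fin -real_normK ?num_real// ltr_pXn2r ?nnegrE//.
  by rewrite !divr_ge0// ltW.
exists ([set n | (m <= n)%N], [set n | (m <= n)%N]); first by split; exists m.
move=> [n1 n2] /= [h1 h2].
have [n12|n21] := leqP n1 n2; last by rewrite big_geq ?normr0// ltnW.
have -> : \sum_(n1 <= k < n2) xi k (path t) =
   mart xi m (n2 - m) (path t) - mart xi m (n1 - m) (path t).
  have mE n : mart xi m n (path t) = series (fun k => xi k (path t)) (m + n)%N -
      series (fun k => xi k (path t)) m.
    elim: n => [|n IH]; first by rewrite mart0 addn0 subrr.
    by rewrite martS IH addnS seriesSr; ring.
  by rewrite !mE !subnKC// opprB addrA subrK sub_series_geq.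
apply: (le_lt_trans (ler_normB _ _)).
rewrite (splitr e) ltrD//.
  by apply: lt_trans (small _) _; rewrite ltr_pdivrMr// ltr_pMr// ltr1n.
by apply: lt_trans (small _) _; rewrite ltr_pdivrMr// ltr_pMr// ltr1n.
Qed.

End MartingaleConvergence.

Lemma vcvg_mx (R : realType) n (v : nat -> 'rV[R]_n) (L : 'rV[R]_n) :
  vcvg v L -> v @ \oo --> L.
Proof.
move=> h; apply/cvg_ballP => e e0.
have H : \forall N \near \oo, forall j, ball (L 0 j) e (v N 0 j).
  by apply: filter_forall => j; have /cvg_ballP := h j; exact.
by apply: filterS H => N hN; split=> // a j; rewrite (ord1 a); exact: hN.
Qed.

Section DominatedL2.
Variables (R : realType) (disp : measure_display) (T : measurableType disp).
Variable P : probability T R.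

(** Dominated convergence for (Y - L)^2, which is at most 2 Y^2 + 2 L^2 and hence at most 4 H,
    because L^2 <= H in the limit. *)
Lemma dominated_L2 (Y : nat -> T -> R) (L : T -> R) (H : T -> \bar R) :
  (forall N, measurable_fun setT (Y N)) -> measurable_fun setT L ->
  P.-integrable setT H ->
  {ae P, forall t, (fun N => Y N t) @ \oo --> L t} ->
  {ae P, forall t, forall N, (((Y N t) ^+ 2)%:E <= H t)%E} ->
  (fun N => 'N[P]_2%:E [(fun t => (Y N t - L t)%:E)])%E @ \oo --> (0 : \bar R).
Proof.
move=> mY mL iH YL YH.
pose f N t : \bar R := ((Y N t - L t) ^+ 2)%:E.
have mf N : measurable_fun setT (f N).
  by apply/measurable_EFinP; apply: measurable_funX; exact: measurable_funB.
have f0 : {ae P, forall t, setT t -> f ^~ t @ \oo --> (0 : \bar R)}.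
  apply: filterS YL => t h _; apply/cvg_EFin; first exact: nearW.
  have hd : (fun N => Y N t - L t) @ \oo --> (0 : R).
    by rewrite -(subrr (L t)); apply: cvgB => //; exact: cvg_cst.
  rewrite (_ : _ \o _ = fun N => (Y N t - L t) * (Y N t - L t)).
    by rewrite -[X in _ --> X](mulr0 0); exact: (cvgM hd hd).
  by apply/funext => N /=; rewrite expr2.
have fH : {ae P, forall t N, setT t -> (`|f N t| <= 4%:E * H t)%E}.
  apply: filterS2 YL YH => t h hH N _.
  have L2 : (((L t) ^+ 2)%:E <= H t)%E.
    have hc : (fun N => ((Y N t) ^+ 2)%:E) @ \oo --> ((L t) ^+ 2)%:E.
      apply/cvg_EFin; first exact: nearW.
      rewrite expr2 (_ : _ \o _ = fun N => Y N t * Y N t); first exact: (cvgM h h).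
      by apply/funext => n /=; rewrite expr2.
    rewrite -(cvg_lim _ hc)//; apply: lime_le; first exact: (cvgP _ hc).
    exact: nearW.
  rewrite /f gee0_abs ?lee_fin ?sqr_ge0//.
  have := hH N; move: L2; case: (H t) => [r| |].
  - rewrite !lee_fin => h1 h2.
    have : 0 <= (Y N t + L t) ^+ 2 by exact: sqr_ge0.
    by nra.
  - by move=> _ _; rewrite gt0_muley ?lte_fin// leey.
  - by move=> _; rewrite leeNy_eq.
have i4H : P.-integrable setT (fun t => 4%:E * H t)%E by exact: integrableZl.
have [_ _ hint] := dominated_convergence measurableT mf
  (measurable_cst (0 : \bar R)) f0 i4H fH.
rewrite /= integral0 in hint.
rewrite unlock/=.
rewrite (_ : (fun N => _) = (fun N => (\int[P]_t f N t) `^ 2^-1)%E); last first.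
  apply/funext => N; congr (_ `^ _)%E; apply: eq_integral => t _.
  by rewrite /f powR_mulrn// real_normK ?num_real.
have /fine_cvgP[hfin hfine] := hint.
have hs : (fun N => (Num.sqrt (fine (\int[P]_t f N t)%E))%:E) @ \oo --> (0 : \bar R).
  apply/cvg_EFin; first exact: nearW.
  have := @cvg_comp _ _ _ _ Num.sqrt _ _ _ hfine (@sqrt_continuous R 0).
  by rewrite sqrtr0.
move: hs; apply: cvg_trans; apply: near_eq_cvg.
near=> N.
have Nfin : (\int[P]_t f N t)%E \is a fin_num by near: N.
rewrite -[in RHS](fineK Nfin) poweR_EFin -powR12_sqrt//.
by apply/fine_ge0/integral_ge0 => t _; rewrite lee_fin sqr_ge0.
Unshelve. all: by end_near. Qed.

End DominatedL2.

(** * Consequences of the increasing order *)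

Lemma submxrow_mulmx (R : realType) (p q : nat) (p_ : 'I_p -> nat) (q_ : 'I_q -> nat)
    r (v : 'M[R]_(r, \sum_k p_ k)) (A : 'M[R]_(\sum_k p_ k, \sum_k q_ k)) k :
  submxrow (v *m A) k = \sum_m submxrow v m *m submxblock A m k.
Proof. by rewrite -{1}(submxrowK v) -{1}(submxblockK A) mul_mxrow_mxblock mxrowK. Qed.

Lemma submxcol_mulmx (R : realType) (p q : nat) (p_ : 'I_p -> nat) (q_ : 'I_q -> nat)
    r (A : 'M[R]_(\sum_k p_ k, \sum_k q_ k)) (v : 'M[R]_(\sum_k q_ k, r)) k :
  submxcol (A *m v) k = \sum_m submxblock A k m *m submxcol v m.
Proof. by rewrite -{1}(submxcolK v) -{1}(submxblockK A) mul_mxblock_mxrow mxcolK. Qed.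

Lemma mulmx_blocks (R : realType) (p : nat) (p_ : 'I_p -> nat) r s
    (v : 'M[R]_(r, \sum_k p_ k)) (u : 'M[R]_(\sum_k p_ k, s)) :
  v *m u = \sum_k submxrow v k *m submxcol u k.
Proof. by rewrite -{1}(submxrowK v) -{1}(submxcolK u) mul_mxrow_mxcol. Qed.

Lemma submxblock1 (R : realType) (p : nat) (p_ : 'I_p -> nat) k m :
  submxblock (1%:M : 'M[R]_(\sum_k p_ k)) k m =
    if k == m then pid_mx (p_ k) else 0.
Proof.
apply/matrixP => a b; rewrite !mxE.
have -> : (tagnat.Rank k a == tagnat.Rank m b) = (Tagged (fun k => 'I_(p_ k)) a == Tagged (fun k => 'I_(p_ k)) b).
  by rewrite /tagnat.Rank (inj_eq (@tagnat.rank_inj _ _)).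
case: (eqVneq k m) b => [<-|km] b.
  by rewrite eq_Tagged/= mxE ltn_ord andbT.
by rewrite mxE -tag_eqE /tag_eq/= (negbTE km).
Qed.

(** Iterating gives v Q^m <= l^m v, and by irreducibility some power of Q carries a positive entry
    of v to any given position. *)
Lemma supersolution_pos (R : realType) n (Q : 'M[R]_n) (v : 'rV[R]_n) (l : R) :
  nneg_mx Q -> irreducible_mx Q -> 0 < l -> nneg_mx v -> v != 0 ->
  nneg_mx (l *: v - v *m Q) -> pos_mx v.
Proof.
move=> Q0 irr l0 v0 vn0 hv.
have h m i : (v *m Q ^+ m) 0 i <= l ^+ m * v 0 i.
  elim: m i => [|m IH] i; first by rewrite !expr0 mulmx1 mul1r.
  rewrite exprSr -mulmxE mulmxA mxE.
  apply: (@le_trans _ _ (\sum_k l ^+ m * v 0 k * Q k i)).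
    by apply: ler_sum => k _; rewrite ler_wpM2r.
  under eq_bigr do rewrite -mulrA.
  rewrite -mulr_sumr exprSr -mulrA ler_wpM2l ?exprn_ge0 ?(ltW l0)//.
  by have := hv 0 i; rewrite !mxE subr_ge0.
have [b vb] : exists b, v 0 b != 0.
  apply/existsP; rewrite -negb_forall; apply: contra vn0 => /forallP e.
  by apply/eqP/rowP => i; rewrite mxE; apply/eqP.
move=> a i; rewrite (ord1 a); have [m _ hm] := irr b i.
have : 0 < (v *m Q ^+ m) 0 i.
  rewrite mxE (bigD1 b)//= ltr_pwDl//.
    by rewrite mulr_gt0// lt_neqAle eq_sym vb v0.
  by apply: sumr_ge0 => k _; rewrite mulr_ge0//; exact: nneg_exp.
move=> /lt_le_trans/(_ (h m i)); rewrite pmulr_rgt0// exprn_gt0//.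
Qed.

Section Structure.
Variables (R : realType) (K J : nat) (d : 'I_K.+1 -> nat).
Hypothesis d_gt0 : forall k, (0 < d k)%N.
Variable M : 'M[R]_(\sum_k d k).
Hypothesis M_ge0 : forall a b, 0 <= M a b.
Hypothesis M_balanced : balanced M.
Hypothesis M_triangular : block_upper_triangular M.
Variable mu : 'I_K.+1 -> R.
Hypothesis mu_character : forall k, is_character (submxblock M k k) (mu k).
Variable i : 'I_J.+1 -> 'I_K.+1.
Hypothesis i_maxima : running_maxima mu i.
Hypothesis M_increasing : increasing_order M mu i.
Variables (pi : forall k, 'rV[R]_(d k)) (zeta : forall k, 'cV[R]_(d k)).
Hypothesis pi_zeta : forall k, irreducible_mx (submxblock M k k) ->
  normalized_eigenvectors (submxblock M k k) (mu k) (pi k) (zeta k).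
Variable W : forall (j : 'I_J.+1) (k : 'I_K.+1), 'M[R]_(d (i j), d k).
Hypothesis W_def : is_cluster_W M mu W.
Implicit Types (m k : 'I_K.+1) (j : 'I_J.+1).

Local Notation Q := (submxblock M).
Local Notation clus := (clus i_maxima).
Local Notation lambda := (fun j => mu (i j)).

Hypothesis connected : forall j, 0 < mu (i j) -> (0 < cluster_order lambda j)%N ->
     exists2 m : 'I_K.+1, (i (previous j) <= m < i j)%N &
       submxblock M m (i j) != 0.

Let Q_ge0 := block_ge0 M_ge0.
Let perron := block_perron M_ge0 mu_character pi_zeta.
Let muge0 := mu_ge0 M_ge0 M_triangular mu_character pi_zeta.

Lemma block_row_sum k (a : 'I_(d k)) : \sum_l \sum_b Q k l a b = 1.
Proof.
have e : M *m const_mx 1 = const_mx 1 :> 'cV_(\sum_k d k).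
  apply/colP => b; rewrite !mxE -[RHS](M_balanced b).
  by apply: eq_bigr => c _; rewrite mxE mulr1.
have /matrixP/(_ a 0) := submxcol_mulmx M (const_mx 1 : 'cV[R]_(\sum_k d k)) k.
rewrite e summxE [LHS]mxE mxE => ->; apply: eq_bigr => l _.
by rewrite mxE; apply: eq_bigr => b _; rewrite !mxE mulr1.
Qed.

Lemma block_row_le1 k (a : 'I_(d k)) : \sum_b Q k k a b <= 1.
Proof.
rewrite -(block_row_sum a) [leRHS](bigD1 k)//= lerDl sumr_ge0// => l _.
by apply: sumr_ge0 => b _; exact: Q_ge0.
Qed.

Lemma last_block_row (a : 'I_(d ord_max)) : \sum_b Q ord_max ord_max a b = 1.
Proof.
rewrite -(block_row_sum a) [RHS](bigD1 ord_max)//= [X in _ = _ + X]big1 ?addr0// => l lK.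
have [-> //] := M_triangular; first by rewrite big1// => b _; rewrite mxE.
by rewrite ltn_neqAle -ltnS ltn_ord andbT; apply: contra lK => /eqP e; apply/eqP/val_inj.
Qed.

Lemma mu_le1 k : mu k <= 1.
Proof.
have [_ /(_ k)[irr|/(mu_character k).2 ->//]] := M_triangular.
exact: (perron_value_le1 (@Q_ge0 k k) irr ((mu_character k).1 irr) (pi_zeta irr)
  (@block_row_le1 k)).
Qed.

Lemma last_irreducible : irreducible_mx (Q ord_max ord_max).
Proof.
have [_ /(_ ord_max)[//|Q0]] := M_triangular.
have := last_block_row (Ordinal (d_gt0 ord_max)); rewrite Q0.
by rewrite big1 => [/eqP|b _]; rewrite ?mxE// eq_sym oner_eq0.
Qed.

Lemma mu_last : mu ord_max = 1.
Proof.
have irr := last_irreducible.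
by apply/(perron_value_eq1 (@Q_ge0 _ _) irr ((mu_character _).1 irr) (pi_zeta irr)
  (@block_row_le1 _)); exact: last_block_row.
Qed.

Lemma i_last : i ord_max = ord_max.
Proof.
have [//|ne] := eqVneq (i ord_max) ord_max.
have h : clus ord_max = ord_max.
  by apply: clus_eq; rewrite /in_cluster /cluster_end ltnn leq_ord/= ltnSn.
have := @mu_nonleader _ _ _ mu i i_maxima ord_max; rewrite h eq_sym => /(_ ne).
by rewrite mu_last ltNge mu_le1.
Qed.

(** Otherwise the cluster p before the last also has character 1. Its leading block then has full
    row sums, so it feeds no other block. The last block must be fed by another block of p, so the
    block right after the leader lies in p; the increasing order requires the leader to feed that
    one, a contradiction. *)
Lemma lambda_lt1 j : (j < J)%N -> mu (i j) < 1.
Proof.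
move=> jJ; rewrite lt_neqAle mu_le1 andbT; apply/eqP => m1.
have lJ : mu (i ord_max) = 1 by rewrite i_last mu_last.
have kJ : (0 < cluster_order lambda ord_max)%N.
  apply/card_gt0P; exists j; rewrite inE jJ m1 lJ eqxx//.
have [|m mr Qm] := connected _ kJ; first by rewrite lJ.
have [J0 lp _] := kappa_gt0 i_maxima kJ.
set p := previous ord_max in mr lp *.
have pJ : (p < J)%N by rewrite /p previousE// prednK.
have irr : irreducible_mx (Q (i p) (i p)).
  have [_ /(_ (i p))[//|/(mu_character (i p)).2 z]] := M_triangular.
  by move: lp; rewrite z lJ => /eqP; rewrite eq_sym oner_eq0.
have full : forall a, \sum_b Q (i p) (i p) a b = 1.
  apply/(perron_value_eq1 (@Q_ge0 _ _) irr ((mu_character _).1 irr) (pi_zeta irr)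
    (@block_row_le1 _)).
  by rewrite lp.
have zero l : l != i p -> Q (i p) l = 0.
  move=> lp0; apply/matrixP => a b; rewrite [RHS]mxE; apply/le_anti; rewrite Q_ge0 andbT.
  have := block_row_sum a; rewrite (bigD1 (i p))//= full => /eqP.
  rewrite -subr_eq0 addrAC subrr add0r (bigD1 l)//= (bigD1 b)//= -addrA => /eqP e.
  rewrite -e lerDl addr_ge0// ?sumr_ge0// => [c _|c _]; first exact: Q_ge0.
  by apply: sumr_ge0 => b' _; exact: Q_ge0.
have [e|ne] := eqVneq m (i p).
  case/andP: mr => _ mi; move: Qm; rewrite e zero ?eqxx//.
  by apply: contraTneq mi => e2; rewrite e e2 ltnn.
have pm : (i p < m)%N by case/andP: mr => h _; rewrite ltn_neqAle h andbT eq_sym; apply: contra ne => /eqP/val_inj ->.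
have cend : cluster_end i p = i ord_max.
  rewrite /cluster_end pJ; congr (nat_of_ord (i _)); apply: val_inj.
  by rewrite /= /p previousE// prednK// inordK.
have h3 : ((i p).+1 < K.+1)%N by apply: leq_ltn_trans pm (ltn_ord m).
have [_ /(_ p (Ordinal h3) pJ)] := M_increasing.
rewrite cend /= ltnSn/= => /(_ _)[].
  by apply: leq_ltn_trans pm _; case/andP: mr.
move=> m' m'r Qm' _.
have e : m' = i p by apply/val_inj/eqP; rewrite /= eqn_leq andbC -ltnS.
move: Qm'; rewrite e zero ?eqxx//.
by apply/eqP => /(congr1 val)/= /eqP; rewrite gtn_eqF.
Qed.

Lemma leader_data j : 0 < mu (i j) ->
  [/\ irreducible_mx (Q (i j) (i j)), pos_mx (pi (i j)) & pos_mx (zeta (i j))].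
Proof.
move=> l0; have [_ /(_ (i j))[irr|/(mu_character (i j)).2 z]] := M_triangular.
  by have [] := perron irr.
by move: l0; rewrite z ltxx.
Qed.

Lemma nneg_neq0 n (v : 'rV[R]_n) : nneg_mx v -> v != 0 -> exists c, 0 < v 0 c.
Proof.
move=> v0 vn0; have [b vb] : exists b, v 0 b != 0.
  apply/existsP; rewrite -negb_forall; apply: contra vn0 => /forallP e.
  by apply/eqP/rowP => c; rewrite mxE; apply/eqP.
by exists b; rewrite lt_neqAle eq_sym vb v0.
Qed.

Lemma pos_mul_neq0 n p (v : 'rV[R]_n) (A : 'M[R]_(n, p)) :
  pos_mx v -> nneg_mx A -> A != 0 -> v *m A != 0.
Proof.
move=> v0 A0 An0.
have [a [b ab]] : exists a b, A a b != 0.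
  apply: contrapT => h; move/negP: An0; apply; apply/eqP/matrixP => a b.
  rewrite mxE; apply/eqP; apply: contraT => hab; case: h; by exists a, b.
apply/eqP => /rowP/(_ b)/eqP; rewrite [X in _ == X]mxE gt_eqF//.
apply: pos_mulmx => //; exists a; by rewrite lt_neqAle eq_sym ab A0.
Qed.

(** By induction the row v = u (lambda - Q_m)^-1 comes from u >= 0, which is nonzero by condition
    (ii) of the increasing order. Positivity of v follows from irreducibility of Q_m, or from d m =
    1 when Q_m = 0. *)
Lemma weight_row_gt0 j m : (j < J)%N -> 0 < mu (i j) -> in_cluster i j m ->
  pos_mx (pi (i j) *m W j m).
Proof.
move=> jJ l0; have [irr p0 z0] := leader_data l0.
have [n] := ubnP (m : nat); elim: n m => // n IH m; rewrite ltnS => mn jm.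
have [->|mi] := eqVneq m (i j); first by have [-> _] := W_def j; rewrite mulmx1.
have ce := clus_eq i_maxima jm.
have mi' : m != i (clus m) by rewrite ce.
have jm' : (i j < m < cluster_end i j)%N by have := clus_nonleader mi'; rewrite ce.
have mul : mu m < mu (i j) by have := mu_nonleader mi'; rewrite ce.
pose u := \sum_(m' < K.+1 | (i j <= m' < m)%N) pi (i j) *m W j m' *m Q m' m.
have inm m' : (i j <= m' < m)%N -> in_cluster i j m'.
  move=> /andP[a b]; rewrite /in_cluster a/=.
  by apply: ltn_trans b _; case/andP: jm'.
have pos m' : (i j <= m' < m)%N -> pos_mx (pi (i j) *m W j m').
  move=> h; apply: IH; last exact: inm.
  by case/andP: h => _ h; exact: leq_trans h mn.
have u0 : nneg_mx u.
  move=> a b; rewrite summxE; apply: sumr_ge0 => m' h.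
  by apply: nneg_mulmx => // c e; exact/ltW/pos.
have un0 : u != 0.
  have [_ /(_ j m jJ jm')[m' m'r Qm'] _] := M_increasing.
  have := pos_mul_neq0 (pos m' m'r) (@Q_ge0 m' m) Qm'.
  apply: contra => /eqP/rowP e; apply/eqP/rowP => b; rewrite [RHS]mxE.
  have := e b; rewrite [RHS]mxE summxE => /eqP; rewrite psumr_eq0.
    by move=> /allP/(_ m'); rewrite mem_index_enum m'r => /(_ isT)/eqP.
  move=> m2 h; apply: nneg_mulmx => // c e2; exact/ltW/pos.
have [z zpos zE] := block_weight M_ge0 M_triangular mu_character pi_zeta m.
have mul' : 0 <= mu m < mu (i j) by rewrite muge0.
have uW : pi (i j) *m W j m = u *m invmx ((mu (i j))%:M - Q m m).
  have [_ /(_ m jJ jm') ->] := W_def j.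
  by rewrite mulmx_sumr mulmx_suml; apply: eq_bigr => m' _; rewrite !mulmxA.
have unit := nonleading_unitmx (@Q_ge0 m m) zpos zE mul'.
have inv0 := nonleading_invmx_ge0 (@Q_ge0 m m) zpos zE mul'.
rewrite uW; set v := u *m _.
have v0 : nneg_mx v by exact: nneg_mulmx.
have vE : v *m ((mu (i j))%:M - Q m m) = u by rewrite mulmxKV.
have vn0 : v != 0 by apply: contra un0 => /eqP e; rewrite -vE e mul0mx.
have [_ /(_ m)[irrm|Qm0]] := M_triangular.
  apply: (supersolution_pos (@Q_ge0 m m) irrm l0 v0 vn0).
  by rewrite -mul_mx_scalar -mulmxBr vE.
have d1 : d m = 1%N.
  have [h _ _] := M_increasing; apply: h => // j'.
  apply: contraNneq mi => e; have := clus_leader i_maxima j'.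
  by rewrite -e ce => ->; rewrite -e.
have [c vc] := nneg_neq0 v0 vn0.
move=> a b; rewrite (ord1 a).
suff -> : b = c by [].
have lt1 (e : 'I_(d m)) : nat_of_ord e = 0%N.
  by apply/eqP; rewrite -leqn0 -ltnS; apply: leq_trans (ltn_ord e) (eq_leq d1).
by apply: val_inj; rewrite /= !lt1.
Qed.

(** Some block in the sum is nonzero by [connected]; positive rows on its left and the positive zeta
    on its right keep it from being lost. *)
Lemma cluster_w_gt0 j : 0 < mu (i j) -> (0 < cluster_order lambda j)%N ->
  0 < cluster_w M mu pi zeta W j.
Proof.
move=> l0 k0; have [j0 lp kp] := kappa_gt0 i_maxima k0.
have [irr p0 z0] := leader_data l0.
rewrite /cluster_w (gt_eqF l0) gtn_eqF//= mulr_gt0 ?invr_gt0 ?ltr0n//.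
have pJ : (previous j < J)%N.
  by rewrite previousE// prednK// -ltnS.
have lp0 : 0 < mu (i (previous j)) by rewrite lp.
have [m mr Qm] := connected l0 k0.
have inp m' : (i (previous j) <= m' < i j)%N -> in_cluster i (previous j) m'.
  by move=> h; exact: (@previous_in_cluster _ _ _ mu i i_maxima j m' k0 h).
pose u := \sum_(m < K.+1 | (i (previous j) <= m < i j)%N)
   pi (i (previous j)) *m W (previous j) m *m Q m (i j).
have uE : pi (i (previous j)) *m (\sum_(m < K.+1 | (i (previous j) <= m < i j)%N)
   W (previous j) m *m Q m (i j)) = u.
  by rewrite mulmx_sumr; apply: eq_bigr => m' _; rewrite mulmxA.
have pos m' : (i (previous j) <= m' < i j)%N ->
    pos_mx (pi (i (previous j)) *m W (previous j) m').
  by move=> h; apply: weight_row_gt0 => //; exact: inp.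
have u0 : nneg_mx u.
  move=> a b; rewrite summxE; apply: sumr_ge0 => m' h.
  by apply: nneg_mulmx => // c e; exact/ltW/pos.
have un0 : u != 0.
  have := pos_mul_neq0 (pos m mr) (@Q_ge0 m (i j)) Qm.
  apply: contra => /eqP/rowP e; apply/eqP/rowP => b; rewrite [RHS]mxE.
  have := e b; rewrite [RHS]mxE summxE => /eqP; rewrite psumr_eq0.
    by move=> /allP/(_ m); rewrite mem_index_enum mr => /(_ isT)/eqP.
  move=> m2 h; apply: nneg_mulmx => // c e2; exact/ltW/pos.
have [c uc] := nneg_neq0 u0 un0.
rewrite uE mxE (bigD1 c)//= ltr_pwDl ?mulr_gt0//.
by apply: sumr_ge0 => c' _; rewrite mulr_ge0// ltW.
Qed.

(** Back substitution from zeta upwards: row m determines the entry in block m through (l - Q_m)^-1,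
    which exists because in order 0 all earlier characters are below l. *)
Lemma right_eigenvector j : 0 < mu (i j) -> cluster_order lambda j = 0%N ->
  exists u : 'cV[R]_(\sum_k d k), [/\ M *m u = mu (i j) *: u,
    forall k, (i j < k)%N -> submxcol u k = 0 & submxcol u (i j) = zeta (i j)].
Proof.
move=> l0 k0; have [irr p0 z0] := leader_data l0; set l := mu (i j).
have [e1 e2 e3 e4] := pi_zeta irr.
have [zeroM _] := M_triangular.
pose inj k := submxrow (1%:M : 'M[R]_(\sum_k d k)) k.
have injE k (x : 'cV_(d k)) m : submxcol (inj k *m x) m = submxblock 1%:M m k *m x.
  by rewrite -submxcol_mul submxblockEh.
have injeq k (x : 'cV_(d k)) : submxcol (inj k *m x) k = x.
  by rewrite injE submxblock1 eqxx pid_mx_1 mul1mx.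
have injne k (x : 'cV_(d k)) m : m != k -> submxcol (inj k *m x) m = 0.
  by move=> mk; rewrite injE submxblock1 (negbTE mk) mul0mx.
have res k (x : 'cV_(d k)) m : submxcol (M *m (inj k *m x)) m = Q m k *m x.
  by rewrite mulmxA mul_submxrow mulmx1 -submxcol_mul -submxblockEh.
suff [u [h1 h2 h3]] : exists u : 'cV[R]_(\sum_k d k),
    [/\ forall m, submxcol (M *m u - l *: u) m = 0,
        forall k, (i j < k)%N -> submxcol u k = 0 & submxcol u (i j) = zeta (i j)].
  exists u; split=> //; apply/eqP; rewrite -subr_eq0; apply/eqP/mxcolP => m.
  by rewrite h1 submxcol0.
suff H n : (n <= i j)%N -> exists u : 'cV[R]_(\sum_k d k),
    [/\ forall m, (i j - n <= m)%N -> submxcol (M *m u - l *: u) m = 0,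
        forall k, (i j < k)%N -> submxcol u k = 0 & submxcol u (i j) = zeta (i j)].
  have [u [h1 h2 h3]] := H (i j) (leqnn _); exists u; split=> // m.
  by apply: h1; rewrite subnn.
elim: n => [_|n IH nij].
  exists (inj (i j) *m zeta (i j)); split=> [m|k|]; last exact: injeq.
    rewrite subn0 leq_eqVlt => /orP[/eqP/val_inj <-|ijm].
      by rewrite submxcolB res e2 -/l scalemxAr injeq subrr.
    rewrite submxcolB res zeroM// mul0mx scalemxAr injne ?subr0//.
    by apply: contraTneq ijm => ->; rewrite ltnn.
  by move=> ijk; apply: injne; apply: contraTneq ijk => ->; rewrite ltnn.
have [u [h1 h2 h3]] := IH (ltnW nij).
have m0K : (i j - n.+1 < K.+1)%N by apply: leq_ltn_trans (leq_subr _ _) (ltn_ord _).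
pose m0 : 'I_K.+1 := Ordinal m0K.
have m0i : (m0 < i j)%N by rewrite /= -subn_gt0 subKn.
have m0S : (i j - n = m0.+1)%N by rewrite /= -subSn// subSS.
have mul : 0 <= mu m0 < l.
  rewrite muge0/=.
  have cl : (clus m0 < j)%N by exact: clus_before.
  apply: le_lt_trans (lambda_lt i_maxima cl k0).
  have [<-//|ne] := eqVneq m0 (i (clus m0)).
  exact: ltW (mu_nonleader ne).
have [z zpos zE] := block_weight M_ge0 M_triangular mu_character pi_zeta m0.
have unit := nonleading_unitmx (@Q_ge0 m0 m0) zpos zE mul.
pose r := submxcol (M *m u - l *: u) m0.
(* The correction x in block m0 cancels the residual of row m0 and leaves the later rows untouched,
   since M is block upper triangular. *)
pose x := invmx (l%:M - Q m0 m0) *m r.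
have xE : Q m0 m0 *m x - l *: x = - r.
  by rewrite -mul_scalar_mx -mulmxBl -[Q m0 m0 - _]opprB mulNmx mulKVmx.
exists (u + inj m0 *m x); split=> [m mge|k ijk|].
- rewrite mulmxDr scalerDr opprD addrACA submxcolD [X in _ + X]submxcolB res.
  rewrite scalemxAr; have [me|mne] := eqVneq m m0.
    rewrite me injeq; apply: (etrans (congr1 (+%R r) xE)); exact: subrr.
  have m0m : (m0 < m)%N.
    by rewrite ltn_neqAle mge andbT eq_sym; apply: contra mne => /eqP/val_inj ->.
  by rewrite h1 ?m0S// zeroM// mul0mx injne// subr0 addr0.
- by rewrite submxcolD h2// injne ?addr0//; apply: contraTneq ijk => ->; rewrite -leqNgt ltnW.
- by rewrite submxcolD h3 injne ?addr0//; apply: contraTneq m0i => <-; rewrite ltnn.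
Qed.

End Structure.

(** * Noise and mean of the urn *)

Section Noise.
Variables (R : realType) (D : nat) (M : 'M[R]_D) (C0 : 'rV[R]_D).
Hypothesis M_ge0 : forall a b, 0 <= M a b.
Hypothesis M_balanced : balanced M.
Hypothesis C0_gt0 : forall a, 0 < C0 0 a.
Hypothesis C0_sum1 : \sum_a C0 0 a = 1.
Variable c0 : 'I_D.
Implicit Types (h : nat -> 'I_D) (N n : nat).

Local Notation cc := (color_counts M C0).
Local Notation Ex N phi := (path_exp M C0 N phi c0).

Definition urn_noise N h : 'rV[R]_D := row (h N) M - step R N *: (cc h N *m M).

Lemma counts_noise h N : cc h N.+1 = cc h N + step R N *: (cc h N *m M) + urn_noise N h.
Proof. by rewrite /= /urn_noise addrACA subrr addr0. Qed.

Lemma selection_mean h N (f : 'cV[R]_D) :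
  \sum_c selection_prob M C0 h N c * f c 0 = step R N * (cc h N *m f) 0 0.
Proof.
rewrite mxE mulr_sumr; apply: eq_bigr => c _.
by rewrite /selection_prob /step [in RHS]mulrA [in RHS](mulrC (_^-1)).
Qed.

Lemma noise_mulmx h N (u : 'cV[R]_D) :
  (urn_noise N h *m u) 0 0 = (M *m u) (h N) 0 - step R N * (cc h N *m (M *m u)) 0 0.
Proof.
rewrite mulmxBl -scalemxAl -mulmxA -row_mul.
by rewrite !mxE.
Qed.

Lemma noise_adapted N : forall h h', (forall n, (n < N.+1)%N -> h n = h' n) ->
  urn_noise N h = urn_noise N h'.
Proof.
move=> h h' e; rewrite /urn_noise e// (@counts_adapted _ _ _ _ N h h')// => n nN.
by apply: e; exact: ltnW.
Qed.

Lemma noise_martdiff N (k : R) (u : 'cV[R]_D) :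
  martdiff M C0 N (fun h => k * (urn_noise N h *m u) 0 0).
Proof.
split=> [h h' e|h]; first by rewrite (noise_adapted e).
rewrite /cond_exp.
under eq_bigr => c _ do
  rewrite noise_mulmx {1}/update eqxx counts_update mulrCA mulrBr.
rewrite -mulr_sumr big_split/= selection_mean sumrN -mulr_suml.
by rewrite selection_sum// mul1r subrr mulr0.
Qed.

Definition mean_counts N : 'rV[R]_D := \row_a Ex N (fun h => cc h N 0 a).

Lemma path_exp_mulmx N (u : 'cV[R]_D) :
  Ex N (fun h => (cc h N *m u) 0 0) = (mean_counts N *m u) 0 0.
Proof.
rewrite mxE; under eq_path_exp do rewrite mxE.
rewrite path_exp_sum; apply: eq_bigr => a _; rewrite !mxE mulrC -path_expZ.
by apply: eq_path_exp => h; rewrite mulrC.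
Qed.

Lemma mean_countsS N :
  mean_counts N.+1 = mean_counts N + step R N *: (mean_counts N *m M).
Proof.
apply/rowP => a; rewrite -[LHS]delta_component -path_exp_mulmx.
rewrite (@eq_path_exp _ _ _ _ _ _ _ (fun h =>
   (cc h N *m (delta_mx a 0 : 'cV_D)) 0 0 +
   (step R N * (cc h N *m (M *m (delta_mx a 0 : 'cV_D))) 0 0 +
    1 * (1 * (urn_noise N h *m (delta_mx a 0 : 'cV_D)) 0 0)))); last first.
  move=> h; rewrite counts_noise !mul1r; move: (urn_noise N h) => z.
  rewrite !mulmxDl -scalemxAl -mulmxA addrA.
  by rewrite [LHS]mxE; congr (_ + _); rewrite [LHS]mxE; congr (_ + _); rewrite [LHS]mxE.
rewrite !path_expD.
rewrite (@martdiff_exp _ _ _ _ _ N (fun=> 1))//; last exact: noise_martdiff.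
rewrite addr0 path_expZ !path_exp_adapted//; last 2 first.
- by move=> h h' e; rewrite (counts_adapted M C0 e).
- by move=> h h' e; rewrite (counts_adapted M C0 e).
by rewrite !path_exp_mulmx mulmxA !delta_component !mxE.
Qed.

Lemma entry_le1 a b : M a b <= 1.
Proof. by rewrite -(M_balanced a) (bigD1 b)//= lerDl sumr_ge0. Qed.

(** The entries of M lie in [0, 1], so the conditional second moment is at most the conditional
    mean, which is linear in the counts. *)
Lemma noise_variance N a :
  Ex N.+1 (fun h => urn_noise N h 0 a ^+ 2) <= step R N * (mean_counts N *m M) 0 a.
Proof.
rewrite -(delta_component (mean_counts N *m M)) -mulmxA -path_exp_mulmx -path_expZ /=.
apply: le_path_exp => // h; set f := M *m _; set s := _ * _.
have fE c : f c 0 = M c a by rewrite /f -colE mxE.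
have sE : \sum_c selection_prob M C0 h N c * f c 0 = s by rewrite selection_mean.
rewrite /cond_exp.
under eq_bigr => c _ do
  rewrite -delta_component noise_mulmx {1}/update eqxx counts_update -/f -/s sqrrB.
apply: (@le_trans _ _ (\sum_c selection_prob M C0 h N c *
    (f c 0 - f c 0 * s *+ 2 + s ^+ 2))).
  apply: ler_sum => c _; rewrite ler_wpM2l ?selection_ge0// lerD2r lerD2r.
  by rewrite fE expr2 ler_piMl ?entry_le1.
under eq_bigr do rewrite mulrDr mulrBr -mulrnAr mulrA.
rewrite !big_split/= sumrN -!mulr_suml sE counts_sum// divff ?pnatr_eq0// mul1r; have := sqr_ge0 s.
by rewrite expr2 => ?; lra.
Qed.

End Noise.

(** * Convergence of the color counts *)

Section Urn.
Variables (R : realType) (K J : nat) (d : 'I_K.+1 -> nat).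
Hypothesis d_gt0 : forall k, (0 < d k)%N.
Variable M : 'M[R]_(\sum_k d k).
Hypothesis M_ge0 : forall a b, 0 <= M a b.
Hypothesis M_balanced : balanced M.
Hypothesis M_triangular : block_upper_triangular M.
Variable C0 : 'rV[R]_(\sum_k d k).
Hypothesis C0_gt0 : forall a, 0 < C0 0 a.
Hypothesis C0_sum1 : \sum_a C0 0 a = 1.
Variable mu : 'I_K.+1 -> R.
Hypothesis mu_character : forall k, is_character (submxblock M k k) (mu k).
Variable i : 'I_J.+1 -> 'I_K.+1.
Hypothesis i_maxima : running_maxima mu i.
Hypothesis M_increasing : increasing_order M mu i.
Variables (pi : forall k, 'rV[R]_(d k)) (zeta : forall k, 'cV[R]_(d k)).
Hypothesis pi_zeta : forall k, irreducible_mx (submxblock M k k) ->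
  normalized_eigenvectors (submxblock M k k) (mu k) (pi k) (zeta k).
Variable W : forall (j : 'I_J.+1) (k : 'I_K.+1), 'M[R]_(d (i j), d k).
Hypothesis W_def : is_cluster_W M mu W.
Variables (disp : measure_display) (T : measurableType disp) (P : probability T R).
Variable X : nat -> T -> 'I_(\sum_k d k).
Hypothesis X_urn : urn_selection P M C0 X.
Hypothesis connected : forall j,
  0 < mu (i j) -> (0 < cluster_order (fun j => mu (i j)) j)%N ->
  exists2 m : 'I_K.+1, (i (previous j) <= m < i j)%N & submxblock M m (i j) != 0.
Implicit Types (m k : 'I_K.+1) (j : 'I_J.+1) (N n : nat).

Local Notation D := (\sum_k d k)%N.
Local Notation Q := (submxblock M).
Local Notation g := (step R).
Local Notation clus := (clus i_maxima).
Local Notation lambda := (fun j => mu (i j)).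
Local Notation kappa := (cluster_order lambda).
Local Notation lam := (block_exponent i_maxima).
Local Notation kap := (block_order i_maxima).
Local Notation a := (block_scale i_maxima).

Let mule1 := mu_le1 M_ge0 M_balanced M_triangular mu_character pi_zeta.
Let muge0 := mu_ge0 M_ge0 M_triangular mu_character pi_zeta.
Let iK : i ord_max = ord_max.
Proof. exact: (i_last d_gt0 M_ge0 M_balanced M_triangular mu_character i_maxima pi_zeta). Qed.
Let lam_ge0 k : 0 <= lam k. Proof. exact: muge0. Qed.
Let lam_le1 k : lam k <= 1. Proof. exact: mule1. Qed.
Let a_gt0 k N : 0 < a k N. Proof. exact: scale_gt0 (lam_ge0 k). Qed.

Definition blocks (x : nat -> 'rV[R]_D) k N : 'rV[R]_(d k) := submxrow (x N) k.

Lemma triangular_mulmx (v : 'rV[R]_D) k : submxrow (v *m M) k =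
  submxrow v k *m Q k k + \sum_(m < K.+1 | (m < k)%N) submxrow v m *m Q m k.
Proof.
have [zeroM _] := M_triangular.
rewrite submxrow_mulmx (bigD1 k)//=; congr (_ + _).
rewrite [LHS]big_mkcond [RHS]big_mkcond; apply: eq_bigr => m _.
have [mk|km|/val_inj ->] := ltngtP m k.
- by rewrite ifT//; apply: contraTneq mk => ->; rewrite ltnn.
- by rewrite zeroM// mulmx0; case: ifP.
- by rewrite eqxx.
Qed.

Lemma blocks_recursion (x z : nat -> 'rV[R]_D) :
  (forall N, x N.+1 = x N + g N *: (x N *m M) + z N) ->
  block_recursion M (blocks x) (blocks z).
Proof.
move=> rec k N; rewrite {1}/blocks rec /blocks -triangular_mulmx.
by apply/rowP => c; rewrite !mxE.
Qed.

(** The mean drift is O(a), so the terms are O(g / a). For a positive exponent this is at most g /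
    growth, which is summable. For exponent 0 it is g / ell^kappa, divergent if kappa = 1; but then
    the diagonal block is 0, the drift is one logarithm smaller, and the sum telescopes in 1 /
    ell. *)
Lemma drift_variance_bounded k (x : nat -> 'rV[R]_D) :
  (forall N, x N.+1 = x N + g N *: (x N *m M)) ->
  exists V, forall N, \sum_(n < N)
    (a k n.+1)^-1 ^+ 2 * (g n * l1norm (submxrow (x n *m M) k)) <= V.
Proof.
move=> rec; pose z (N : nat) : 'rV[R]_D := 0.
have l10 n : l1norm (0 : 'rV[R]_n) = 0.
  by rewrite /l1norm big1// => ? _; rewrite mxE normr0.
have z0 m N : blocks z m N = 0 by apply/rowP => c; rewrite !mxE.
have brec : block_recursion M (blocks x) (blocks z).
  by apply: blocks_recursion => N; rewrite rec addr0.
pose B := \sum_m l1norm (blocks x m 0).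
have B0 : 0 <= B by apply: sumr_ge0 => m _; exact: l1norm_ge0.
have ad : admissible M i_maxima (blocks x) (blocks z) B.
  split=> // [m|m N].
    by rewrite /B (bigD1 m)//= lerDl sumr_ge0// => ? _; exact: l1norm_ge0.
  rewrite (_ : vsum _ _ _ N = 0) ?l10// /vsum big1// => n _.
  by rewrite z0 scaler0.
have ex m : exists C, 0 <= C /\ forall N, l1norm ((a m N)^-1 *: blocks x m N) <= C * B.
  have [C C0' hC] := block_bounded M_ge0 M_triangular mu_character mule1 i_maxima pi_zeta m.
  by exists C; split=> // N; exact: hC ad N.
have [C hC] := fin_all_exists ex.
have Cge0 m : 0 <= C m by case: (hC m).
have XC m : (m < k)%N -> forall N, l1norm ((a m N)^-1 *: blocks x m N) <= C m * B.
  by move=> _; case: (hC m).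
have a_leS N : a k N <= a k N.+1 by exact: scale_leS.
have unscale (s : R) n (v : 'rV[R]_n) b : 0 < s -> l1norm (s^-1 *: v) <= b ->
    l1norm v <= b * s.
  by move=> s0; rewrite l1normZ ger0_norm ?invr_ge0 ?(ltW s0)// mulrC ler_pdivrMr.
have [l0|l0] := eqVneq (lam k) 0.
- have ki : k = i (clus k).
    by apply: (zero_cluster M_ge0 M_triangular mu_character i_maxima pi_zeta l0); exact: clusP.
  have Qk : Q k k = 0 := leader_zero M_ge0 M_triangular mu_character pi_zeta ki l0.
  have [k0|[q kq]] : kap k = 0%N \/ exists q, kap k = q.+1.
    by case: (kap k) => [|q]; [left|right; exists q].
  + have ke := first_block M_ge0 M_triangular mu_character pi_zeta ki l0 k0.
    exists 0 => N; rewrite big1// => n _.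
    rewrite triangular_mulmx Qk mulmx0 add0r big_pred0 ?l10 ?mulr0//.
    by move=> m; rewrite ke.
  have [E E0 hE] := drift_scaled_bounded M_ge0 M_triangular mu_character pi_zeta (lam_ge0 k)
    (lam_le1 k) Cge0 (fun m mk => before_orderS mk ki kq).
  have step_le n : (a k n.+1)^-1 ^+ 2 * (g n * l1norm (submxrow (x n *m M) k)) <=
      E * B * ((ell R n)^-1 - (ell R n.+1)^-1).
    have h := unscale _ _ _ _ (scale_gt0 q n (lam_ge0 k)) (hE _ _ B0 XC n).
    rewrite triangular_mulmx Qk mulmx0 add0r.
    move: h; set y := l1norm _ => h.
    have sE r N : scale 0 r N = ell R N ^+ r by rewrite /scale growth0 mul1r.
    rewrite l0 sE in h; rewrite /block_scale l0 kq sE.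
    have u0 := ell_gt0 R n; have w0 := ell_gt0 R n.+1.
    have uw : ell R n <= ell R n.+1 by rewrite ellS lerDl step_ge0.
    have w1 := ell_ge1 R n.+1.
    have -> : (ell R n)^-1 - (ell R n.+1)^-1 = g n / (ell R n * ell R n.+1).
      have /eqP gE : g n = ell R n.+1 - ell R n by rewrite ellS addrC addKr.
      by rewrite (eqP gE); field; rewrite !gt_eqF.
    apply: (@le_trans _ _ ((ell R n.+1 ^+ q.+1)^-1 ^+ 2 * (g n * (E * B * ell R n ^+ q)))).
      by rewrite ler_wpM2l ?exprn_ge0 ?invr_ge0 ?exprn_ge0 ?(ltW w0)// ler_wpM2l ?step_ge0.
    have -> : (ell R n.+1 ^+ q.+1)^-1 ^+ 2 * (g n * (E * B * ell R n ^+ q)) =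
        E * B * g n * (ell R n ^+ q / (ell R n.+1 ^+ q.+1) ^+ 2).
      by rewrite exprVn; ring.
    rewrite [leRHS]mulrA ler_wpM2l ?mulr_ge0 ?step_ge0//.
    rewrite ler_pdivrMr ?exprn_gt0// mulrC ler_pdivlMr ?mulr_gt0//.
    rewrite mulrA -exprSr expr2 ler_pM ?exprn_ge0 ?(ltW u0) ?(ltW w0)//.
      by rewrite lerXn2r ?nnegrE ?(ltW u0) ?(ltW w0).
    by rewrite exprS ler_peMr ?(ltW w0)// exprn_ege1.
  exists (E * B) => N; apply: (@le_trans _ _ (\sum_(n < N) E * B * ((ell R n)^-1 - (ell R n.+1)^-1))).
    exact: ler_sum.
  rewrite -mulr_sumr ler_piMr ?mulr_ge0//.
  have -> : \sum_(n < N) ((ell R n)^-1 - (ell R n.+1)^-1) = (ell R 0)^-1 - (ell R N)^-1.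
    elim: N => [|N IH]; first by rewrite big_ord0 subrr.
    by rewrite big_ord_recr/= IH addrA subrK.
  rewrite (_ : ell R 0 = 1); last by rewrite /ell big_ord0 addr0.
  by rewrite invr1 gerBl invr_ge0 ltW// ell_gt0.
have {}l0 : 0 < lam k by rewrite lt_neqAle eq_sym l0 lam_ge0.
have [E E0 hE] := drift_scaled_bounded M_ge0 M_triangular mu_character pi_zeta (lam_ge0 k)
    (lam_le1 k) Cge0 (fun m mk => before_orderW i_maxima mk).
pose F := absnorm (Q k k) * (C k * B) + E * B.
have F0 : 0 <= F by rewrite addr_ge0 ?mulr_ge0 ?absnorm_ge0.
have hF n : l1norm (submxrow (x n *m M) k) <= F * a k n.
  rewrite triangular_mulmx (le_trans (l1normD _ _))// mulrDl lerD//.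
    rewrite (le_trans (l1norm_mulmx _ _))// -/(absnorm _) -mulrA ler_wpM2l ?absnorm_ge0//.
    by apply: unscale => //; case: (hC k).
  exact: unscale (a_gt0 k n) (hE _ _ B0 XC n).
have [G G0 hG] := growth_series_bounded 0 (lexx 0) l0 (lam_le1 k).
exists (F * G) => N.
apply: (@le_trans _ _ (F * \sum_(n < N) g n * (growth 0 n * ell R n ^+ 0 / growth (lam k) n))).
  rewrite mulr_sumr; apply: ler_sum => n _.
  have g0 := growth_gt0 n (lam_ge0 k).
  have ga : growth (lam k) n <= a k n.
    by rewrite /block_scale /scale ler_peMr ?(ltW g0)// exprn_ege1 ?ell_ge1.
  rewrite growth0 expr0 mul1r div1r.
  apply: (@le_trans _ _ ((a k n.+1)^-1 ^+ 2 * (g n * (F * a k n)))).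
    by rewrite ler_wpM2l ?exprn_ge0 ?invr_ge0 ?(ltW (a_gt0 _ _))// ler_wpM2l ?step_ge0.
  have -> : (a k n.+1)^-1 ^+ 2 * (g n * (F * a k n)) =
     F * (g n * (a k n / a k n.+1 ^+ 2)) by rewrite exprVn; ring.
  rewrite ler_wpM2l// ler_wpM2l ?step_ge0//.
  rewrite ler_pdivrMr ?exprn_gt0// mulrC ler_pdivlMr// expr2 ler_pM ?(ltW (a_gt0 _ _)) ?(ltW g0)//.
  exact: le_trans ga (a_leS n).
by rewrite ler_wpM2l.
Qed.

Let c0 : 'I_D := tagnat.Rank ord0 (Ordinal (d_gt0 ord0)).

Local Notation counts t := (color_counts M C0 (path X t)).
Local Notation noise t := (fun N => urn_noise M C0 N (path X t)).

Lemma counts_recursion t :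
  block_recursion M (blocks (counts t)) (blocks (noise t)).
Proof. by apply: blocks_recursion => N; exact: counts_noise. Qed.

Let noise_mart k c N h : R :=
  (a k N.+1)^-1 * (urn_noise M C0 N h *m (delta_mx (tagnat.Rank k c) 0 : 'cV[R]_D)) 0 0.

Let noise_martE k c t N :
  vsum (lam k) (kap k) (blocks (noise t) k) N 0 c = mart (noise_mart c) 0 N (path X t).
Proof.
rewrite /vsum summxE; apply: eq_bigr => n _.
by rewrite /noise_mart add0n delta_component !mxE.
Qed.

Lemma noise_sum_cvg k (c : 'I_(d k)) : exists H : T -> \bar R,
  [/\ P.-integrable setT H,
   forall N t, (((vsum (lam k) (kap k) (blocks (noise t) k) N 0 c) ^+ 2)%:E <= H t)%E &
  {ae P, forall t, cvgn (fun N => vsum (lam k) (kap k) (blocks (noise t) k) N 0 c)}].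
Proof.
have [V hV] := drift_variance_bounded k
  (mean_countsS M_balanced C0_sum1 c0).
have [|n|H [iH hH cH]] := @martingale_cvg _ _ _ _ M_ge0 M_balanced C0_gt0 C0_sum1
  _ _ _ _ X_urn c0 (noise_mart c) _ V.
- by move=> N; exact: noise_martdiff.
- apply: le_trans (hV n); apply: ler_sum => m _.
  set e := tagnat.Rank k c.
  rewrite (@eq_path_exp _ _ _ _ _ _ _ (fun h =>
    (a k m.+1)^-1 ^+ 2 * (urn_noise M C0 m h 0 e ^+ 2))).
    rewrite path_expZ ler_wpM2l ?sqr_ge0//.
    apply: (le_trans (noise_variance M_ge0 M_balanced C0_gt0 C0_sum1 c0 m e)).
    rewrite ler_wpM2l ?step_ge0//.
    have := ler_l1norm (submxrow (mean_counts M C0 c0 m *m M) k) c.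
    by rewrite [submxrow _ _ _ _]mxE; apply: le_trans; exact: ler_norm.
  by move=> h; rewrite /noise_mart delta_component exprMn.
exists H; split=> // [N t|]; first by rewrite noise_martE.
apply: filterS cH => t; rewrite (_ : (fun N => _) = (mart (noise_mart c) 0)^~ (path X t))//.
by apply/funext => N; rewrite noise_martE.
Qed.

(** All columns of M in the first block vanish, so no draw changes its counts. *)
Lemma noise0 t : mu ord0 = 0 -> forall N, blocks (noise t) ord0 N = 0.
Proof.
have [i0 _ _ _] := i_maxima.
have c0E : clus ord0 = ord0 by rewrite -i0 clus_leader.
move=> m0 N; have Q0 : Q ord0 ord0 = 0.
  have [_ /(_ ord0)[irr|//]] := M_triangular.
  have [h _ _] := block_perron M_ge0 mu_character pi_zeta irr.
  by move: h; rewrite m0 ltxx.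
have col0 (v : 'rV[R]_D) : submxrow (v *m M) ord0 = 0.
  by rewrite triangular_mulmx Q0 mulmx0 big_pred0 ?addr0// => m; rewrite ltn0.
rewrite /blocks /urn_noise rowE scalemxAl -mulmxBl; exact: col0.
Qed.

Theorem urn_block_cvg : {ae P, forall t, forall k j, in_cluster i j k ->
  vcvg (block_normalized i_maxima (blocks (counts t)) k)
    (block_limit M i_maxima pi W (blocks (counts t)) j k)} /\
  {ae P, forall t, forall j, 0 < mu (i j) -> (0 < kappa j)%N ->
    block_weight_limit i_maxima (blocks (counts t)) j =
    cluster_w M mu pi zeta W j *
    block_weight_limit i_maxima (blocks (counts t)) (previous j)}.
Proof.
have H : {ae P, forall t, forall k (c : 'I_(d k)),
    cvgn (fun N => vsum (lam k) (kap k) (blocks (noise t) k) N 0 c)}.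
  apply: filter_forall => k; apply: filter_forall => c.
  by have [? [_ _]] := noise_sum_cvg c.
split; apply: filterS H => t hc.
  pose S k : 'rV[R]_(d k) := \row_c limn (fun N => vsum (lam k) (kap k) (blocks (noise t) k) N 0 c).
  have hS k : vcvg (vsum (lam k) (kap k) (blocks (noise t) k)) (S k).
    by move=> c; rewrite mxE; exact: hc.
  exact: (block_cvg M_ge0 M_triangular mu_character mule1 pi_zeta W_def iK
    (counts_recursion t) hS (@noise0 t)).
pose S k : 'rV[R]_(d k) := \row_c limn (fun N => vsum (lam k) (kap k) (blocks (noise t) k) N 0 c).
have hS k : vcvg (vsum (lam k) (kap k) (blocks (noise t) k)) (S k).
  by move=> c; rewrite mxE; exact: hc.
exact: (block_weight_limit_rec M_ge0 M_triangular mu_character mule1 pi_zeta W_def iK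
    (counts_recursion t) hS (@noise0 t)).
Qed.

(** [block_bounded] is applied on each path with B = 1 + D sqrt h, where h adds up the dominating
    functions of all noise coordinates; B^2 <= 2 + 2 D^2 h is integrable. *)
Theorem urn_dominated : exists2 G : T -> \bar R, P.-integrable setT G &
  {ae P, forall t, forall k N c,
    (((block_normalized i_maxima (blocks (counts t)) k N 0 c) ^+ 2)%:E <= G t)%E}.
Proof.
have ex k : exists Hk : 'I_(d k) -> T -> \bar R, forall c,
    P.-integrable setT (Hk c) /\ forall N t,
    (((vsum (lam k) (kap k) (blocks (noise t) k) N 0 c) ^+ 2)%:E <= Hk c t)%E.
  apply: (@fin_all_exists _ _ (fun c (H : T -> \bar R) => P.-integrable setT H /\ forall N t,
    (((vsum (lam k) (kap k) (blocks (noise t) k) N 0 c) ^+ 2)%:E <= H t)%E)) => c.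
  by have [H [? ? _]] := noise_sum_cvg c; exists H.
have [H hH] := fin_all_exists ex.
pose Hs t : \bar R := (\sum_k \sum_c H k c t)%E.
have iHs : P.-integrable setT Hs.
  rewrite /Hs; apply: integrable_sum => //= k _; apply: integrable_sum => //= c _.
  by case: (hH k c).
have exC k : exists C, 0 <= C /\ forall X xi B,
    admissible M i_maxima X xi B -> forall N, l1norm ((a k N)^-1 *: X k N) <= C * B.
  have [C C0' hC] := block_bounded M_ge0 M_triangular mu_character mule1 i_maxima pi_zeta k.
  by exists C.
have [C hC] := fin_all_exists exC.
have Cge0 k : 0 <= C k by case: (hC k).
pose Cm := \sum_k C k; pose Dn : R := D%:R.
have Cm0 : 0 <= Cm by apply: sumr_ge0 => k _.
have CCm k : C k <= Cm by rewrite /Cm (bigD1 k)//= lerDl sumr_ge0.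
exists (fun t => ((2 * Cm ^+ 2)%:E + (2 * Cm ^+ 2 * Dn ^+ 2)%:E * Hs t)%E).
  apply: integrableD => //; last exact: integrableZl.
  exact: finite_measure_integrable_cst.
have := integrable_ae measurableT iHs; apply: filterS => t /(_ I) Hfin k N c.
have H0 m b : (0 <= H m b t)%E.
  by have [_ h] := hH m b; apply: le_trans (h 0%N t); rewrite lee_fin sqr_ge0.
pose h := fine (Hs t).
have Hs0 : (0 <= Hs t)%E by apply: sume_ge0 => m _; apply: sume_ge0 => b _.
have h0 : 0 <= h by exact: fine_ge0.
have hb m b N' : (vsum (lam m) (kap m) (blocks (noise t) m) N' 0 b) ^+ 2 <= h.
  rewrite -lee_fin /h fineK//; have [_ hh] := hH m b; apply: (le_trans (hh N' t)).
  rewrite /Hs (bigD1 m)//= (bigD1 b)//= -addeA leeDl//.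
  by apply: adde_ge0; apply: sume_ge0 => // ? _; apply: sume_ge0.
have habs m b N' : `|vsum (lam m) (kap m) (blocks (noise t) m) N' 0 b| <= Num.sqrt h.
  by rewrite -sqrtr_sqr ler_wsqrtr.
pose B := 1 + Dn * Num.sqrt h.
have dD m : (d m <= D)%N by rewrite (bigD1 m)//= leq_addr.
have ad : admissible M i_maxima (blocks (counts t)) (blocks (noise t)) B.
  split; first exact: counts_recursion.
  (* C0 is a probability vector, so every block starts with l1 norm at most 1, the 1 in B. *)
  - move=> m; apply: (@le_trans _ _ 1).
      have e : (C0 *m (const_mx 1 : 'cV[R]_D)) 0 0 = 1.
        by rewrite mxE -[RHS]C0_sum1; apply: eq_bigr => b _; rewrite mxE mulr1.
      rewrite mulmx_blocks summxE (bigD1 m)//= in e.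
      rewrite -e /l1norm /blocks /=.
      rewrite (eq_bigr (fun b => C0 0 (tagnat.Rank m b))); last first.
        by move=> b _; rewrite mxE ger0_norm// ltW.
      rewrite -[leLHS]addr0 lerD//.
        by rewrite mxE; apply: ler_sum => b _; rewrite !mxE mulr1.
      apply: sumr_ge0 => m' _; rewrite mxE; apply: sumr_ge0 => b _.
      by rewrite !mxE mulr1 ltW.
    by rewrite /B lerDl mulr_ge0 ?sqrtr_ge0.
  - move=> m N'; apply: (@le_trans _ _ (\sum_(b < d m) Num.sqrt h)).
      by apply: ler_sum => b _; exact: habs.
    rewrite sumr_const card_ord -[_ *+ _]mulr_natl /B ler_wpDl// ler_wpM2r ?sqrtr_ge0//.
    by rewrite ler_nat.
have hn := (hC k).2 _ _ _ ad N.
have B0 : 0 <= B by rewrite addr_ge0 ?mulr_ge0 ?sqrtr_ge0.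
rewrite -[Hs t]fineK// -/h -EFinM -EFinD lee_fin.
apply: (@le_trans _ _ ((Cm * B) ^+ 2)).
  rewrite -real_normK ?num_real// lerXn2r ?nnegrE ?mulr_ge0//.
  apply: (le_trans (ler_l1norm _ _)); apply: (le_trans hn).
  by rewrite ler_wpM2r.
rewrite exprMn (_ : _ + _ = Cm ^+ 2 * (2 + 2 * (Dn ^+ 2 * h))); last by ring.
rewrite ler_wpM2l ?sqr_ge0// /B -[in leRHS](sqr_sqrtr h0).
have := sqr_ge0 (1 - Dn * Num.sqrt h); rewrite -exprMn.
by move: (Dn * _) => z; rewrite !expr2; nra.
Qed.

Local Notation normalized t := (block_normalized i_maxima (blocks (counts t))).
Local Notation raw_weight t := (block_weight_limit i_maxima (blocks (counts t))).

Lemma in_cluster_scale j k N : in_cluster i j k ->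
  a k N = scale (mu (i j)) (kappa j) N.
Proof. by move=> /(clus_eq i_maxima) e; rewrite /block_scale /block_exponent /block_order e. Qed.

Lemma counts_measurable k N c : measurable_fun setT (fun t => blocks (counts t) k N 0 c).
Proof.
apply: (adapted_measurable X_urn c0 (N := N) (psi := fun h => blocks (color_counts M C0 h) k N 0 c)).
by move=> h h' e; rewrite /blocks (counts_adapted M C0 e).
Qed.

Definition scaled j k N t : 'rV[R]_(d k) :=
  (N%:R `^ mu (i j) * ln N%:R ^+ kappa j)^-1 *: submxrow (counts t N) k.

(** The ratio r of the two scales converges to [growth_constant] and is therefore bounded, which
    preserves the domination. Where the denominator vanishes for small N, both sides of [scaledE]
    are 0. *)
Lemma scaled_cvg j k (L : T -> 'rV[R]_(d k)) : in_cluster i j k ->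
  (forall c, measurable_fun setT (fun t => L t 0 c)) ->
  {ae P, forall t, growth_constant (mu (i j)) *:
     block_limit M i_maxima pi W (blocks (counts t)) j k = L t} ->
  cvg_as_and_L2 P (scaled j k) L.
Proof.
move=> jk mL eL; have l01 : 0 <= mu (i j) <= 1 by rewrite muge0 mule1.
pose r N := scale (mu (i j)) (kappa j) N / (N%:R `^ mu (i j) * ln N%:R ^+ kappa j).
have rc : r @ \oo --> growth_constant (mu (i j)) := scale_asymp _ l01.
have scaledE N t : scaled j k N t = r N *: normalized t k N.
  rewrite /scaled /r /block_normalized scalerA (in_cluster_scale _ jk).
  by rewrite mulrAC divff ?mul1r// gt_eqF// scale_gt0//; case/andP: l01.
have cv : {ae P, forall t, vcvg (fun N => scaled j k N t) (L t)}.
  have [h _] := urn_block_cvg; apply: filterS2 h eL => t hc <-.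
  rewrite (_ : (fun N => _) = fun N => r N *: normalized t k N).
    by apply: vcvgZ => //; exact: hc.
  by apply/funext => N; rewrite scaledE.
split=> [|c]; first by apply: filterS cv => t; exact: vcvg_mx.
have [G iG hG] := urn_dominated.
have /cvgP/cvg_has_ub[B hB] := rc.
have rB N : `|r N| <= B by apply: hB; exists N.
have B0 : 0 <= B := le_trans (normr_ge0 _) (rB 0%N).
apply: (@dominated_L2 _ _ _ _ (fun N t => scaled j k N t 0 c) (fun t => L t 0 c)
  (fun t => (B ^+ 2)%:E * G t)%E) => //.
- move=> N; rewrite (_ : (fun t => _) = fun t =>
    (N%:R `^ mu (i j) * ln N%:R ^+ kappa j)^-1 * blocks (counts t) k N 0 c).
    by apply: measurable_funM => //; exact: counts_measurable.
  by apply/funext => t; rewrite mxE.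
- exact: integrableZl.
- by apply: filterS cv => t; exact.
- apply: filterS hG => t hG N; rewrite scaledE mxE exprMn EFinM.
  apply: lee_pmul; rewrite ?lee_fin ?sqr_ge0//.
  by rewrite -real_normK ?num_real// lerXn2r ?nnegrE.
Qed.

(* The limit exists almost everywhere only; the limsup is measurable. *)
Definition leader_sum j t : R := growth_constant (mu (i j)) *
  fine (limn_esup (fun N => (\sum_c normalized t (i j) N 0 c)%:E)).

Lemma leader_sum_measurable j : measurable_fun setT (leader_sum j).
Proof.
apply: measurable_funM => //; apply: measurableT_comp => //.
apply: measurable_fun_limn_esup => N; apply/measurable_EFinP.
apply: measurable_sum => c.
rewrite (_ : (fun t => _) = fun t => (a (i j) N)^-1 * blocks (counts t) (i j) N 0 c).
  by apply: measurable_funM => //; exact: counts_measurable.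
by apply/funext => t; rewrite mxE.
Qed.

(** Recursion on the cluster makes V_j = w_j V_(j-1) hold at every point, where limits would give it
    only almost everywhere. A fresh limit is taken at each cluster of order 0. *)
Fixpoint weight n : T -> R :=
  if n is n'.+1 then
    if kappa (inord n) == 0%N then leader_sum (inord n)
    else fun t => cluster_w M mu pi zeta W (inord n) * weight n' t
  else leader_sum (inord 0).

Lemma weight_measurable n : measurable_fun setT (weight n).
Proof.
elim: n => [|n IH] /=; first exact: leader_sum_measurable.
by case: ifP => _; [exact: leader_sum_measurable|exact: measurable_funM].
Qed.

Lemma weight_rec j t : (0 < kappa j)%N ->
  weight j t = cluster_w M mu pi zeta W j * weight (previous j) t.
Proof.
move=> k0; have [j0 _ _] := kappa_gt0 i_maxima k0.
have e : nat_of_ord j = (previous j).+1 by rewrite previousE// prednK.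
rewrite {1}e /=.
have -> : inord (previous j).+1 = j by rewrite -e inord_val.
by rewrite gtn_eqF.
Qed.

(** Almost everywhere the limits satisfy the recursion that defines [weight], and the growth
    constant is unchanged because lambda_(j-1) = lambda_j at positive order. *)
Lemma weightE : {ae P, forall t, forall j, 0 < mu (i j) ->
  weight j t = growth_constant (mu (i j)) * raw_weight t j}.
Proof.
have [h1 h2] := urn_block_cvg; apply: filterS2 h1 h2 => t hc hr.
have base j : 0 < mu (i j) ->
    leader_sum j t = growth_constant (mu (i j)) * raw_weight t j.
  move=> l0; congr (_ * _).
  have /(_ (i j) j (in_cluster_leader i_maxima j)) hv := hc.
  have : cvgn (fun N => \sum_c normalized t (i j) N 0 c).
    by apply: cvgP; apply: cvg_sumr => c _; exact: hv.
  rewrite /block_weight_limit => /cvg_ex[s hs]; rewrite (cvg_lim _ hs)//.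
  have hE : (fun N => (\sum_c normalized t (i j) N 0 c)%:E) @ \oo --> s%:E.
    by apply/cvg_EFin => //; exact: nearW.
  by rewrite is_cvg_limn_esupE ?(cvg_lim _ hE)//; exact: cvgP hE.
move=> j; have [n] := ubnP (j : nat); elim: n j => // n IH j; rewrite ltnS => jn l0.
have [k0|k0] := posnP (kappa j); last first.
  have [j0 lp _] := kappa_gt0 i_maxima k0.
  rewrite weight_rec// hr// IH ?lp//; first by rewrite mulrCA.
  by apply: leq_trans jn; rewrite previousE// prednK.
rewrite -base//; case: j {jn l0 IH} k0 => -[|m] mJ k0 /=.
  by congr (leader_sum _ t); apply: val_inj; rewrite /= inordK.
have -> : inord m.+1 = Ordinal mJ by apply: val_inj; rewrite /= inordK.
by rewrite k0 eqxx.
Qed.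

Lemma block_cvg_zero j k : in_cluster i j k -> mu (i j) = 0 ->
  cvg_as_and_L2 P (scaled j k) (fun=> (kappa j)`!%:R^-1 *:
    (submxrow C0 ord0 *m superdiagonal_prod M (nb_factors i j) k)).
Proof.
move=> jk l0; apply: scaled_cvg => //.
by apply: aeW => t; rewrite l0 growth_constant0 scale1r /block_limit l0 eqxx.
Qed.

Lemma block_cvg_pos j k : in_cluster i j k -> 0 < mu (i j) ->
  cvg_as_and_L2 P (scaled j k) (fun t => weight j t *: (pi (i j) *m W j k)).
Proof.
move=> jk l0; apply: scaled_cvg => // [c|].
  rewrite (_ : (fun t => _) = fun t => weight j t * (pi (i j) *m W j k) 0 c).
    by apply: measurable_funM => //; exact: weight_measurable.
  by apply/funext => t; rewrite mxE.
apply: filterS weightE => t h; rewrite h// /block_limit gt_eqF//.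
by rewrite scalerA.
Qed.

(** * Nondegeneracy of the limits *)

Section Nondegenerate.
Variable j : 'I_J.+1.
Hypothesis jJ : (j < J)%N.
Hypothesis l_gt0 : 0 < mu (i j).
Hypothesis kappa0 : kappa j = 0%N.
Variable u : 'cV[R]_D.
Hypothesis u_eigen : M *m u = mu (i j) *: u.
Hypothesis u_after : forall k, (i j < k)%N -> submxcol u k = 0.
Hypothesis u_leader : submxcol u (i j) = zeta (i j).
Local Notation l := (mu (i j)).
Local Notation Ex N phi := (path_exp M C0 N phi c0).

Let Z N h : R := (growth l N)^-1 * (color_counts M C0 h N *m u) 0 0.

Let l0 : 0 <= l := ltW l_gt0.

Let Z_adapted N : adapted N (Z N).
Proof. by move=> h h' e; rewrite /Z (counts_adapted M C0 e). Qed.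

Let Z_step N h : Z N.+1 h =
  Z N h + (growth l N.+1)^-1 * (urn_noise M C0 N h *m u) 0 0.
Proof.
rewrite /Z counts_noise; move: (urn_noise M C0 N h) => z.
rewrite !mulmxDl -scalemxAl -mulmxA u_eigen -scalemxAr scalerA.
move: (z *m u) (_ *m u) => {}z x.
rewrite !mxE.
have f0 := growth_factor_gt0 N l0; have g0 := growth_gt0 N l0.
by rewrite growthS; field; rewrite !gt_eqF.
Qed.

Let start (b : 'I_D) (h : nat -> 'I_D) : R := (h 0%N == b)%:R.

Let start_adapted b : adapted 1 (start b).
Proof. by move=> h h' e; rewrite /start e. Qed.

Let first_step_exp b phi : adapted 1 phi ->
  Ex 1 (fun h => start b h * phi h) = C0 0 b * phi (fun=> b).
Proof.
move=> ad; rewrite /= /cond_exp [LHS](bigD1 b)//= [X in _ + X = _]big1 ?addr0 => [|c cb].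
  rewrite /selection_prob /= divr1 /start /update/= eqxx mul1r; congr (_ * _).
  by apply: ad => n; rewrite ltnS leqn0 => ->.
by rewrite /start /update/= (negbTE cb) mul0r mulr0.
Qed.

(** By the martingale property, the mean of Z on the event that the first color is b no longer
    changes after the first draw. *)
Let start_Z_exp b N : Ex N.+1 (fun h => start b h * Z N.+1 h) = C0 0 b * Z 1 (fun=> b).
Proof.
elim: N => [|N IH]; first exact: first_step_exp (@Z_adapted 1).
rewrite (@eq_path_exp _ _ _ _ _ _ _ (fun h => start b h * Z N.+1 h +
  start b h * ((growth l N.+2)^-1 * (urn_noise M C0 N.+1 h *m u) 0 0))); last first.
  by move=> h; rewrite Z_step mulrDr.
have ad : adapted N.+1 (start b) by exact: adaptedW (start_adapted b).
rewrite path_expD [X in _ + X](martdiff_exp _ ad); last exact: noise_martdiff.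
rewrite addr0 path_exp_adapted// => h h' e.
by rewrite (ad _ _ e) (Z_adapted e).
Qed.

Let ratio k N : R := a k N / growth l N.

Let ratioE k N t : ratio k N *: normalized t k N = (growth l N)^-1 *: blocks (counts t) k N.
Proof.
rewrite /ratio /block_normalized scalerA; congr (_ *: _).
by rewrite mulrAC divff ?mul1r// gt_eqF.
Qed.

Let Z_blocks N t : Z N (path X t) =
  \sum_(k < K.+1 | (k <= i j)%N) ratio k N * (normalized t k N *m submxcol u k) 0 0.
Proof.
rewrite /Z mulmx_blocks summxE mulr_sumr [LHS](bigID (fun k : 'I_K.+1 => (k <= i j)%N))/=.
rewrite [X in _ + X]big1 ?addr0 => [|k]; last first.
  by rewrite -ltnNge => /u_after ->; rewrite mulmx0 mxE mulr0.
apply: eq_bigr => k _; have := ratioE k N t => /(congr1 (fun v => (v *m submxcol u k) 0 0)).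
rewrite -!scalemxAl -[submxrow _ k]/(blocks (counts t) k N).
by move: (blocks _ _ _ *m _) => x; rewrite !mxE => ->.
Qed.

Let ratio_cvg k : (k <= i j)%N -> (fun N => ratio k N) @ \oo --> ((k == i j)%:R : R).
Proof.
have aE k' N : scale (lam k') (kap k') N / scale l 0 N = ratio k' N.
  by rewrite /ratio /block_scale /scale expr0 mulr1.
rewrite leq_eqVlt => /orP[/eqP/val_inj ->|kj].
  rewrite eqxx; apply: cvg_near_cst; apply: nearW => N.
  rewrite -aE /block_exponent /block_order clus_leader kappa0 divff// gt_eqF//.
  exact: scale_gt0.
have -> : (k == i j) = false by apply: contraTF kj => /eqP ->; rewrite ltnn.
rewrite (_ : (fun N => _) = fun N => scale (lam k) (kap k) N / scale l 0 N).
  apply: scale_ratio_cvg0 => //; apply/orP; left.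
  by apply: (lambda_lt i_maxima) => //; exact: clus_before.
by apply/funext => N; rewrite aE.
Qed.

Let Z_cvg : {ae P, forall t, (fun N => Z N (path X t)) @ \oo --> raw_weight t j}.
Proof.
have [h _] := urn_block_cvg; apply: filterS h => t hc.
have [irr _ _] := leader_data M_ge0 M_triangular mu_character pi_zeta l_gt0.
have [_ _ _ e4] := pi_zeta irr.
rewrite (_ : (fun N => _) = fun N => \sum_(k < K.+1 | (k <= i j)%N) ratio k N *
   (normalized t k N *m submxcol u k) 0 0); last by apply/funext => N; rewrite Z_blocks.
rewrite [X in _ --> X](_ : _ = \sum_(k < K.+1 | (k <= i j)%N) (k == i j)%:R *
   (block_limit M i_maxima pi W (blocks (counts t)) (clus k) k *m submxcol u k) 0 0).
  apply: cvg_sumr => k kj; apply: cvgM; first exact: ratio_cvg.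
  have := hc k (clus k) (clusP i_maxima k).
  by move=> /(@vcvgM _ _ _ (submxcol u k) _ _)/(_ 0).
rewrite [RHS](bigD1 (i j))//= eqxx mul1r [X in _ = _ + X]big1 ?addr0 => [|k /andP[_ /negbTE ->]]; last first.
  by rewrite mul0r.
rewrite clus_leader u_leader /block_limit gt_eqF//.
have [-> _] := W_def j; rewrite mulmx1 -scalemxAl e4.
by rewrite !mxE eqxx mulr1.
Qed.

Let Z_dominated : exists2 G : T -> \bar R, P.-integrable setT G &
  {ae P, forall t, forall N, (`|Z N (path X t)|%:E <= G t)%E}.
Proof.
have [G iG hG] := urn_dominated.
have ex k : exists B, 0 <= B /\ ((k <= i j)%N -> forall N, `|ratio k N| <= B).
  have [kj|_] := boolP (k <= i j)%N; last by exists 0.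
  have /cvgP/cvg_has_ub[B hB] := ratio_cvg kj; exists B; split=> [|_ N].
    by apply: le_trans (normr_ge0 _) (hB _ _); exists 0%N.
  by apply: hB; exists N.
have [B hB] := fin_all_exists ex.
have B0 k : 0 <= B k by case: (hB k).
pose U := \sum_(k < K.+1 | (k <= i j)%N) B k * \sum_c `|submxcol u k c 0|.
exists (fun t => U%:E * (1 + G t))%E.
  by apply: integrableZl => //; apply: integrableD => //; exact: finite_measure_integrable_cst.
have := integrable_ae measurableT iG; apply: filterS2 hG => t hG /(_ I) Gfin N.
rewrite -(fineK Gfin) -EFinD -EFinM lee_fin; set g := fine (G t).
have hg k n c : `|normalized t k n 0 c| <= 1 + g.
  have := hG k n c; rewrite -(fineK Gfin) lee_fin -/g -real_normK ?num_real//.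
  move: `|_| => x; have := sqr_ge0 (x - 1); rewrite !expr2; nra.
rewrite Z_blocks mulr_suml (le_trans (ler_norm_sum _ _ _))//; apply: ler_sum => k kj.
rewrite normrM -[leRHS]mulrA ler_pM//; first by case: (hB k) => _; apply.
rewrite mxE (le_trans (ler_norm_sum _ _ _))// mulr_suml; apply: ler_sum => c _.
by rewrite normrM mulrC ler_wpM2l.
Qed.

Lemma leading_weight_nondegenerate : nondegenerate_rv P (weight j).
Proof.
move=> w hw; pose z := w / growth_constant l.
have gam0 : 0 < growth_constant l by apply: growth_constant_gt0; rewrite muge0 mule1.
have Zz : {ae P, forall t, (fun N => Z N (path X t)) @ \oo --> z}.
  have h : {ae P, forall t, weight j t = raw_weight t j * growth_constant l}.
    by apply: filterS weightE => t ->//; rewrite mulrC.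
  apply: filterS3 hw h Z_cvg => t wt h Zt.
  by rewrite /z -wt h mulfK// gt_eqF.
(* Dominated convergence on the event that the first color is b, whose probability C0 b is positive
   and can be cancelled. *)
have Z1 b : Z 1 (fun=> b) = z.
  apply: (mulfI (lt0r_neq0 (C0_gt0 b))); rewrite -(first_step_exp b (phi := fun=> z))//.
  have ad N : adapted N.+1 (fun h => start b h * Z N.+1 h).
    by move=> h h' e; rewrite (Z_adapted e) (adaptedW (ltn0Sn N) (start_adapted b) e).
  have adz : adapted 1 (fun h => start b h * z).
    by move=> h h' e; rewrite (start_adapted b e).
  have [G iG hG] := Z_dominated.
  pose f N t : \bar R := (start b (path X t) * Z N.+1 (path X t))%:E.
  pose f' t : \bar R := (start b (path X t) * z)%:E.
  have mf N : measurable_fun setT (f N).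
    by apply/measurable_EFinP; exact: (adapted_measurable X_urn c0 (ad N)).
  have mf' : measurable_fun setT f'.
    by apply/measurable_EFinP; exact: (adapted_measurable X_urn c0 adz).
  have cf : {ae P, forall t, setT t -> f ^~ t @ \oo --> f' t}.
    apply: filterS Zz => t h _; apply/cvg_EFin; first exact: nearW.
    apply: cvgM; first exact: cvg_cst.
    by move: h; rewrite -cvg_shiftS.
  have fG : {ae P, forall t N, setT t -> (`|f N t| <= G t)%E}.
    apply: filterS hG => t hG N _; apply: le_trans (hG N.+1).
    rewrite /f abse_EFin lee_fin normrM /start.
    by case: eqP => _; rewrite ?normr1 ?normr0 ?mul1r ?mul0r.
  have [_ _ hint] := dominated_convergence measurableT mf mf' cf iG fG.
  have c1 N : (\int[P]_t f N t = (C0 0%R b * Z 1 (fun=> b))%:E)%E.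
    by rewrite (integral_path_exp X_urn c0 (ad N)) start_Z_exp.
  have c2 : (\int[P]_t f' t = (Ex 1 (fun h => start b h * z))%:E)%E.
    by rewrite (integral_path_exp X_urn c0 adz).
  move: hint; rewrite c2 => hint; apply: EFin_inj.
  rewrite -(cvg_lim _ hint)//; apply/esym/cvg_lim => //.
  by apply: cvg_near_cst; apply: nearW => N; exact: c1.
have [_ _ zeta0] := leader_data M_ge0 M_triangular mu_character pi_zeta l_gt0.
(* After a first draw of b, [Z 1] is affine in the entry of u at b, with nonzero slope l /
   growth. *)
have ub b b' : u b 0 = u b' 0.
  have uE b1 : Z 1 (fun=> b1) = (growth l 1)^-1 * ((C0 *m u) 0 0 + l * u b1 0).
    by rewrite /Z /= mulmxDl -row_mul u_eigen !mxE.
  have := Z1 b; rewrite -(Z1 b') !uE => /(mulfI _) h.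
  have {}h := h (invr_neq0 (lt0r_neq0 (growth_gt0 1 l0))).
  by apply: (mulfI (lt0r_neq0 l_gt0)); exact: addrI h.
have iJ : (i j < @ord_max K)%N.
  by rewrite -iK; case: i_maxima => _ h _ _; exact: h.
pose b1 := tagnat.Rank (i j) (Ordinal (d_gt0 (i j))).
pose b2 := tagnat.Rank ord_max (Ordinal (d_gt0 ord_max)).
have := zeta0 (Ordinal (d_gt0 (i j))) 0.
rewrite -u_leader mxE (ub _ b2).
have := u_after iJ => /matrixP/(_ (Ordinal (d_gt0 ord_max)) 0).
by rewrite !mxE => ->; rewrite ltxx.
Qed.

End Nondegenerate.

Lemma weight_nondegenerate j : (j < J)%N -> 0 < mu (i j) -> nondegenerate_rv P (weight j).
Proof.
have [n] := ubnP (j : nat); elim: n j => // n IH j; rewrite ltnS => jn jJ l0.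
have [k0|k0] := posnP (kappa j).
  have [u [h1 h2 h3]] := right_eigenvector M_ge0 M_triangular mu_character i_maxima pi_zeta l0 k0.
  exact: leading_weight_nondegenerate h1 h2 h3.
have [j0 lp _] := kappa_gt0 i_maxima k0.
have w0 := cluster_w_gt0 M_ge0 M_triangular mu_character i_maxima M_increasing pi_zeta W_def connected l0 k0.
have pj : (previous j < j)%N by exact: previous_lt.
have := IH (previous j) (leq_trans pj jn) (ltn_trans pj jJ); rewrite lp => /(_ l0) H c hc.
apply: (H (c / cluster_w M mu pi zeta W j)); apply: filterS hc => t.
by rewrite weight_rec// => <-; rewrite mulrAC divff ?mul1r// gt_eqF.
Qed.

Lemma last_order : kappa ord_max = 0%N.
Proof.
apply/eqP; rewrite cards_eq0; apply/eqP/setP => j; rewrite !inE.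
apply/negP => /andP[jJ /eqP e].
have := lambda_lt1 d_gt0 M_ge0 M_balanced M_triangular mu_character i_maxima M_increasing pi_zeta connected jJ.
by rewrite e iK (mu_last d_gt0 M_ge0 M_balanced M_triangular mu_character pi_zeta) ltxx.
Qed.

Let mu_last1 : mu (i ord_max) = 1.
Proof. by rewrite iK; exact: (mu_last d_gt0 M_ge0 M_balanced M_triangular mu_character pi_zeta). Qed.

Lemma total_counts t N : \sum_k \sum_c blocks (counts t) k N 0 c = N.+1%:R.
Proof.
rewrite -(counts_sum M_balanced C0_sum1 (path X t) N).
have e (v : 'rV[R]_D) : \sum_b v 0 b = (v *m (const_mx 1 : 'cV[R]_D)) 0 0.
  by rewrite mxE; apply: eq_bigr => b _; rewrite mxE mulr1.
rewrite e mulmx_blocks summxE; apply: eq_bigr => k _.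
by rewrite mxE; apply: eq_bigr => c _; rewrite !mxE mulr1.
Qed.

(** The counts add up to N + 1, which is exactly the scale of the last block, and all other blocks
    have exponents below 1 and are negligible. *)
Lemma last_weight : {ae P, forall t, raw_weight t ord_max = 1}.
Proof.
have [h _] := urn_block_cvg; apply: filterS h => t hc.
have aE N : a (i ord_max) N = N.+1%:R.
  rewrite (in_cluster_scale _ (in_cluster_leader i_maxima _)) last_order mu_last1.
  by rewrite /scale growth1 expr0 mulr1.
have nE k N c : normalized t k N 0 c = (a k N)^-1 * blocks (counts t) k N 0 c.
  by rewrite mxE.
have sumE N : \sum_c normalized t (i ord_max) N 0 c =
    1 - \sum_(k < K.+1 | k != i ord_max)
      a k N / scale 1 0 N * \sum_c normalized t k N 0 c.
  have := total_counts t N; rewrite [LHS](bigD1 (i ord_max))//= => e.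
  have N0 : N.+1%:R != 0 :> R by rewrite pnatr_eq0.
  apply: (mulfI N0); rewrite mulrBr mulr1 -{2}e.
  rewrite [in RHS]mulr_sumr; apply/eqP; rewrite -subr_eq opprK; apply/eqP.
  congr (_ + _).
    rewrite mulr_sumr; apply: eq_bigr => c _.
    by rewrite nE aE mulVKf.
  apply: eq_bigr => k _; rewrite /scale growth1 expr0 mulr1 mulr_sumr mulr_sumr.
  apply: eq_bigr => c _; rewrite nE.
  by field; rewrite gt_eqF//= nat1r.
apply/cvg_lim => //; rewrite (funext sumE) -[X in _ --> X]subr0; apply: cvgB.
  exact: cvg_cst.
rewrite [X in _ --> X](_ : _ = \sum_(k < K.+1 | k != i ord_max) 0 *
    \sum_c block_limit M i_maxima pi W (blocks (counts t)) (clus k) k 0 c); last first.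
  by rewrite big1// => k _; rewrite mul0r.
apply: cvg_sumr => k kK; apply: cvgM; last first.
  by apply: cvg_sumr => c _; exact: hc k (clus k) (clusP i_maxima k) c.
apply: scale_ratio_cvg0 => //; apply/orP; left.
apply: (lambda_lt1 d_gt0 M_ge0 M_balanced M_triangular mu_character i_maxima M_increasing pi_zeta connected).
apply: (clus_before i_maxima (j := ord_max)).
rewrite iK ltn_neqAle -ltnS ltn_ord andbT.
by move: kK; rewrite iK; apply: contra => /eqP e; apply/eqP/val_inj.
Qed.

Lemma last_block_cvg : cvg_as_and_L2 P
  (fun N t => N%:R^-1 *: submxrow (counts t N) ord_max) (fun=> pi ord_max).
Proof.
have jK : in_cluster i ord_max ord_max.
  by have := in_cluster_leader i_maxima ord_max; rewrite iK.
have e : pi (i ord_max) *m W ord_max ord_max = pi ord_max.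
  (* The equality i ord_max = ord_max is only propositional; generalizing the block k avoids a
     cast. *)
  suff H k : k = i ord_max -> pi (i ord_max) *m W ord_max k = pi k by exact: H.
  by move=> ->; have [-> _] := W_def ord_max; rewrite mulmx1.
rewrite (_ : (fun N t => _) = scaled ord_max ord_max).
  apply: scaled_cvg => //; apply: filterS last_weight => t h.
  by rewrite /block_limit mu_last1 oner_eq0 h e growth_constant1 !scale1r.
apply/funext => N; apply/funext => t.
by rewrite /scaled mu_last1 last_order expr0 mulr1 powRr1.
Qed.

End Urn.

Theorem theorem5p3 (R : realType)
    (K J : nat) (d : 'I_K.+1 -> nat) (d_gt0 : forall k, (0 < d k)%N)
    (M : 'M[R]_(\sum_k d k)) (M_ge0 : forall a b, 0 <= M a b)
    (M_balanced : balanced M)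
    (M_triangular : block_upper_triangular M)
    (C0 : 'rV[R]_(\sum_k d k)) (C0_gt0 : forall a, 0 < C0 0 a)
    (C0_sum1 : \sum_a C0 0 a = 1)
    (mu : 'I_K.+1 -> R)
    (mu_character : forall k, is_character (submxblock M k k) (mu k))
    (i : 'I_J.+1 -> 'I_K.+1) (i_maxima : running_maxima mu i)
    (M_increasing : increasing_order M mu i)
    (pi : forall k, 'rV[R]_(d k)) (zeta : forall k, 'cV[R]_(d k))
    (pi_zeta : forall k, irreducible_mx (submxblock M k k) ->
       normalized_eigenvectors (submxblock M k k) (mu k) (pi k) (zeta k))
    (W : forall (j : 'I_J.+1) (k : 'I_K.+1), 'M[R]_(d (i j), d k))
    (W_def : is_cluster_W M mu W)
    (disp : measure_display) (T : measurableType disp) (P : probability T R)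
    (X : nat -> T -> 'I_(\sum_k d k)) (X_urn : urn_selection P M C0 X) :
  let lambda (j : 'I_J.+1) := mu (i j) in
  let kappa := cluster_order lambda in
  let C (N : nat) (t : T) := color_counts M C0 (fun n => X n t) N in
  (forall j : 'I_J.+1, 0 < lambda j -> (0 < kappa j)%N ->
     exists2 m : 'I_K.+1, (i (previous j) <= m < i j)%N &
       submxblock M m (i j) != 0) ->
  (exists V : 'I_J.+1 -> {RV P >-> R},
     [/\ forall j : 'I_J.+1, (j < J)%N -> 0 < lambda j -> nondegenerate_rv P (V j),
         forall (j : 'I_J.+1) (k : 'I_K.+1), (j < J)%N ->
           (i j <= k < cluster_end i j)%N ->
           let scaled N t :=
             (N%:R `^ lambda j * ln N%:R ^+ kappa j)^-1 *:
             submxrow (C N t) k in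
           (lambda j = 0 ->
              cvg_as_and_L2 P scaled (fun=>
                (kappa j)`!%:R^-1 *:
                (submxrow C0 ord0 *m
                 superdiagonal_prod M (nb_factors i j) k))) /\
           (0 < lambda j ->
              cvg_as_and_L2 P scaled (fun t =>
                V j t *: (pi (i j) *m W j k)))
       & forall j : 'I_J.+1, (j < J)%N -> 0 < lambda j -> (0 < kappa j)%N ->
           forall t, V j t = cluster_w M mu pi zeta W j * V (previous j) t]) /\
  cvg_as_and_L2 P (fun N t => N%:R^-1 *: submxrow (C N t) ord_max)
    (fun=> pi ord_max).
Proof.
move=> lambda kappa C connected; split; last first.
  exact: (last_block_cvg d_gt0 M_ge0 M_balanced M_triangular C0_gt0 C0_sum1
    mu_character i_maxima M_increasing pi_zeta W_def X_urn connected).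
pose V (j : 'I_J.+1) : {RV P >-> R} :=
  mfun_Sub (mem_set (weight_measurable d_gt0 i_maxima pi zeta W X_urn j)).
exists V; split=> [j jJ l0|j k jJ jk scaled|j jJ l0 k0 t].
- exact: (weight_nondegenerate d_gt0 M_ge0 M_balanced M_triangular C0_gt0 C0_sum1
    mu_character M_increasing pi_zeta W_def X_urn connected jJ l0).
- split=> [l0|l0].
    exact: (block_cvg_zero d_gt0 M_ge0 M_balanced M_triangular C0_gt0 C0_sum1
      mu_character i_maxima pi_zeta W_def X_urn jk l0).
  exact: (block_cvg_pos d_gt0 M_ge0 M_balanced M_triangular C0_gt0 C0_sum1
    mu_character i_maxima pi_zeta W_def X_urn jk l0).
- exact: weight_rec.
Qed.
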